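(* Let $s\in(0,1)$ and $\rho>0$. Then there exist $V\in C^\infty_c(B_\rho)$ and $u\in C^s(\mathbb{R}^n)$ satisfying $$\begin{cases}(-\Delta)^su=V(x)\,u&\text{in }B_\rho,\\ u=0&\text{in }\mathbb{R}^n\setminus B_\rho,\end{cases}$$ such that $u$ does not vanish identically and does not change sign in a neighborhood of $\rho e_1$ in $B_\rho$, with $$\lim_{B_\rho\ni x\to\rho e_1}\frac{u}{d^s}(x)=0.$$ Also, $u$ is rotationally symmetric.
   Context: $B_\rho$ denotes the open ball of radius $\rho$ centered at the origin of $\mathbb{R}^n$, $e_1$ is the first vector of the standard basis, and $d(x):=\mathrm{dist}(x,\partial B_\rho)$. $(-\Delta)^s$ is the fractional Laplacian, i.e. up to a positive normalization constant $(-\Delta)^sw(x)=PV\int_{\mathbb{R}^n}\frac{w(x)-w(x+y)}{|y|^{n+2s}}\,dy$, with $PV$ the principal value. *)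

(* Defs.v *)
From HB Require Import structures.
From mathcomp Require Import all_boot all_order all_algebra.
From mathcomp Require Import all_classical all_reals all_analysis.

Set Implicit Arguments.
Unset Strict Implicit.
Unset Printing Implicit Defensive.

Import Order.TTheory GRing.Theory Num.Theory.
Import numFieldNormedType.Exports.
Local Open Scope classical_set_scope.
Local Open Scope ring_scope.

Definition measure_rV_display : measure_display.
Proof. exact. Qed.

Section measurable_rV.
Context {R : realType}.
Variable n : nat.

Let coord (i : 'I_n) (x : 'rV[R]_n) : measurableTypeR R := x 0 i.

Let rV_set0 : g_sigma_preimage coord set0.
Proof. exact: sigma_algebra0. Qed.

Let rV_setC A : g_sigma_preimage coord A -> g_sigma_preimage coord (~` A).
Proof. exact: sigma_algebraC. Qed.

Let rV_bigcup (F : (set 'rV[R]_n)^nat) :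
  (forall i, g_sigma_preimage coord (F i)) ->
  g_sigma_preimage coord (\bigcup_i (F i)).
Proof. exact: sigma_algebra_bigcup. Qed.

(* The sigma-algebra generated by the coordinates; it is the Borel one. *)
HB.instance Definition _ := @isMeasurable.Build measure_rV_display
  'rV[R]_n (g_sigma_preimage coord) rV_set0 rV_setC rV_bigcup.

Lemma measurable_coord (i : 'I_n) : measurable_fun [set: 'rV[R]_n] (coord i).
Proof.
move=> _ Y mY; rewrite setTI; apply: sub_sigma_algebra => /=.
rewrite -bigcup_seq/=; exists i => /=; first by rewrite mem_index_enum.
by exists Y => //; rewrite setTI.
Qed.

Lemma measurable_fun_rV d (T : measurableType d) (f : T -> 'rV[R]_n) :
  (forall i, measurable_fun [set: T] (coord i \o f)) ->
  measurable_fun [set: T] f.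
Proof.
move=> mf; apply: (measurability (\big[setU/set0]_(i < n)
  preimage_set_system setT (coord i) measurable)) => //.
move=> _ [B + <-]; rewrite setTI -bigcup_seq => -[i _ [C mC <-]].
by rewrite setTI -[X in measurable X]setTI; exact: mf.
Qed.

End measurable_rV.

Section row_cons.
Context {R : realType}.
Variable n : nat.

Definition row_cons (p : measurableTypeR R * 'rV[R]_n) : 'rV[R]_n.+1 :=
  \row_i oapp (p.2 0) p.1 (unlift 0 i).

Lemma row_cons0 p : row_cons p 0 0 = p.1.
Proof. by rewrite mxE unlift_none. Qed.

Lemma row_cons_lift p i : row_cons p 0 (lift 0 i) = p.2 0 i.
Proof. by rewrite mxE liftK. Qed.

Lemma measurable_row_cons : measurable_fun setT row_cons.
Proof.
apply: measurable_fun_rV => i; case: (unliftP 0 i) => [j ->|->].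
  rewrite (_ : _ \o _ = (fun x : 'rV[R]_n => (x 0 j : measurableTypeR R)) \o snd).
    exact: (measurableT_comp (measurable_coord j)).
  by apply/funext => p; exact: row_cons_lift.
rewrite (_ : _ \o _ = fst); last by apply/funext => p; exact: row_cons0.
exact: measurable_fst.
Qed.

End row_cons.

Section lebesgue_rV_step.
Context {R : realType}.
Variable n : nat.
Variable m : {sigma_finite_measure set 'rV[R]_n -> \bar R}.
Local Open Scope ereal_scope.

Definition lebesgue_rV_step : set 'rV[R]_n.+1 -> \bar R :=
  pushforward (@lebesgue_measure R \x m) (@row_cons R n).

Let step0 : lebesgue_rV_step set0 = 0.
Proof. by rewrite /lebesgue_rV_step /pushforward preimage_set0 measure0. Qed.

Let step_ge0 A : 0 <= lebesgue_rV_step A.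
Proof. exact: integral_ge0. Qed.

Let step_sigma_additive : semi_sigma_additive lebesgue_rV_step.
Proof.
have mpre A : measurable A -> measurable (@row_cons R n @^-1` A).
  by move=> mA; rewrite -[X in measurable X]setTI; exact: measurable_row_cons.
move=> F mF tF mUF; rewrite /lebesgue_rV_step /pushforward preimage_bigcup.
apply: measure_semi_sigma_additive.
- by move=> k; exact: mpre.
- apply/trivIsetP => /= i j _ _ ij; rewrite -preimage_setI.
  by move/trivIsetP : tF => /(_ _ _ _ _ ij) -> //; rewrite preimage_set0.
- by rewrite -preimage_bigcup; exact: mpre.
Qed.

HB.instance Definition _ := isMeasure.Build _ _ _ lebesgue_rV_step
  step0 step_ge0 step_sigma_additive.

Lemma lebesgue_rV_stepE (A : set (measurableTypeR R)) (B : set 'rV[R]_n) :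
  measurable A -> measurable B ->
  lebesgue_rV_step [set x | A (x 0 0)%R /\ B (\row_i x 0 (lift 0 i))%R] =
  lebesgue_measure A * m B.
Proof.
move=> mA mB; rewrite -product_measure1E//; congr (product_measure1 _ _ _).
apply/seteqP; split=> -[a b] /=; rewrite row_cons0 /=.
all: have -> : (\row_i row_cons (a, b) 0 (lift 0 i) = b)%R by
  apply/rowP => i; rewrite mxE row_cons_lift.
all: by [].
Qed.

Let step_sigma_finite : sigma_finite setT lebesgue_rV_step.
Proof.
have /sigma_finiteP[F [FT ndF Foo]] := sigma_finiteT (@lebesgue_measure R).
have /sigma_finiteP[G [GT ndG Goo]] := sigma_finiteT m.
pose H k := [set x : 'rV[R]_n.+1 |
  F k (x 0 0)%R /\ G k (\row_i x 0 (lift 0 i))%R].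
have mtail : measurable_fun [set: 'rV[R]_n.+1]
    (fun x : 'rV[R]_n.+1 => (\row_i x 0 (lift 0 i))%R).
  apply: measurable_fun_rV => i.
  rewrite (_ : _ \o _ = fun x : 'rV[R]_n.+1 =>
    (x 0%R (lift 0%R i) : measurableTypeR R)); first exact: measurable_coord.
  by apply/funext => x /=; rewrite mxE.
exists H.
  apply/seteqP; split=> // x _.
  have : setT (x 0%R 0%R) by []. rewrite FT => -[i _ Fi].
  have : setT (\row_i x 0 (lift 0 i))%R by []. rewrite GT => -[j _ Gj].
  exists (maxn i j) => //; split.
    by move: Fi; exact/subsetPset/ndF/leq_maxl.
  by move: Gj; exact/subsetPset/ndG/leq_maxr.
move=> k; have [mF Fk] := Foo k; have [mG Gk] := Goo k; split.
  apply: measurableI.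
    by rewrite -[X in measurable X]setTI; exact: (measurable_coord 0%R).
  by rewrite -[X in measurable X]setTI; exact: mtail.
by rewrite lebesgue_rV_stepE// lte_mul_pinfty// ge0_fin_numE.
Qed.

HB.instance Definition _ := @Measure_isSigmaFinite.Build _ _ _
  lebesgue_rV_step step_sigma_finite.

End lebesgue_rV_step.

Fixpoint lebesgue_rV (R : realType) (n : nat) :
    {sigma_finite_measure set 'rV[R]_n -> \bar R} :=
  match n return {sigma_finite_measure set 'rV[R]_n -> \bar R} with
  | 0%N => @dirac _ 'rV[R]_0 0 R
  | n'.+1 => lebesgue_rV_step (lebesgue_rV R n')
  end.

Lemma lebesgue_rV_box (R : realType) n (A : 'I_n -> set (measurableTypeR R)) :
  (forall i, measurable (A i)) ->
  lebesgue_rV R n [set x | forall i, A i (x 0 i)] =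
  (\prod_(i < n) lebesgue_measure (A i))%E.
Proof.
elim: n A => [|n IH] A mA.
  by rewrite big_ord0 /= diracE mem_set// => -[].
have mbox : measurable [set x : 'rV[R]_n | forall i, A (lift 0 i) (x 0 i)].
  rewrite (_ : [set x | _] =
      \bigcap_(i in [set: 'I_n]) [set x : 'rV[R]_n | A (lift 0 i) (x 0 i)]).
    apply: fin_bigcap_measurable => // i _.
    by rewrite -[X in measurable X]setTI; exact: (measurable_coord i).
  by apply/seteqP; split=> [x h i _|x h i]; [exact: h|exact: (h i)].
rewrite big_ord_recl -IH// -lebesgue_rV_stepE//.
congr (lebesgue_rV_step _ _); apply/seteqP; split=> x /=.
  by move=> h; split=> // i; rewrite mxE.
move=> [h0 h] i; case: (unliftP 0 i) => [j ->|->//].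
by have := h j; rewrite mxE.
Qed.

Section euclidean.
Context {R : realType}.
Variable n : nat.
Implicit Types (x y : 'rV[R]_n) (A : set 'rV[R]_n).

(* The library norm `|x| on row vectors is the sup norm; it induces the same
   topology as the Euclidean norm. *)
Definition enorm x : R := Num.sqrt (\sum_i x 0 i ^+ 2).

Definition eball (rho : R) : set 'rV[R]_n := [set x | enorm x < rho].

Definition boundary A : set 'rV[R]_n := closure A `\` A°.

Definition dist_to A x : R := inf [set enorm (x - y) | y in A].

Fixpoint class_C (k : nat) (f : 'rV[R]_n -> R) : Prop :=
  continuous f /\
  if k is k'.+1 then
    forall i : 'I_n, (forall x, derivable f x (delta_mx 0 i)) /\
      class_C k' ('D_(delta_mx 0 i) f)
  else True.

Definition smooth (f : 'rV[R]_n -> R) : Prop := forall k, class_C k f.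

Definition test_function A (f : 'rV[R]_n -> R) : Prop :=
  let supp := closure [set x | f x != 0] in
  [/\ smooth f, compact supp & supp `<=` A].

Definition hoelder_space (s : R) (f : 'rV[R]_n -> R) : Prop :=
  (exists M : R, forall x, `|f x| <= M) /\
  (exists C : R, forall x y, `|f x - f y| <= C * enorm (x - y) `^ s).

(* "(-Delta)^s u (x) exists and equals l", with normalization constant c.  The
   truncated integrals are extended-real valued, so a finite limit forces them
   to be finite for small eps. *)
Definition is_fractional_laplacian (c s : R) (u : 'rV[R]_n -> R) x (l : R) :
    Prop :=
  (c%:E * \int[lebesgue_rV R n]_(y in [set y | (eps < enorm y)%R])
     ((u x - u (x + y)) / enorm y `^ (n%:R + 2 * s))%:E)%E
  @[eps --> 0^'+] --> l%:E.

Definition rotationally_symmetric (u : 'rV[R]_n -> R) : Prop :=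
  forall Q : 'M[R]_n, Q *m Q^T = 1%:M -> forall x, u (x *m Q) = u x.

End euclidean.

Arguments eball {R n}.

(* Main.v *)
Require Import Defs.
From HB Require Import structures.
From mathcomp Require Import all_boot all_order all_algebra.
From mathcomp Require Import all_classical all_reals all_analysis.
From mathcomp Require Import measurable_realfun.
From mathcomp Require Import ring lra.

Set Implicit Arguments.
Unset Strict Implicit.
Unset Printing Implicit Defensive.

Import Order.TTheory GRing.Theory Num.Theory.
Import numFieldNormedType.Exports.
Local Open Scope classical_set_scope.
Local Open Scope ring_scope.

(* Everything is radial: u(x) = g(|x|^2) with g(r) = int K(t) (t - r)_+^s dt and
   K supported in [0, P], P = rho^2.

   For K(t) = e^(-p t) the function u is a Gaussian; writing |y|^(-n-2s) as a
   Gamma integral of Gaussians shows that (-Delta)^s u (x) is a fixed multiple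
   of E(H)(|x|^2), where H(t) = int_t^oo K and
     E(H)(r) = int_0^oo m^(s-1) (H(r) - w^(n/2) H(w r)) dm,   w = m / (1 + m).
   Bernstein polynomials in e^(-t) and dominated convergence extend this to
   every bounded, exponentially decaying K that is continuous off one point.

   Up to a constant, E inverts the Abel-type average
     H0(t) = int_0^1 f(t v) v^(n/2-1) (1 - v)^(s-1) dv.
   Hence if H0(P) = 0 and K = - H0' on [0, P], then (-Delta)^s u = C f(|x|^2) in
   the ball, while boundedness of K makes g vanish to order s + 1 at P, which
   gives u / d^s -> 0.

   It remains to find f such that f / g is smooth: f is the difference of two
   bumps, normalized so that H0(P) = 0, the positive one living in a thin shell
   close to the sphere. Then H0 >= 0 beyond that shell, g > 0 on it and g < 0 on
   the inner shell, so V = C f / g (extended by 0) is a test function. *)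

(** Why f must change sign: g(r) equals s times the integral of (t - r)^(s-1) H0(t) over r < t < P,
    and in such an integral H0(P) is the coefficient of (P - r)^s at the sphere. H0(P) is an average
    of f with a positive weight, so a nontrivial f of one sign cannot make it vanish, in accordance
    with the Hopf lemma. With two signs, V = C f / g is only as good as g is on the support of f:
    the difficulty is to control the sign of g on both shells.

    The mechanism is a comparison of potentials normalized to be 1 at P: between a shell and the
    sphere, mass closer to the sphere has the larger potential. So the positive bump dominates
    beyond its shell. Its total effect is nevertheless proportional to its distance from the sphere,
    so far inside the negative bump wins. Only on the outer shell itself could the negative bump
    spoil the sign; making that shell thin even compared with its distance to the sphere excludes
    this. Hence two nested scales, d P and d (d P). *)

(** * Integrable functions *)

Section L1.
Context d (T : measurableType d) (R : realType) (m : {measure set T -> \bar R}).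
Implicit Types f g h : T -> R.

Definition L1 f := m.-integrable setT (EFin \o f).

Lemma L1_measurable f : L1 f -> measurable_fun setT f.
Proof. by move=> /measurable_int /measurable_EFinP. Qed.

Lemma L1_le f g : measurable_fun setT f -> (forall x, `|f x| <= g x) ->
  L1 g -> L1 f.
Proof.
move=> mf fg Lg; apply: (le_integrable measurableT _ _ Lg).
  exact/measurable_EFinP.
by move=> x _; rewrite /= lee_fin (le_trans (fg x))// ler_norm.
Qed.

Lemma L1D f g : L1 f -> L1 g -> L1 (fun x => f x + g x).
Proof. by move=> Lf Lg; exact: (integrableD measurableT Lf Lg). Qed.

Lemma L1B f g : L1 f -> L1 g -> L1 (fun x => f x - g x).
Proof. by move=> Lf Lg; exact: (integrableB measurableT Lf Lg). Qed.

Lemma L1Z f (k : R) : L1 f -> L1 (fun x => k * f x).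
Proof. by move=> Lf; exact: (integrableZl measurableT k Lf). Qed.

Lemma L10 : L1 (fun=> 0).
Proof. exact: integrable0. Qed.

Lemma L1_norm f : L1 f -> L1 (fun x => `|f x|).
Proof. by move=> Lf; exact: (integrable_norm Lf). Qed.

Lemma eq_L1 f g : f =1 g -> L1 f -> L1 g.
Proof. by move=> /funext ->. Qed.

Lemma L1_mul_bounded f h (C : R) : measurable_fun setT h ->
  (forall x, `|h x| <= C) -> L1 f -> L1 (fun x => h x * f x).
Proof.
move=> mh hC Lf; apply: (@L1_le _ (fun x => C * `|f x|)).
- by apply: measurable_funM => //; exact: L1_measurable.
- by move=> x; rewrite normrM ler_wpM2r.
- exact/L1Z/L1_norm.
Qed.

Lemma L1_ge0 f : measurable_fun setT f -> (forall x, 0 <= f x) ->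
  (\int[m]_x (f x)%:E < +oo)%E -> L1 f.
Proof.
move=> mf f0 foo; apply/integrableP; split; first exact/measurable_EFinP.
by under eq_integral do rewrite /= ger0_norm//.
Qed.

Lemma EFin_Rint f : L1 f -> (\int[m]_x f x)%:E = (\int[m]_x (f x)%:E)%E.
Proof. by move=> Lf; rewrite fineK//; exact: integrable_fin_num. Qed.

Lemma RintD f g : L1 f -> L1 g ->
  \int[m]_x (f x + g x) = \int[m]_x f x + \int[m]_x g x.
Proof. by move=> *; exact: RintegralD. Qed.

Lemma RintB f g : L1 f -> L1 g ->
  \int[m]_x (f x - g x) = \int[m]_x f x - \int[m]_x g x.
Proof. by move=> *; exact: RintegralB. Qed.

Lemma RintZ f (k : R) : L1 f -> \int[m]_x (k * f x) = k * \int[m]_x f x.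
Proof. by move=> *; exact: RintegralZl. Qed.

Lemma Rint_ge0 f : (forall x, 0 <= f x) -> 0 <= \int[m]_x f x.
Proof. by move=> f0; exact: Rintegral_ge0. Qed.

Lemma Rint_le f g : L1 f -> L1 g -> (forall x, f x <= g x) ->
  \int[m]_x f x <= \int[m]_x g x.
Proof. by move=> Lf Lg fg; exact: le_Rintegral. Qed.

Lemma Rint_norm_le f g : measurable_fun setT f -> L1 g ->
  (forall x, `|f x| <= g x) -> `|\int[m]_x f x| <= \int[m]_x g x.
Proof.
move=> mf Lg fg; have Lf := L1_le mf fg Lg.
apply: (le_trans (le_normr_Rintegral _ _)) => //.
by apply: Rint_le => //; exact: L1_norm.
Qed.

Lemma eq_Rint f g : f =1 g -> \int[m]_x f x = \int[m]_x g x.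
Proof. by move=> /funext ->. Qed.

Lemma Rint_dct (f_ : nat -> T -> R) f g :
  (forall k, measurable_fun setT (f_ k)) -> measurable_fun setT f ->
  {ae m, forall x, f_ ^~ x @ \oo --> f x} -> L1 g ->
  (forall k x, `|f_ k x| <= g x) ->
  \int[m]_x f_ k x @[k --> \oo] --> \int[m]_x f x.
Proof.
move=> mf_ mf ff Lg fg.
have [Lf _ cf] : [/\ m.-integrable setT (EFin \o f),
  [sequence \int[m]_x `|(f_ n x)%:E - (f x)%:E|]_n @ \oo --> 0 &
  [sequence \int[m]_x (EFin \o f_ n) x]_n @ \oo --> \int[m]_x (EFin \o f) x]%E.
  apply: (@dominated_convergence _ _ _ m setT measurableT
    (fun n => EFin \o f_ n) (EFin \o f) (EFin \o g)) => //.
  - by move=> k; exact/measurable_EFinP.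
  - exact/measurable_EFinP.
  - by apply: filterS ff => x fx _; exact: cvg_comp fx _.
  - by apply: aeW => x k _ /=; rewrite lee_fin.
rewrite /Rintegral; apply: fine_cvg.
by rewrite fineK//; exact: integrable_fin_num.
Qed.

Lemma Rint_gt0 f : L1 f -> (forall x, 0 <= f x) ->
  (m [set x | f x != 0%R] != 0)%E -> 0 < \int[m]_x f x.
Proof.
move=> Lf f0 mf; rewrite lt_neqAle Rint_ge0// andbT eq_sym.
apply: contra mf => /eqP If0.
have mfE : measurable_fun setT (EFin \o f).
  by apply/measurable_EFinP; exact: L1_measurable.
have : ae_eq m setT (EFin \o f) (cst 0%E).
  apply/(ae_eq_integral_abs m measurableT mfE).
  under eq_integral do rewrite /= ger0_norm//.
  by rewrite -EFin_Rint// If0.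
move=> [N [mN N0 fN]]; apply/eqP.
apply: (subset_measure0 _ mN _ N0) => //.
  rewrite (_ : [set x | _] = f @^-1` [set~ 0]); last first.
    by apply/seteqP; split=> x /=; [move/eqP|move=> /eqP].
  rewrite -[X in measurable X]setTI; apply: L1_measurable => //.
  exact: measurableC.
move=> x /= fx0; apply: fN => /= /(_ I) [fx].
by rewrite fx eqxx in fx0.
Qed.

End L1.

(** * Fubini for real-valued integrals *)

Section Fubini.
Context d1 d2 (T1 : measurableType d1) (T2 : measurableType d2) (R : realType).
Variables (m1 : {sigma_finite_measure set T1 -> \bar R}).
Variables (m2 : {sigma_finite_measure set T2 -> \bar R}).
Variable F : T1 -> T2 -> R.
Hypothesis mF : measurable_fun setT (fun z => F z.1 z.2).
Hypothesis F1 : forall x, L1 m2 (F x).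
Hypothesis LF : L1 m1 (fun x => \int[m2]_y `|F x y|).

Let iF : (m1 \x m2)%E.-integrable setT (fun z => (F z.1 z.2)%:E).
Proof.
apply/integrable12ltyP; first exact/measurable_EFinP.
under eq_integral => x _.
  rewrite /=; have := EFin_Rint (L1_norm (F1 x)); rewrite /= => <-.
  over.
by rewrite -(EFin_Rint LF) ltry.
Qed.

Lemma Rint_Fubini : (forall y, L1 m1 (F^~ y)) ->
  \int[m1]_x \int[m2]_y F x y = \int[m2]_y \int[m1]_x F x y.
Proof.
move=> F2; have := Fubini iF; rewrite /=.
under eq_integral do rewrite -(EFin_Rint (F1 _)).
under [RHS]eq_integral do rewrite -(EFin_Rint (F2 _)).
by rewrite /Rintegral => ->.
Qed.

Lemma L1_Fubini1 : L1 m1 (fun x => \int[m2]_y F x y).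
Proof.
have := integrable_fubini_F iF; apply: eq_integrable => // x _ /=.
by rewrite /fubini_F /= EFin_Rint//; exact: F1.
Qed.

(** By Tonelli the integral of |F| is finite in the other order too, and its inner integral
    dominates the function in question. *)
Lemma L1_Fubini2 : (forall y, L1 m1 (F^~ y)) ->
  L1 m2 (fun y => \int[m1]_x F x y).
Proof.
move=> F2.
have [mG fG] : measurable_fun setT (fun z => F z.1 z.2) /\ 
    (\int[m2]_y \int[m1]_x `|(F x y)%:E| < +oo)%E.
  by split=> //; apply: (integrable21ltyP _ _ _).1 iF; exact/measurable_EFinP.
have E y : (\int[m1]_x F x y)%:E = fubini_G m1 (fun z => (F z.1 z.2)%:E) y.
  by rewrite /fubini_G /= EFin_Rint//; exact: F2.
apply/integrableP; split.
  rewrite (_ : _ \o _ = fubini_G m1 (fun z => (F z.1 z.2)%:E)).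
    by have := measurable_fubini_G iF.
  by apply/funext.
apply: le_lt_trans fG; apply: ge0_le_integral => //.
- apply: measurableT_comp => //.
  rewrite (_ : EFin \o _ = fubini_G m1 (fun z => (F z.1 z.2)%:E)).
    by have := measurable_fubini_G iF.
  by apply/funext.
- apply: (measurable_fun_fubini_tonelli_G (fun z => `|(F z.1 z.2)%:E|)%E) => //=.
  apply/(measurable_EFinP setT (fun z => `|F z.1 z.2|)).
  exact: measurableT_comp.
- move=> y _; rewrite -[leLHS]/(`|(\int[m1]_x F x y)%:E|)%E E.
  by apply: le_abse_integral => //; exact: measurable_int (F2 y).
Qed.

End Fubini.

(** The extended integral is a difference of two Tonelli integrals, each measurable in x, and [fine]
    is measurable; sections with a divergent integral are thus covered. *)
Lemma measurable_Rint1 d1 d2 (T1 : measurableType d1) (T2 : measurableType d2)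
    (R : realType) (m2 : {sigma_finite_measure set T2 -> \bar R})
    (F : T1 -> T2 -> R) :
  measurable_fun setT (fun z => F z.1 z.2) ->
  measurable_fun setT (fun x => \int[m2]_y F x y).
Proof.
move=> mF; apply: measurableT_comp; first exact: fine_measurable.
pose f := fun z : T1 * T2 => (F z.1 z.2)%:E.
have mf : measurable_fun setT f by exact/measurable_EFinP.
rewrite (_ : (fun x => _) = (fun x => \int[m2]_y f^\+ (x, y))%E \-
    (fun x => \int[m2]_y f^\- (x, y))%E)%E; last first.
  apply/funext => x; rewrite [LHS]integralE.
  by congr (_ - _)%E; apply: eq_integral => y _; rewrite ?funeposE ?funenegE.
apply: emeasurable_funB; apply: measurable_fun_fubini_tonelli_F => //.
- exact: measurable_funepos.
- exact: measurable_funeneg.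
Qed.

(** * Change of variables for maps that multiply a measure by a constant *)

Section image_measure.
Context d (T : measurableType d) (R : realType) (m : {measure set T -> \bar R}).
Variables (phi : T -> T) (k : R).
Hypotheses (mphi : measurable_fun setT phi) (k0 : 0 < k).
Hypothesis mk : forall A, measurable A -> m (phi @^-1` A) = (k%:E * m A)%E.

Lemma ge0_integral_image (f : T -> \bar R) : measurable_fun setT f ->
  (forall x, 0 <= f x)%E ->
  (\int[m]_x f (phi x) = k%:E * \int[m]_x f x)%E.
Proof.
move=> mf f0; transitivity (\int[pushforward m phi]_x f x)%E.
  by rewrite ge0_integral_pushforward// preimage_setT.
have [m' m'E] : exists m' : {measure set T -> \bar R},
    forall A, m' A = mscale (NngNum (ltW k0)) m A by exists (mscale (NngNum (ltW k0)) m).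
pose phi_mixin := isMeasurableFun.Build _ _ _ _ _ mphi.
pose phi_pack : {mfun _ >-> _} := HB.pack phi phi_mixin.
transitivity (\int[mscale (NngNum (ltW k0)) m]_x f x)%E.
  apply: (@eq_measure_integral _ _ _ setT _ (pushforward m phi_pack) f).
  by move=> A mA _; exact: mk.
by rewrite ge0_integral_mscale.
Qed.

Lemma L1_image (f : T -> R) : L1 m f -> L1 m (f \o phi).
Proof.
move=> Lf; have mf := L1_measurable Lf; move: Lf => /integrableP[mf' foo].
apply/integrableP; split; first exact/measurable_EFinP/measurableT_comp.
rewrite (@ge0_integral_image (fun x => `|(f x)%:E|)%E)//; last first.
  exact: measurableT_comp.
by rewrite lte_mul_pinfty// lee_fin ltW.
Qed.

Lemma Rint_image (f : T -> R) : L1 m f ->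
  \int[m]_x f (phi x) = k * \int[m]_x f x.
Proof.
move=> Lf.
have H g : L1 m g -> (forall x, 0 <= g x) ->
    \int[m]_x g (phi x) = k * \int[m]_x g x.
  move=> Lg g0; apply: EFin_inj; rewrite EFinM !EFin_Rint//; last exact: L1_image.
  apply: (@ge0_integral_image (EFin \o g)) => [|x]; last by rewrite lee_fin.
  exact/measurable_EFinP/(L1_measurable Lg).
have Lp : L1 m f^\+ by exact: integrable_funrpos.
have Ln : L1 m f^\- by exact: integrable_funrneg.
have fE x : f x = f^\+ x - f^\- x.
  by rewrite -[in LHS](funrposBneg f).
transitivity (\int[m]_x (f^\+ (phi x) - f^\- (phi x))).
  by apply: eq_Rint => x; rewrite -fE.
rewrite RintB; [|exact: (L1_image Lp)|exact: (L1_image Ln)].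
rewrite (H _ Lp)// (H _ Ln)// -mulrBr -RintB//.
by congr (_ * _); apply: eq_Rint => x; rewrite -fE.
Qed.

End image_measure.

Section affine_change.
Context {R : realType}.
Local Notation mu := (@lebesgue_measure R).
Implicit Types f : R -> R.

Let shift (b : R) (t : measurableTypeR R) : measurableTypeR R := (t : R) + b.
Let scale (c : R) (t : measurableTypeR R) : measurableTypeR R := c * (t : R).

Let mshift b : measurable_fun setT (shift b).
Proof. exact: measurable_funD. Qed.

Let mscale c : measurable_fun setT (scale c).
Proof. exact: measurable_funM. Qed.

(** Uniqueness of Lebesgue measure reduces this to half-open intervals. The factor [1%:E] makes it
    an instance of the hypothesis [mk] on image measures. *)
Lemma lebesgue_shift b A : measurable A ->
  mu (shift b @^-1` A) = (1%:E * mu A)%E.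
Proof.
move=> mA; rewrite mul1e; apply/esym.
apply: (@lebesgue_measure_unique _ (pushforward mu (shift b))) => //.
move=> X [[x y] _ <-].
transitivity (mu `]x - b, y - b]%classic); last first.
  congr (mu _); apply/seteqP; split=> t /=; by rewrite /= !in_itv/= /shift ltrBlDr lerBrDr.
rewrite !lebesgue_measure_itv/= !lte_fin ltrD2r -!EFinB.
by rewrite (_ : y - b - (x - b) = y - x)//; ring.
Qed.

Lemma lebesgue_scale (c : R) A : 0 < c -> measurable A ->
  mu (scale c @^-1` A) = (c^-1%:E * mu A)%E.
Proof.
move=> c0 mA.
suff -> : mu A = (c%:E * mu (scale c @^-1` A))%E.
  by rewrite muleA -EFinM mulVf ?mul1e// gt_eqF.
apply: (@lebesgue_measure_unique _
  (measure_function.mscale (NngNum (ltW c0)) (pushforward mu (scale c)))) => //.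
move=> X [[x y] _ <-].
transitivity (c%:E * mu `](x / c)%R, (y / c)%R]%classic)%E; last first.
  congr (_ * mu _)%E; apply/seteqP; split=> t; rewrite /= !in_itv/= /scale.
    by rewrite ltr_pdivrMr// ler_pdivlMr// ![t * c]mulrC.
  by rewrite ltr_pdivrMr// ler_pdivlMr// ![t * c]mulrC.
rewrite !lebesgue_measure_itv/= !lte_fin ltr_pM2r ?invr_gt0//.
case: ifPn => _; last by rewrite mule0.
by rewrite -!EFinB -EFinM -mulrBl mulrC divfK// gt_eqF.
Qed.

Lemma lebesgue_opp A : measurable A ->
  mu ((fun t : measurableTypeR R => - (t : R) : measurableTypeR R) @^-1` A) = (1%:E * mu A)%E.
Proof. by move=> mA; rewrite mul1e -[RHS]lebesgue_measureN. Qed.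

Lemma L1_shift b f : L1 mu f -> L1 mu (fun t => f (t + b)).
Proof.
by move=> Lf; exact: (L1_image (mshift b) ltr01 (lebesgue_shift b) Lf).
Qed.

Lemma Rint_shift b f : L1 mu f -> \int[mu]_t f (t + b) = \int[mu]_t f t.
Proof.
by move=> Lf; rewrite (Rint_image (mshift b) ltr01 (lebesgue_shift b) Lf) mul1r.
Qed.

Lemma L1_scale c f : 0 < c -> L1 mu f -> L1 mu (fun t => f (c * t)).
Proof.
move=> c0 Lf; have ci : 0 < c^-1 by rewrite invr_gt0.
exact: (L1_image (mscale c) ci (fun A => @lebesgue_scale c A c0) Lf).
Qed.

Lemma Rint_scale c f : 0 < c -> L1 mu f ->
  \int[mu]_t f (c * t) = c^-1 * \int[mu]_t f t.
Proof.
move=> c0 Lf; have ci : 0 < c^-1 by rewrite invr_gt0.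
exact: (Rint_image (mscale c) ci (fun A => @lebesgue_scale c A c0) Lf).
Qed.

Lemma L1_opp f : L1 mu f -> L1 mu (fun t => f (- t)).
Proof.
by move=> Lf; apply: (L1_image _ ltr01 lebesgue_opp Lf); exact: oppr_measurable.
Qed.

End affine_change.

(** * Fundamental theorem of calculus, proper and improper *)

Section FTC.
Context {R : realType}.
Local Notation mu := (@lebesgue_measure R).
Implicit Types f F : R -> R.

Lemma integral_FTC f F (a b : R) : a <= b ->
  (forall x, a <= x <= b -> is_derive x 1 F (f x)) ->
  (forall x, a <= x <= b -> {for x, continuous f}) ->
  (\int[mu]_(x in `[a, b]) (f x)%:E = (F b)%:E - (F a)%:E)%E.
Proof.
rewrite le_eqVlt => /predU1P[<- _ _|ab dF cf].
  by rewrite set_itv1 integral_set1 subee.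
have cF x : a <= x <= b -> {for x, continuous F}.
  move=> /dF [d _]; apply: differentiable_continuous.
  exact/derivable1_diffP.
apply: continuous_FTC2 => //.
- apply: continuous_in_subspaceT => x /set_mem; rewrite /= in_itv /=; exact: cf.
- split.
  + by move=> x; rewrite in_itv/= => /andP[/ltW ax /ltW xb]; have [] : is_derive x 1 F (f x) by apply: dF; rewrite ax.
  + by apply: cvg_at_right_filter; apply: cF; rewrite lexx ltW.
  + by apply: cvg_at_left_filter; apply: cF; rewrite lexx ltW.
- move=> x; rewrite in_itv/= => /andP[/ltW ax /ltW xb].
  by rewrite derive1E; have [] : is_derive x 1 F (f x) by apply: dF; rewrite ax.
Qed.

(** Phrased with a truncated function integrated over the whole line, so that the rules for [L1]
    apply directly. *)
Lemma Rint_FTC f F (a b : R) : a <= b ->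
  (forall x, a <= x <= b -> is_derive x 1 F (f x)) ->
  (forall x, a <= x <= b -> {for x, continuous f}) ->
  L1 mu (fun x => if a <= x <= b then f x else 0) /\
  \int[mu]_x (if a <= x <= b then f x else 0) = F b - F a.
Proof.
move=> ab dF cf.
have E : f \_ `[a, b] = (fun x => if a <= x <= b then f x else 0).
  by apply/funext => x; rewrite patchE mem_setE in_itv.
have If : mu.-integrable `[a, b] (EFin \o f).
  apply: continuous_compact_integrable => //; first exact: segment_compact.
  apply: continuous_in_subspaceT => x /set_mem; rewrite /= in_itv /=; exact: cf.
split.
  rewrite /L1 -E -restrict_EFin; apply/integrable_restrict => //.
  by rewrite setTI.
by rewrite -E -Rintegral_mkcond /Rintegral (integral_FTC ab dF cf).
Qed.

(** Monotone convergence along the increasing intervals [a k, b k], outside whose union f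
    vanishes. *)
Lemma Rint_FTC_improper f F (a b : nat -> R) (L : R) :
  (forall k, a k.+1 <= a k) -> (forall k, b k <= b k.+1) ->
  (forall k, a k <= b k) -> measurable_fun setT f -> (forall x, 0 <= f x) ->
  (forall x, f x != 0 -> exists k, a k <= x <= b k) ->
  (forall k x, a k <= x <= b k -> is_derive x 1 F (f x)) ->
  (forall k x, a k <= x <= b k -> {for x, continuous f}) ->
  F (b k) - F (a k) @[k --> \oo] --> L ->
  L1 mu f /\ \int[mu]_x f x = L.
Proof.
move=> a1 b1 ab mf f0 fS dF cf FL.
have nd : nondecreasing_seq (fun k => `[a k, b k]%classic).
  apply/nondecreasing_seqP => k; apply/subsetPset => x /=.
  by rewrite !in_itv/= => /andP[ax xb]; rewrite (le_trans (a1 _) ax) (le_trans xb (b1 _)).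
have := @ge0_nondecreasing_set_cvg_integral _ (measurableTypeR R) R (fun k => `[a k, b k]%classic)
  (EFin \o f) mu nd.
move=> /(_ (fun k => measurable_itv _)).
have mfE : measurable_fun setT (EFin \o f) by exact/measurable_EFinP.
move=> /(_ (fun i => measurable_funTS mfE)).
move=> /(_ _)/wrap[|cI]; first by move=> i x _; rewrite lee_fin.
have cL : (\int[mu]_(x in `[a k, b k]) (f x)%:E @[k --> \oo] --> L%:E)%E.
  under eq_fun do rewrite (integral_FTC (ab _) (dF _) (cf _)) -EFinB.
  exact: cvg_comp FL _.
have IL : (\int[mu]_x (f x)%:E = L%:E)%E.
  rewrite (_ : L%:E = \int[mu]_(x in \bigcup_i `[a i, b i]%classic) (f x)%:E)%E; last first.
    exact: cvg_unique cL cI.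
  rewrite integral_mkcond [RHS]integral_mkcond; apply: eq_integral => x _.
  rewrite !patchE in_setT; case: ifPn => //.
  move=> /negP xS; rewrite /=; congr (_%:E); apply/eqP/negPn/negP => /fS [k kx].
  by apply: xS; apply/mem_set; exists k => //=; rewrite in_itv.
have Lf : L1 mu f by apply: L1_ge0 => //; rewrite IL ltry.
by split => //; rewrite /Rintegral IL.
Qed.

End FTC.

(** * Truncated powers: integrability, Gamma and Beta integrals *)

Section ppow.
Context {R : realType}.
Local Notation mu := (@lebesgue_measure R).

(* Unlike [powR], this vanishes for every [t <= 0], also when [r = 0]: [ppow 0] is
   the indicator function of the positive reals. *)
Definition ppow (r t : R) : R := if 0 < t then t `^ r else 0.

Lemma ppow_ge0 r t : 0 <= ppow r t.
Proof. by rewrite /ppow; case: ifP => // _; exact: powR_ge0. Qed.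

Lemma ppowE r t : 0 < t -> ppow r t = t `^ r.
Proof. by rewrite /ppow => ->. Qed.

Lemma ppow0 r t : t <= 0 -> ppow r t = 0.
Proof. by rewrite /ppow => t0; rewrite ltNge t0. Qed.

Lemma measurable_ppow r : measurable_fun setT (ppow r).
Proof.
by apply: measurable_fun_ifT => //; exact: measurable_fun_ltr.
Qed.

Lemma ppowM r c t : 0 < c -> ppow r (c * t) = c `^ r * ppow r t.
Proof.
move=> c0; rewrite /ppow pmulr_rgt0//; case: ifPn => t0; last by rewrite mulr0.
by rewrite powRM// ltW.
Qed.

Lemma is_derive_powR_int r (t : R) : r != -1 -> 0 < t ->
  is_derive t 1 (fun t => t `^ (r + 1) / (r + 1)) (t `^ r).
Proof.
move=> r1 t0; have r10 : r + 1 != 0 by rewrite addr_eq0.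
have -> : t `^ r = (r + 1)^-1 *: ((r + 1) * t `^ (r + 1 - 1)).
  by rewrite /GRing.scale /= addrK mulKf.
rewrite (_ : (fun _ => _) = (r + 1)^-1 \*: (@powR R ^~ (r + 1))); last first.
  by apply/funext => x; rewrite mulrC.
have := is_derive1_powR (r + 1) t0; exact: is_deriveZ.
Qed.

Lemma continuous_powR r (t : R) : 0 < t -> {for t, continuous (@powR R ^~ r)}.
Proof.
move=> t0; apply: differentiable_continuous; apply/derivable1_diffP.
by apply: derivable_powR; rewrite in_itv/= andbT.
Qed.

Lemma Rint_ppow_near0 r (b : R) : -1 < r -> 0 < b ->
  L1 mu (fun t => if t < b then ppow r t else 0) /\
  \int[mu]_t (if t < b then ppow r t else 0) = b `^ (r + 1) / (r + 1).
Proof.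
move=> r1 b0; have r10 : 0 < r + 1 by rewrite -ltrBlDr sub0r.
have k1 (k : nat) : k.+2%:R^-1 * 2 <= 1 :> R.
  by rewrite ler_pdivrMl// mulr1 ler_nat.
have kb (k : nat) : 0 < b * k.+2%:R^-1 by rewrite mulr_gt0.
have kS (k : nat) : k.+3%:R^-1 <= k.+2%:R^-1 :> R.
  by rewrite lef_pV2 ?posrE// ler_nat.
(* The intervals avoid 0, where t^r may be singular, and b, where the truncated function jumps; k +
   2 makes them nonempty already at k = 0. *)
apply: (@Rint_FTC_improper _ _ (fun t => t `^ (r + 1) / (r + 1))
  (fun k => b * k.+2%:R^-1) (fun k => b - b * k.+2%:R^-1)).
- by move=> k; rewrite ler_pM2l.
- by move=> k; rewrite lerB// ler_pM2l.
- move=> k; rewrite lerBrDr -mulrDr; apply: ler_piMr; first exact: ltW.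
  by have := k1 k; rewrite mulr_natr mulr2n.
- apply: measurable_fun_ifT; [|exact: measurable_ppow|exact: measurable_cst].
  exact: measurable_fun_ltr.
- by move=> x; case: ifP => // _; exact: ppow_ge0.
- move=> x; case: ifPn => [xb|_]; last by rewrite eqxx.
  rewrite /ppow; case: ifPn => [x0 _|_]; last by rewrite eqxx.
  pose e := Num.min (x / b) ((b - x) / b).
  have e0 : 0 < e by rewrite lt_min !divr_gt0// subr_gt0.
  have [k ke] : exists k, k.+2%:R^-1 < e.
    have [k] := ltr_add_invr e0; rewrite add0r => ke.
    by exists k; rewrite (le_lt_trans _ ke)// lef_pV2 ?posrE// ler_nat.
  exists k; rewrite -ler_pdivlMl//; apply/andP; split.
    by rewrite mulrC (le_trans (ltW ke))// ge_min lexx.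
  rewrite lerBrDr -lerBrDl -ler_pdivlMl// mulrC (le_trans (ltW ke))//.
  by rewrite ge_min lexx orbT.
- move=> k x /andP[ax xb].
  have x0 : 0 < x by rewrite (lt_le_trans _ ax).
  have -> : x < b by rewrite (le_lt_trans xb)// ltrBlDr ltrDl.
  by rewrite ppowE//; apply: is_derive_powR_int => //; rewrite gt_eqF.
- move=> k x /andP[ax xb].
  have x0 : 0 < x by rewrite (lt_le_trans _ ax).
  have xb' : x < b by rewrite (le_lt_trans xb)// ltrBlDr ltrDl.
  apply: (@cvg_trans _ (t `^ r @[t --> x])).
    apply: near_eq_cvg; near=> t; rewrite ppowE; last by near: t; exact: lt_nbhsr.
    by rewrite ifT//; near: t; exact: lt_nbhsl.
  by rewrite xb' ppowE//; exact: continuous_powR.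
- have c0 : (b * k.+2%:R^-1) @[k --> \oo] --> (0 : R).
    rewrite -(mulr0 b); apply: cvgMr.
    have := @cvg_harmonic R; rewrite -cvg_shiftS; exact.
  rewrite -[b `^ _ / _]subr0; apply: cvgB.
    apply: cvgMl.
    apply: (@continuous_cvg _ _ _ _ _ (fun k : nat => b - b * k.+2%:R^-1) (@powR R ^~ (r + 1)) b).
      exact: continuous_powR.
    by rewrite -[X in _ --> X]subr0; apply: cvgB => //; exact: cvg_cst.
  rewrite -(mul0r (r + 1)^-1); apply: cvgMl.
  have /cvg_at_rightP := powR_cvg0 r10.
  by move=> /(_ (fun k : nat => b * k.+2%:R^-1)); apply.
Unshelve. all: by end_near. Qed.

Lemma L1_ppow_nearoo r (b : R) : r < -1 -> 0 < b ->
  L1 mu (fun t => if b < t then ppow r t else 0).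
Proof.
move=> r1 b0; have r10 : r + 1 < 0 by rewrite -ltrBrDr sub0r.
have kb (k : nat) : 0 < b * k.+1%:R^-1 by rewrite mulr_gt0.
have kS (k : nat) : k.+2%:R^-1 <= k.+1%:R^-1 :> R.
  by rewrite lef_pV2 ?posrE// ler_nat.
have k1 (k : nat) : k.+1%:R^-1 <= 1 :> R.
  by rewrite invf_le1 ?ltr0n// ler1n.
suff [] : L1 mu (fun t => if b < t then ppow r t else 0) /\
  \int[mu]_t (if b < t then ppow r t else 0) = 0 - b `^ (r + 1) / (r + 1) by [].
apply: (@Rint_FTC_improper _ _ (fun t => t `^ (r + 1) / (r + 1))
  (fun k => b + b * k.+1%:R^-1) (fun k => b + b + k%:R)).
- by move=> k; rewrite lerD2l ler_pM2l.
- by move=> k; rewrite lerD2l ler_nat.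
- move=> k; rewrite -addrA lerD2l (@le_trans _ _ b)//.
    by apply: ler_piMr => //; exact: ltW.
  by rewrite lerDl.
- apply: measurable_fun_ifT; [|exact: measurable_ppow|exact: measurable_cst].
  exact: measurable_fun_ltr.
- by move=> x; case: ifP => // _; exact: ppow_ge0.
- move=> x; case: ifPn => [xb|_]; last by rewrite eqxx.
  move=> _; pose e := (x - b) / b.
  have e0 : 0 < e by rewrite divr_gt0// subr_gt0.
  have [k1' ke] := ltr_add_invr e0; rewrite add0r in ke.
  have [k2 kx] : exists k, x <= b + b + k%:R.
    exists (Num.bound `|x - (b + b)|); rewrite -lerBlDl.
    by rewrite (le_trans (ler_norm _))// ltW// archi_boundP.
  exists (maxn k1' k2); apply/andP; split.
    rewrite -lerBrDl -ler_pdivlMl// mulrC (le_trans _ (ltW ke))//.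
    by rewrite lef_pV2 ?posrE// ler_nat ltnS leq_maxl.
  by rewrite (le_trans kx)// lerD2l ler_nat leq_maxr.
- move=> k x /andP[ax xb].
  have bx : b < x by rewrite (lt_le_trans _ ax)// ltrDl.
  have x0 : 0 < x by rewrite (lt_trans b0).
  by rewrite bx ppowE//; apply: is_derive_powR_int => //; rewrite lt_eqF.
- move=> k x /andP[ax xb].
  have bx : b < x by rewrite (lt_le_trans _ ax)// ltrDl.
  have x0 : 0 < x by rewrite (lt_trans b0).
  apply: (@cvg_trans _ (t `^ r @[t --> x])).
    apply: near_eq_cvg; near=> t; rewrite ppowE; last by near: t; exact: lt_nbhsr.
    by rewrite ifT//; near: t; exact: lt_nbhsr.
  by rewrite bx ppowE//; exact: continuous_powR.
- have c0 : (b * k.+1%:R^-1) @[k --> \oo] --> (0 : R).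
    rewrite -(mulr0 b); apply: cvgMr; exact: cvg_harmonic.
  apply: cvgB; last first.
    apply: cvgMl.
    apply: (@continuous_cvg _ _ _ _ _ (fun k : nat => b + b * k.+1%:R^-1) (@powR R ^~ (r + 1)) b).
      exact: continuous_powR.
    by rewrite -[X in _ --> X]addr0; apply: cvgD => //; exact: cvg_cst.
  rewrite -(mul0r (r + 1)^-1); apply: cvgMl.
  (* A negative power at infinity is a positive power of the inverse at 0+, where the limit is
     known. *)
  have E (k : nat) : (b + b + k%:R) `^ (r + 1) = (b + b + k%:R)^-1 `^ (- (r + 1)).
    rewrite -[in RHS]powR_inv1; first by rewrite -powRrM mulN1r opprK.
    by rewrite addr_ge0// addr_ge0// ltW.
  under eq_cvg do rewrite E.
  have r11 : 0 < - (r + 1) by rewrite oppr_gt0.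
  have /cvg_at_rightP := powR_cvg0 r11.
  move=> /(_ (fun k : nat => (b + b + k%:R)^-1)); apply; split.
    by move=> k; rewrite invr_gt0 ltr_wpDr// addr_gt0.
  apply/gtr0_cvgV0; first by near=> k; rewrite ltr_wpDr// addr_gt0.
  apply: (@ger_cvgy _ _ _ _ (fun k : nat => k%:R : R)); last exact: cvgr_idn.
  by near=> k; rewrite lerDr addr_ge0// ltW.
Unshelve. all: by end_near. Qed.

Lemma L1_ppow_dom (f : R -> R) (A r1 r2 : R) : measurable_fun setT f -> 0 <= A ->
  -1 < r1 -> r2 < -1 -> (forall t, t <= 0 -> f t = 0) ->
  (forall t, 0 < t < 1 -> `|f t| <= A * t `^ r1) ->
  (forall t, 1 <= t -> `|f t| <= A * t `^ r2) -> L1 mu f.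
Proof.
move=> mf A0 r1N r2N fN f1 f2.
have [L _] := Rint_ppow_near0 r1N ltr01.
(* The tail function vanishes at its own cut point, so it is cut at 1/2 in order to cover t = 1. *)
have h2 : 0 < 2^-1 :> R by rewrite invr_gt0.
have L2 := L1_ppow_nearoo r2N h2.
apply: (L1_le (m := mu) mf _ (L1Z A (L1D L L2))) => t /=.
have [t0|t0] := leP t 0; first by rewrite fN// normr0 mulr_ge0// !ppow0// !if_same addr0.
have [t1|t1] := ltP t 1.
  rewrite ppowE// (le_trans (f1 _ _)) ?t0// ler_wpM2l// lerDl.
  by case: ifP => // _; exact: ppow_ge0.
rewrite add0r ifT; first by rewrite ppowE// f2.
by rewrite (lt_le_trans _ t1)// invf_lt1// ltr1n.
Qed.

(** Raise t/p <= e^(t/p) to the power p. *)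
Lemma powR_le_expR (p t : R) : 0 < p -> 0 <= t -> t `^ p <= p `^ p * expR t.
Proof.
move=> p0 t0; rewrite -[X in X `^ _ <= _](@mulfVK _ p) ?gt_eqF//.
rewrite mulrC powRM ?divr_ge0 ?(ltW p0)// ler_wpM2l ?powR_ge0//.
rewrite -[X in expR X](@mulfVK _ p) ?gt_eqF// expRM.
apply: ge0_ler_powR; rewrite ?nnegrE ?expR_ge0 ?divr_ge0 ?(ltW p0)//.
by apply: (le_trans _ (expR_ge1Dx _)); rewrite lerDr.
Qed.

Lemma measurable_expRN c : measurable_fun setT (fun t : R => expR (- (c * t))).
Proof.
by apply: measurableT_comp => //; apply: measurableT_comp => //.
Qed.

(** This is Euler's Gamma at r + 1: the exponent is not shifted. *)
Definition Gam r : R := \int[mu]_t (ppow r t * expR (- t)).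

Lemma L1_Gam r : -1 < r -> L1 mu (fun t => ppow r t * expR (- t)).
Proof.
move=> r1; have p0 : 0 < r + 2 by lra.
apply: (@L1_ppow_dom _ (Num.max 1 ((r + 2) `^ (r + 2))) r (-2)).
- apply: measurable_funM; first exact: measurable_ppow.
  by apply: measurableT_comp.
- by rewrite le_max ler01.
- exact: r1.
- by lra.
- by move=> t t0; rewrite ppow0// mul0r.
- move=> t /andP[t0 _]; rewrite ppowE// ger0_norm ?mulr_ge0 ?powR_ge0 ?expR_ge0//.
  rewrite mulrC ler_wpM2r ?powR_ge0// le_max.
  by rewrite -expR0 ler_expR oppr_le0 ltW.
- move=> t t1; have t0 : 0 < t by rewrite (lt_le_trans ltr01).
  rewrite ppowE// ger0_norm ?mulr_ge0 ?powR_ge0 ?expR_ge0//.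
  rewrite expRN ler_pdivrMr ?expR_gt0//.
  rewrite (_ : r = (r + 2) + -2); last by lra.
  rewrite powRD; last by rewrite (gt_eqF t0) implybT.
  rewrite mulrAC ler_wpM2r ?powR_ge0//.
  rewrite (le_trans (powR_le_expR p0 (ltW t0)))//.
  rewrite (_ : r + 2 - 2 + 2 = r + 2); last by lra.
  by rewrite ler_wpM2r ?expR_ge0// le_max lexx orbT.
Qed.

Lemma Gam_gt0 r : -1 < r -> 0 < Gam r.
Proof.
move=> r1; apply: Rint_gt0 (L1_Gam r1) _ _.
  by move=> t; rewrite mulr_ge0 ?ppow_ge0 ?expR_ge0.
rewrite (_ : [set x | _] = `]0, +oo[%classic); last first.
  apply/seteqP; split=> t /=; rewrite in_itv/= andbT.
    by apply: contraR; rewrite -leNgt => t0; rewrite ppow0// mul0r.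
  by move=> t0; rewrite ppowE// mulf_neq0// gt_eqF ?powR_gt0 ?expR_gt0.
suff : (mu `]0%R, +oo[%classic != 0)%E by [].
by rewrite lebesgue_measure_itv/= ltry.
Qed.

Lemma Rint_Gam r c : -1 < r -> 0 < c ->
  L1 mu (fun t => ppow r t * expR (- (c * t))) /\
  \int[mu]_t (ppow r t * expR (- (c * t))) = c `^ (- (r + 1)) * Gam r.
Proof.
move=> r1 c0.
have E t : ppow r t * expR (- (c * t)) =
    c `^ (- r) * (ppow r (c * t) * expR (- (c * t))).
  by rewrite ppowM// !mulrA powRN mulVf ?mul1r// gt_eqF ?powR_gt0.
have L := L1_scale c0 (L1_Gam r1).
split; first by apply: eq_L1 (L1Z (c `^ (- r)) L) => t; rewrite E.
under eq_Rintegral do rewrite E.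
rewrite RintZ// (@Rint_scale _ c (fun t => ppow r t * expR (- t)))//.
  rewrite mulrA opprD powRD; last by rewrite (gt_eqF c0) implybT.
  by rewrite powR_inv1// ltW.
exact: L1_Gam.
Qed.

Lemma powR_half_le2 (b v : R) : -1 < b -> 2^-1 <= v <= 1 -> v `^ b <= 2.
Proof.
move=> b1 /andP[v2 v1].
have v0 : 0 < v by rewrite (lt_le_trans _ v2)// invr_gt0.
have [b0|b0] := leP 0 b.
  have : v `^ b <= v `^ 0 by apply: ger_powR => //; rewrite v0.
  by rewrite powRr0; lra.
have : v `^ b <= v `^ (-1) by apply: ger_powR; rewrite ?v0// ltW.
move/le_trans; apply; rewrite powR_inv1 ?(ltW v0)//.
by rewrite -[2]invrK lef_pV2 ?posrE// invr_gt0.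
Qed.

(** On each half of [0, 1] only one factor can be singular, and the other is at most 2 because its
    exponent exceeds -1. *)
Lemma L1_Beta a b : -1 < a -> -1 < b -> L1 mu (fun v => ppow a v * ppow b (1 - v)).
Proof.
move=> a1 b1.
have [La _] := Rint_ppow_near0 a1 ltr01.
have [Lb _] := Rint_ppow_near0 b1 ltr01.
have Lb' : L1 mu (fun v => if 1 - v < 1 then ppow b (1 - v) else 0).
  have := L1_opp (L1_shift 1 Lb); apply: eq_L1 => v /=.
  by rewrite addrC.
have mS : measurable_fun setT (fun v : R => ppow a v * ppow b (1 - v)).
  apply: measurable_funM; first exact: measurable_ppow.
  by apply: measurableT_comp; [exact: measurable_ppow|exact: measurable_funB].
apply: (L1_le (m := mu) mS _ (L1Z 2 (L1D La Lb'))) => v /=.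
have RHS0 : 0 <= 2 * ((if v < 1 then ppow a v else 0) +
    (if 1 - v < 1 then ppow b (1 - v) else 0)) :> R.
  by rewrite mulr_ge0// addr_ge0//; case: ifP => // _; exact: ppow_ge0.
have [v0|v0] := leP v 0; first by rewrite (_ : _ * _ = 0) ?normr0// ppow0// mul0r.
have [v1|v1] := leP 1 v.
  have -> : ppow a v * ppow b (1 - v) = 0.
    by rewrite [ppow b _]ppow0 ?subr_le0// mulr0.
  by rewrite normr0 add0r mulr_ge0//; case: ifP => // _; exact: ppow_ge0.
rewrite ifT ?gtrBl// !ppowE ?subr_gt0//.
rewrite ger0_norm ?mulr_ge0 ?powR_ge0// mulrDr.
have [v2|v2] := leP v 2^-1.
  rewrite -[leLHS]addr0 lerD ?mulr_ge0 ?powR_ge0// mulrC ler_wpM2r ?powR_ge0//.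
  by apply: powR_half_le2 => //; lra.
rewrite -[leLHS]add0r lerD ?mulr_ge0 ?powR_ge0// ler_wpM2r ?powR_ge0//.
by apply: powR_half_le2 => //; lra.
Qed.

End ppow.

(** * Gaussian integrals and the Riesz kernel *)

Section rV_measure.
Context {R : realType}.
Local Notation mu := (@lebesgue_measure R).
Local Notation leb n := (lebesgue_rV R n).

Definition sq n (x : 'rV[R]_n) : R := \sum_i x 0 i ^+ 2.

Lemma sq_ge0 n (x : 'rV[R]_n) : 0 <= sq x.
Proof. by apply: sumr_ge0 => i _; exact: sqr_ge0. Qed.

Lemma sqN n (x : 'rV[R]_n) : sq (- x) = sq x.
Proof. by apply: eq_bigr => i _; rewrite mxE sqrrN. Qed.

Lemma measurable_rV_coord n (i : 'I_n) :
  measurable_fun setT (fun x : 'rV[R]_n => x 0 i).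
Proof. exact: (measurable_coord i). Qed.

Lemma measurable_sq_shift n (x : 'rV[R]_n) :
  measurable_fun setT (fun y : 'rV[R]_n => sq (x + y)).
Proof.
rewrite /sq; apply: measurable_sum => i.
under eq_fun do rewrite mxE.
apply: measurable_funX; apply: measurable_funD => //.
exact: measurable_rV_coord.
Qed.

Lemma measurable_sq n : measurable_fun setT (@sq n).
Proof.
have := measurable_sq_shift (0 : 'rV[R]_n).
by under eq_fun do rewrite add0r.
Qed.

Lemma measurable_rV_opp n : measurable_fun setT (fun y : 'rV[R]_n => - y).
Proof.
apply: measurable_fun_rV => i; rewrite (_ : _ \o _ = (fun y : 'rV[R]_n => - y 0 i)).
  by apply: measurableT_comp => //; exact: measurable_rV_coord.
by apply/funext => y /=; rewrite mxE.
Qed.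

Lemma ge0_integral_rV_cons n (f : 'rV[R]_n.+1 -> \bar R) :
  measurable_fun setT f -> (forall x, 0 <= f x)%E ->
  (\int[leb n.+1]_x f x = \int[mu]_t \int[leb n]_z f (row_cons (t, z)))%E.
Proof.
move=> mf f0.
transitivity (\int[pushforward (mu \x leb n)%E (@row_cons R n)]_x f x)%E => //.
rewrite ge0_integral_pushforward//; last exact: measurable_row_cons.
rewrite preimage_setT fubini_tonelli1//.
  by apply: measurableT_comp => //; exact: measurable_row_cons.
by move=> x /=.
Qed.

Lemma ge0_integral_opp1 (f : R -> \bar R) :
  measurable_fun setT f -> (forall x, 0 <= f x)%E ->
  (\int[mu]_t f (- t)%R = \int[mu]_t f t)%E.
Proof.
move=> mf f0; rewrite -[RHS]mul1e.
apply: (ge0_integral_image (k := 1)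
  (phi := fun t : measurableTypeR R => - (t : R) : measurableTypeR R)) => //.
- exact: oppr_measurable.
- exact: lebesgue_opp.
Qed.

Lemma row_consN n (t : R) (z : 'rV[R]_n) : - row_cons (t, z) = row_cons (- t, - z).
Proof.
apply/rowP => i; rewrite mxE; case: (unliftP 0 i) => [j ->|->].
  by rewrite !row_cons_lift /= mxE.
by rewrite !row_cons0.
Qed.

Lemma ge0_integral_rV_opp n (f : 'rV[R]_n -> \bar R) :
  measurable_fun setT f -> (forall x, 0 <= f x)%E ->
  (\int[leb n]_x f (- x)%R = \int[leb n]_x f x)%E.
Proof.
elim: n f => [f _ _|n IH f mf f0].
  by apply: eq_integral => x _; congr f; apply/rowP => -[].
rewrite !ge0_integral_rV_cons//; last first.
  by apply: measurableT_comp => //; exact: measurable_rV_opp.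
have mfc : measurable_fun setT (fun z => f (row_cons z)).
  by apply: measurableT_comp => //; exact: measurable_row_cons.
transitivity (\int[mu]_t \int[leb n]_z f (row_cons (- t, z)%R))%E.
  apply: eq_integral => t _; under eq_integral do rewrite row_consN.
  apply: (IH (fun z => f (row_cons (- t, z)))) => //.
  apply: (measurableT_comp mfc); exact: measurable_pair1.
apply: (@ge0_integral_opp1 (fun t => \int[leb n]_z f (row_cons (t, z)))%E).
  by apply: (measurable_fun_fubini_tonelli_F (fun z => f (row_cons z))) => // z.
by move=> t; exact: integral_ge0.
Qed.

Lemma lebesgue_rV_opp n (A : set 'rV[R]_n) : measurable A ->
  leb n ((fun y => - y) @^-1` A) = (1%:E * leb n A)%E.
Proof.
move=> mA; rewrite mul1e.
have mA' : measurable ((fun y : 'rV[R]_n => - y) @^-1` A).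
  by rewrite -[X in measurable X]setTI; exact: measurable_rV_opp.
have E B : measurable B -> leb n B = (\int[leb n]_x (\1_B x)%:E)%E.
  by move=> mB; rewrite integral_indic// setIT.
rewrite !E//; apply: (@ge0_integral_rV_opp n (fun x => (\1_A x)%:E)) => //.
  exact/measurable_EFinP/measurable_indic.
Qed.

Lemma L1_rV_opp n (f : 'rV[R]_n -> R) : L1 (leb n) f -> L1 (leb n) (fun y => f (- y)).
Proof.
exact: (L1_image (@measurable_rV_opp n) ltr01 (@lebesgue_rV_opp n)).
Qed.

Lemma Rint_rV_opp n (f : 'rV[R]_n -> R) : L1 (leb n) f ->
  \int[leb n]_y f (- y) = \int[leb n]_y f y.
Proof.
move=> Lf.
by rewrite (Rint_image (@measurable_rV_opp n) ltr01 (@lebesgue_rV_opp n) Lf) mul1r.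
Qed.

(** Complete the square: p (a + t)^2 + l t^2 = (p + l) (t + p a / (p + l))^2 + p l / (p + l) a^2. *)
Lemma Rint_gauss1 (a p l : R) : 0 <= p -> 0 < l ->
  L1 mu (fun t => expR (- (p * (a + t) ^+ 2 + l * t ^+ 2))) /\
  \int[mu]_t expR (- (p * (a + t) ^+ 2 + l * t ^+ 2)) =
    Num.sqrt pi / Num.sqrt (p + l) * expR (- (p * l / (p + l) * a ^+ 2)).
Proof.
move=> p0 l0; have pl0 : 0 < p + l by lra.
have c0 : 0 < Num.sqrt (p + l) by rewrite sqrtr_gt0.
have E t : expR (- (p * (a + t) ^+ 2 + l * t ^+ 2)) =
    expR (- (p * l / (p + l) * a ^+ 2)) *
    gauss_fun (Num.sqrt (p + l) * (t + p * a / (p + l))).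
  rewrite /gauss_fun -expRD; congr expR.
  rewrite exprMn sqr_sqrtr; last exact: ltW.
  by field; rewrite gt_eqF.
have L0 : L1 mu (@gauss_fun R) by exact: integrableT_gauss.
have L2 : L1 mu (fun t => gauss_fun (Num.sqrt (p + l) * (t + p * a / (p + l)))).
  exact: (L1_shift _ (L1_scale c0 L0)).
split; first by apply: eq_L1 (L1Z (expR (- (p * l / (p + l) * a ^+ 2))) L2) => t; rewrite E.
under eq_Rintegral do rewrite E.
rewrite RintZ// mulrC; congr (_ * _).
rewrite (@Rint_shift _ _ (fun t => gauss_fun (Num.sqrt (p + l) * t))); last exact: L1_scale.
rewrite Rint_scale// mulrC; congr (_ * _).
by rewrite /Rintegral integralT_gauss.
Qed.

Lemma sq_row_cons n (x : 'rV[R]_n.+1) (t : R) (z : 'rV[R]_n) :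
  sq (x + row_cons (t, z)) =
  (x 0 0 + t) ^+ 2 + sq (\row_i x 0 (lift 0 i) + z).
Proof.
rewrite /sq big_ord_recl mxE row_cons0; congr (_ + _).
by apply: eq_bigr => i _; rewrite mxE row_cons_lift !mxE.
Qed.

Lemma measurable_gauss n (x : 'rV[R]_n) (p l : R) :
  measurable_fun setT (fun y : 'rV[R]_n => expR (- (p * sq (x + y) + l * sq y))).
Proof.
apply: measurableT_comp => //; apply: measurableT_comp => //.
apply: measurable_funD.
  by apply: measurable_funM => //; exact: measurable_sq_shift.
by apply: measurable_funM => //; exact: measurable_sq.
Qed.

(** The Gaussian factors over coordinates, so the recursion defining [lebesgue_rV] gives an
    induction on the dimension that starts from a Dirac mass. *)
Lemma integral_gauss_rV n (x : 'rV[R]_n) (p l : R) : 0 <= p -> 0 < l ->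
  (\int[leb n]_y (expR (- (p * sq (x + y) + l * sq y)))%:E =
  ((Num.sqrt pi / Num.sqrt (p + l)) ^+ n *
    expR (- (p * l / (p + l) * sq x)))%:E)%E.
Proof.
move=> p0 l0; elim: n x => [|n IH] x.
  have mg := (measurable_EFinP _ _).2 (measurable_gauss x p l).
  rewrite (@integral_dirac _ _ (0 : 'rV[R]_0) _ _ measurableT _ mg) /=.
  by rewrite /sq !big_ord0 !mulr0 !addr0 diracE in_setT mul1e expr0 mul1r.
rewrite ge0_integral_rV_cons//; last first.
  exact: ((measurable_EFinP _ _).2 (measurable_gauss x p l)).
pose x' : 'rV[R]_n := \row_i x 0 (lift 0 i).
have E t z : expR (- (p * sq (x + row_cons (t, z)) + l * sq (row_cons (t, z)))) =
    expR (- (p * (x 0 0 + t) ^+ 2 + l * t ^+ 2)) *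
    expR (- (p * sq (x' + z) + l * sq z)).
  have -> : sq (row_cons (t, z)) = t ^+ 2 + sq z.
    rewrite -[row_cons (t, z)]add0r sq_row_cons mxE add0r; congr (_ + sq _).
    by apply/rowP => i; rewrite !mxE add0r.
  by rewrite -expRD sq_row_cons -/x'; congr expR; ring.
under eq_integral => t _.
  under eq_integral do rewrite E EFinM.
  rewrite ge0_integralZl//; last first.
    exact: ((measurable_EFinP _ _).2 (measurable_gauss x' p l)).
  rewrite IH -EFinM.
  over.
have [L1g I1g] := Rint_gauss1 (x 0 0) p0 l0.
rewrite -EFin_Rint; last first.
  by apply: eq_L1 (L1Z ((Num.sqrt pi / Num.sqrt (p + l)) ^+ n * expR (- (p * l / (p + l) * sq x'))) L1g) => t; rewrite mulrC.
congr EFin; under eq_Rintegral do rewrite mulrC.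
rewrite RintZ// I1g (exprS _ n) [in RHS]/sq big_ord_recl.
rewrite (_ : \sum_(i < n) _ = sq x'); last by apply: eq_bigr => i _; rewrite mxE.
by rewrite mulrDr opprD expRD; ring.
Qed.

Lemma Rint_gauss n (x : 'rV[R]_n) (p l : R) : 0 <= p -> 0 < l ->
  L1 (leb n) (fun y => expR (- (p * sq (x + y) + l * sq y))) /\
  \int[leb n]_y expR (- (p * sq (x + y) + l * sq y)) =
    (Num.sqrt pi / Num.sqrt (p + l)) ^+ n * expR (- (p * l / (p + l) * sq x)).
Proof.
move=> p0 l0; have I := integral_gauss_rV x p0 l0; split.
  apply: L1_ge0; last by rewrite I ltry.
    exact: measurable_gauss.
  by move=> y; exact: expR_ge0.
by rewrite /Rintegral I.
Qed.

Lemma Rint_gauss0 n (l : R) : 0 < l ->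
  L1 (leb n) (fun y => expR (- (l * sq y))) /\
  \int[leb n]_y expR (- (l * sq y)) = (Num.sqrt pi / Num.sqrt l) ^+ n.
Proof.
move=> l0; have [L I] := @Rint_gauss n 0 0 l (lexx 0) l0.
have E y : expR (- (0 * sq (0 + y) + l * sq (y : 'rV[R]_n))) = expR (- (l * sq y)).
  by rewrite mul0r add0r.
split; first by apply: eq_L1 L => y; rewrite E.
under eq_Rintegral do rewrite -E.
by rewrite I add0r !mul0r oppr0 expR0 mulr1.
Qed.

End rV_measure.

(** * The Riesz kernel as a Gamma mixture of Gaussians *)

Section kernel.
Context {R : realType}.
Variables (n : nat) (s : R).
Hypothesis s01 : 0 < s < 1.
Local Notation mu := (@lebesgue_measure R).
Local Notation leb := (lebesgue_rV R n).
Local Notation a := (n%:R / 2 : R).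
Local Notation b := ((1 + s) / 2 : R).
Let s0 : 0 < s. Proof. by case/andP: s01. Qed.
Let s1 : s < 1. Proof. by case/andP: s01. Qed.
Let a0 : 0 <= a. Proof. by rewrite divr_ge0. Qed.
Let b0 : 0 < b. Proof. by rewrite divr_gt0// addr_gt0. Qed.
Let as1 : -1 < a + s - 1. Proof. by have := a0; have := s0; lra. Qed.
(** This is min(1, |y|^(1+s)), the size of the second differences of the profiles
    ([second_diff_bound]). Since 1 + s > 2s, it makes |y|^(-n-2s) integrable at the origin. *)
Let cm (y : 'rV[R]_n) : R := Num.min 1 (ppow b (sq y)).

Let cm_ge0 y : 0 <= cm y.
Proof. by rewrite le_min ler01 ppow_ge0. Qed.

Let cm_le1 y : cm y <= 1.
Proof. by rewrite ge_min lexx. Qed.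

Let cm_sq0 y : sq y <= 0 -> cm y = 0.
Proof. by move=> q0; rewrite /cm ppow0//; apply/min_idPr. Qed.

Let mcm : measurable_fun setT cm.
Proof.
apply: measurable_minr; first exact: measurable_cst.
by apply: measurableT_comp; [exact: measurable_ppow|exact: measurable_sq].
Qed.

(** The joint integrand for Fubini: integrated in [l] it is a multiple of [cm y * kern y], while its
    integral in [y] is bounded by Gaussian integrals. *)
Definition mixk (l : R) (y : 'rV[R]_n) : R :=
  Num.min 1 (ppow b (sq y)) * (ppow (a + s - 1) l * expR (- (l * sq y))).

(** The kernel |y|^(-n-2s), with value 0 at the origin. *)
Definition kern (y : 'rV[R]_n) : R := ppow (- (a + s)) (sq y).

Lemma mixk_ge0 l y : 0 <= mixk l y.
Proof. by rewrite !mulr_ge0 ?cm_ge0 ?ppow_ge0 ?expR_ge0. Qed.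

Lemma measurable_kern : measurable_fun setT kern.
Proof. by apply: measurableT_comp; [exact: measurable_ppow|exact: measurable_sq]. Qed.

Lemma measurable_mixw : measurable_fun setT
  (fun z : R * 'rV[R]_n => ppow (a + s - 1) z.1 * expR (- (z.1 * sq z.2))).
Proof.
apply: measurable_funM.
  by apply: (measurableT_comp (measurable_ppow _)); exact: measurable_fst.
apply: measurableT_comp => //; apply: measurableT_comp => //.
apply: measurable_funM; first exact: measurable_fst.
by apply: (measurableT_comp (@measurable_sq R n)); exact: measurable_snd.
Qed.

Lemma measurable_mixk : measurable_fun setT (fun z => mixk z.1 z.2).
Proof.
apply: measurable_funM; last exact: measurable_mixw.
by apply: (measurableT_comp mcm); exact: measurable_snd.
Qed.

Let sqrtE (l : R) : 0 < l -> Num.sqrt l ^- n = l `^ (- a).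
Proof.
move=> l0; rewrite -powR12_sqrt ?ltW// -powR_mulrn ?powR_ge0// -powRN -powRrM.
by congr (_ `^ _); ring.
Qed.

Lemma Rint_gaussE (l : R) : 0 < l ->
  \int[leb]_y expR (- (l * sq y)) = Num.sqrt pi ^+ n * l `^ (- a).
Proof.
by move=> l0; have [_ ->] := Rint_gauss0 n l0; rewrite expr_div_n sqrtE.
Qed.

Lemma L1_mixk l : L1 leb (mixk l).
Proof.
have [l0|l0] := leP l 0.
  apply: eq_L1 (L10 leb) => y.
  by rewrite /mixk [ppow _ l]ppow0// mul0r mulr0.
have [L _] := Rint_gauss0 n l0.
apply: (@L1_mul_bounded _ _ _ leb _ cm 1 mcm) => [y|].
  by rewrite ger0_norm.
exact: (L1Z (ppow (a + s - 1) l) L).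
Qed.

(** Drop [cm <= 1]: the Gaussian integral contributes l^(-a), which leaves l^(s-1), integrable at
    0. *)
Lemma Rint_mixk_near0 l : 0 < l ->
  \int[leb]_y mixk l y <= Num.sqrt pi ^+ n * l `^ (s - 1).
Proof.
move=> l0; have [L I] := Rint_gauss0 n l0.
apply: (@le_trans _ _ (\int[leb]_y (ppow (a + s - 1) l * expR (- (l * sq y))))).
  apply: Rint_le; [exact: L1_mixk|exact: L1Z|] => y.
  apply: ler_piMl; last exact: cm_le1.
  by rewrite mulr_ge0 ?ppow_ge0 ?expR_ge0.
rewrite RintZ// Rint_gaussE// ppowE// mulrCA ler_wpM2l ?exprn_ge0 ?sqrtr_ge0//.
rewrite -powRD; last by rewrite (gt_eqF l0) implybT.
by rewrite (_ : a + s - 1 + - a = s - 1)//; ring.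
Qed.

Let half_powR (r : R) : 2^-1 `^ r = 2 `^ (- r) :> R.
Proof. by rewrite -[2^-1]powR_inv1// -powRrM mulN1r. Qed.

(** Half of the Gaussian exponent pays for |y|^(2b) <= C l^(-b) e^(l |y|^2 / 2). The power s - 1 - b
    obtained is below -1 because b > s. *)
Lemma Rint_mixk_nearoo l : 0 < l ->
  \int[leb]_y mixk l y <=
  (b `^ b * 2 `^ b * 2 `^ a * Num.sqrt pi ^+ n) * l `^ (s - 1 - b).
Proof.
move=> l0; have l20 : 0 < l / 2 by rewrite divr_gt0.
have [L I] := Rint_gauss0 n l20.
pose A := b `^ b * 2 `^ b * l `^ (- b) * l `^ (a + s - 1).
have key y : mixk l y <= A * expR (- (l / 2 * sq y)).
  have [q0|q0] := leP (sq y) 0.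
    by rewrite /mixk -/(cm y) cm_sq0// mul0r !mulr_ge0 ?powR_ge0 ?expR_ge0.
  rewrite /mixk [ppow _ l]ppowE//.
  have h : ppow b (sq y) <= b `^ b * 2 `^ b * l `^ (- b) * expR (l / 2 * sq y).
    have := @powR_le_expR _ b (l / 2 * sq y) b0.
    rewrite mulr_ge0 ?(ltW l20) ?(ltW q0)// => /(_ isT).
    rewrite [(l / 2 * sq y) `^ _]powRM ?(ltW l20) ?(ltW q0)//.
    rewrite [(l / 2) `^ _]powRM ?(ltW l0) ?invr_ge0//.
    rewrite ppowE// half_powR !powRN => h.
    have p2 : 0 < 2 `^ b :> R by rewrite powR_gt0.
    have pl : 0 < l `^ b by rewrite powR_gt0.
    rewrite -(ler_pM2l (_ : 0 < l `^ b / 2 `^ b)) ?divr_gt0//.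
    apply: (le_trans h); rewrite le_eqVlt; apply/orP; left; apply/eqP.
    by field; rewrite !gt_eqF.
  have : Num.min 1 (ppow b (sq y)) <= b `^ b * 2 `^ b * l `^ (- b) * expR (l / 2 * sq y).
    by rewrite ge_min h orbT.
  move=> /(ler_wpM2r _) H.
  apply: (le_trans (H _ _)); first by rewrite mulr_ge0 ?powR_ge0 ?expR_ge0.
  rewrite le_eqVlt; apply/orP; left; apply/eqP.
  rewrite /A (_ : - (l / 2 * sq y) = l / 2 * sq y - l * sq y); last by field.
  by rewrite expRD; ring.
apply: (le_trans (Rint_le (L1_mixk l) (L1Z A L) key)).
rewrite RintZ// Rint_gaussE// le_eqVlt; apply/orP; left; apply/eqP.
rewrite /A [(l / 2) `^ _]powRM ?(ltW l0) ?invr_ge0//.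
rewrite half_powR opprK.
rewrite (_ : s - 1 - b = - b + (a + s - 1) + - a); last by ring.
have lD x y : l `^ (x + y) = l `^ x * l `^ y.
  by rewrite powRD// (gt_eqF l0) implybT.
rewrite (lD (- b + (a + s - 1)) (- a)) (lD (- b) (a + s - 1)).
by ring.
Qed.

Lemma measurable_Rint_mixk : measurable_fun setT (fun l => \int[leb]_y mixk l y).
Proof.
by apply: measurable_Rint1; exact: measurable_mixk.
Qed.

Lemma L1_Rint_mixk : L1 mu (fun l => \int[leb]_y mixk l y).
Proof.
pose A := Num.max (Num.sqrt pi ^+ n)
  (b `^ b * 2 `^ b * 2 `^ a * Num.sqrt pi ^+ n).
apply: (@L1_ppow_dom _ _ A (s - 1) (s - 1 - b)).
- exact: measurable_Rint_mixk.
- by rewrite le_max exprn_ge0// sqrtr_ge0.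
- by have := s0; lra.
- by have := s1; lra.
- move=> l l0; rewrite (_ : mixk l = cst 0) ?Rintegral_cst ?mul0r//.
  by apply/funext => y; rewrite /mixk [ppow _ l]ppow0// mul0r mulr0.
- move=> l /andP[l0 _]; rewrite ger0_norm; last first.
    by apply: Rint_ge0 => y; exact: mixk_ge0.
  rewrite (le_trans (Rint_mixk_near0 l0))// ler_wpM2r ?powR_ge0//.
  by rewrite le_max lexx.
- move=> l l1; have l0 : 0 < l by rewrite (lt_le_trans _ l1).
  rewrite ger0_norm; last by apply: Rint_ge0 => y; exact: mixk_ge0.
  rewrite (le_trans (Rint_mixk_nearoo l0))// ler_wpM2r ?powR_ge0//.
  by rewrite le_max lexx orbT.
Qed.

Lemma Rint_mixw y c : 0 < sq y -> 0 < c ->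
  L1 mu (fun l => ppow (a + s - 1) l * expR (- (l * (c * sq y)))) /\
  \int[mu]_l (ppow (a + s - 1) l * expR (- (l * (c * sq y)))) =
    c `^ (- (a + s)) * Gam (a + s - 1) * kern y.
Proof.
move=> q0 c0; have q0' : 0 < c * sq y by rewrite mulr_gt0.
have [L I] := Rint_Gam as1 q0'.
have E l : ppow (a + s - 1) l * expR (- (l * (c * sq y))) =
  ppow (a + s - 1) l * expR (- (c * sq y * l)) by rewrite [l * _]mulrC.
split; first by apply: eq_L1 L => l; rewrite E.
under eq_Rintegral do rewrite E.
rewrite I /kern ppowE// subrK powRM ?(ltW c0) ?(ltW q0)//; ring.
Qed.

(** Fubini on the Gaussian mixture takes the place of polar coordinates. *)
Lemma L1_kern : L1 leb (fun y => Num.min 1 (ppow b (sq y)) * kern y).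
Proof.
have F2 y : L1 mu (fun l => mixk l y) /\
    \int[mu]_l mixk l y = Gam (a + s - 1) * (cm y * kern y).
  have [q0|q0] := leP (sq y) 0.
    have E : (fun l => mixk l y) = cst 0.
      by apply/funext => l; rewrite /mixk -/(cm y) cm_sq0// mul0r.
    rewrite E cm_sq0// mul0r mulr0 Rintegral_cst ?mul0r//.
    by split => //; exact: L10.
  have [L I] := Rint_mixw q0 ltr01.
  have E l : mixk l y = cm y * (ppow (a + s - 1) l * expR (- (l * (1 * sq y)))).
    by rewrite /mixk mul1r.
  split; first by apply: eq_L1 (L1Z (cm y) L) => l; rewrite E.
  under eq_Rintegral do rewrite E.
  by rewrite RintZ// I powR1 mul1r mulrCA.
have LF : L1 mu (fun l => \int[leb]_y `|mixk l y|).
  apply: eq_L1 L1_Rint_mixk => l; apply: eq_Rint => y.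
  by rewrite ger0_norm// mixk_ge0.
have := @L1_Fubini2 _ _ (measurableTypeR R) _ R mu leb mixk measurable_mixk L1_mixk LF (fun y => (F2 y).1).
move=> /(L1Z (Gam (a + s - 1))^-1); apply: eq_L1 => y.
by rewrite (F2 y).2 mulKf// gt_eqF// Gam_gt0.
Qed.

End kernel.

(** * The principal value as an absolutely convergent integral *)

Section symmetrized_integral.
Context {R : realType}.
Variables (n : nat) (s : R).
Hypothesis s01 : 0 < s < 1.
Local Notation leb := (lebesgue_rV R n).
Local Notation b := ((1 + s) / 2 : R).
Let s0 : 0 < s. Proof. by case/andP: s01. Qed.
Let b0 : 0 < b. Proof. by rewrite divr_gt0// addr_gt0. Qed.
Let cm (y : 'rV[R]_n) : R := Num.min 1 (ppow b (sq y)).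

(* The kernel is even, so the truncated integrals of [g] may be symmetrized; the
   symmetrized integral converges absolutely. *)
Definition second_diff (g : R -> R) (x y : 'rV[R]_n) : R :=
  g (sq x) - (g (sq (x + y)) + g (sq (x - y))) / 2.

Definition sym_int (g : R -> R) (x : 'rV[R]_n) : R :=
  \int[leb]_y (second_diff g x y * kern s y).

Lemma measurable_sq_shiftB (x : 'rV[R]_n) :
  measurable_fun setT (fun y : 'rV[R]_n => sq (x - y)).
Proof.
exact: (measurableT_comp (measurable_sq_shift x) (@measurable_rV_opp R n)).
Qed.

Lemma measurable_second_diff g x : measurable_fun setT g ->
  measurable_fun setT (second_diff g x).
Proof.
move=> mg; apply: measurable_funB; first exact: measurable_cst.
apply: measurable_funM; last exact: measurable_cst.
apply: measurable_funD; apply: (measurableT_comp mg).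
  exact: measurable_sq_shift.
exact: measurable_sq_shiftB.
Qed.

Lemma enorm_ge0 (y : 'rV[R]_n) : 0 <= enorm y.
Proof. exact: sqrtr_ge0. Qed.

Lemma enorm_sqr (y : 'rV[R]_n) : enorm y ^+ 2 = sq y.
Proof. by rewrite sqr_sqrtr// sq_ge0. Qed.

Lemma enormN (y : 'rV[R]_n) : enorm (- y) = enorm y.
Proof. by rewrite /enorm -/(sq (- y)) sqN. Qed.

Lemma measurable_enorm : measurable_fun setT (@enorm R n).
Proof.
rewrite (_ : @enorm R n = (fun y => sq y `^ 2^-1)); last first.
  by apply/funext => y; rewrite powR12_sqrt// sq_ge0.
by apply: (measurableT_comp (measurable_powR _)); exact: measurable_sq.
Qed.

Lemma kernE (y : 'rV[R]_n) : 0 < enorm y ->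
  (enorm y `^ (n%:R + 2 * s))^-1 = kern s y.
Proof.
move=> y0; have q0 : 0 < sq y by rewrite -enorm_sqr exprn_gt0.
rewrite /kern ppowE// powRN -enorm_sqr; congr (_^-1).
rewrite -powR_mulrn ?enorm_ge0// -powRrM; congr (_ `^ _).
by field.
Qed.

Lemma L1_dominated_kern (f : 'rV[R]_n -> R) C : measurable_fun setT f ->
  (forall y, `|f y| <= C * cm y) -> L1 leb (fun y => f y * kern s y).
Proof.
move=> mf fC; apply: (@L1_le _ _ _ leb _ (fun y => C * (cm y * kern s y))).
- by apply: measurable_funM => //; exact: measurable_kern.
- move=> y; rewrite normrM (ger0_norm (ppow_ge0 _ _)) mulrA.
  by rewrite ler_wpM2r ?ppow_ge0.
- exact: L1Z (L1_kern n s01).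
Qed.

Section principal_value.
Variables (g : R -> R) (x : 'rV[R]_n) (M C : R).
Hypotheses (mg : measurable_fun setT g) (gM : forall r, 0 <= r -> `|g r| <= M).
Hypothesis gC : forall y, `|second_diff g x y| <= C * cm y.

Let mcut (e : R) (f : 'rV[R]_n -> R) : measurable_fun setT f ->
  measurable_fun setT (fun y => if e < enorm y then f y else 0).
Proof.
move=> mf; apply: measurable_fun_ifT; [|exact: mf|exact: measurable_cst].
by apply: measurable_fun_ltr => //; exact: measurable_enorm.
Qed.

Let M0 : 0 <= M. Proof. exact: le_trans (normr_ge0 _) (gM (lexx 0)). Qed.

Let truncated_L1 (e : R) (f : 'rV[R]_n -> R) : 0 < e -> measurable_fun setT f ->
  (forall y, `|f y| <= 2 * M) ->
  L1 leb (fun y => (if e < enorm y then f y else 0) * kern s y).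
Proof.
(* [d] bounds [cm] from below on |y| > e, so a function bounded by 2M and cut there is at most 2M/d
   times [cm]. *)
move=> e0 mf fM; pose d := Num.min 1 (ppow b (e ^+ 2)).
have d0 : 0 < d by rewrite lt_min ltr01 ppowE ?powR_gt0 ?exprn_gt0.
apply: (@L1_dominated_kern _ (2 * M / d)); first exact: mcut.
move=> y; case: ifPn => [ey|_]; last first.
  by rewrite normr0 mulr_ge0 ?divr_ge0 ?mulr_ge0 ?(ltW d0)// le_min ler01 ppow_ge0.
rewrite (le_trans (fM y))// -mulrA ler_peMr ?mulr_ge0//.
rewrite ler_pdivlMl// mulr1 /d /cm.
have q0 : 0 < sq y by rewrite -enorm_sqr exprn_gt0// (lt_trans e0).
have eq : e ^+ 2 <= sq y.
  by rewrite -enorm_sqr ler_pXn2r ?nnegrE ?enorm_ge0 ?ltW.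
have : ppow b (e ^+ 2) <= ppow b (sq y).
  rewrite !ppowE ?exprn_gt0//.
  by apply: ge0_ler_powR; rewrite ?nnegrE ?sq_ge0 ?sqr_ge0 ?(ltW b0).
by move=> h; rewrite le_min ge_min lexx /= ge_min h orbT.
Qed.

Let truncatedE (e : R) : 0 < e ->
  (\int[leb]_(y in [set y | (e < enorm y)%R])
     ((g (sq x) - g (sq (x + y))) / enorm y `^ (n%:R + 2 * s))%:E)%E =
  (\int[leb]_y ((if e < enorm y then second_diff g x y else 0) * kern s y))%:E.
Proof.
move=> e0; pose f (y : 'rV[R]_n) := g (sq x) - g (sq (x + y)).
have mf : measurable_fun setT f.
  apply: measurable_funB; first exact: measurable_cst.
  by apply: (measurableT_comp mg); exact: measurable_sq_shift.
have fM y : `|f y| <= 2 * M.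
  by rewrite (le_trans (ler_normB _ _))// mulr2n mulrDl !mul1r lerD ?gM ?sq_ge0.
pose F (y : 'rV[R]_n) := (if e < enorm y then f y else 0) * kern s y.
have LF : L1 leb F by exact: truncated_L1.
transitivity (\int[leb]_y F y)%:E.
  rewrite EFin_Rint// [LHS]integral_mkcond; apply: eq_integral => y _.
  rewrite patchE /F; case: ifPn => [|/negP] h.
    have ey : e < enorm y by move/set_mem: h.
    by rewrite ey kernE// (lt_trans e0).
  by rewrite ifF ?mul0r//; apply/negP => ey; apply: h; exact/mem_set.
congr EFin.
have LFN := L1_rV_opp LF.
(* Average over y and -y, which preserves both the cut and the kernel. *)
transitivity (\int[leb]_y (2^-1 * (F y + F (- y)))).
  by rewrite RintZ ?RintD ?Rint_rV_opp//; [field|exact: L1D].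
apply: eq_Rint => y; rewrite /F /kern sqN enormN; case: ifPn => _; last by rewrite !mul0r addr0 mulr0.
by rewrite /second_diff /f; field.
Qed.

(** Dominated convergence with a multiple of [cm y * kern s y]: at y = 0 the kernel is 0, and at any
    other y the cut eventually becomes inactive. *)
Lemma is_fractional_laplacian_sym (c : R) :
  is_fractional_laplacian c s (fun x => g (sq x)) x (c * sym_int g x).
Proof.
rewrite /is_fractional_laplacian.
pose J e := \int[leb]_y ((if e < enorm y then second_diff g x y else 0) * kern s y).
have msd := @measurable_second_diff g x mg.
apply: (@cvg_trans _ ((c * J e)%:E @[e --> 0^'+])).
  by apply: near_eq_cvg; near=> e; rewrite truncatedE ?EFinM.
apply: (@cvg_comp _ _ _ (fun e => c * J e) EFin _ (nbhs (c * sym_int g x))) => //.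
apply: cvgMr; apply/cvg_at_rightP => e_ [e_0 e_cvg].
apply: (@Rint_dct _ _ _ leb (fun k y => (if e_ k < enorm y then second_diff g x y else 0) * kern s y)
    (fun y => second_diff g x y * kern s y) (fun y => C * (cm y * kern s y))).
- move=> k; apply: measurable_funM; last exact: measurable_kern.
  exact: mcut.
- by apply: measurable_funM => //; exact: measurable_kern.
- apply: aeW => y; have [q0|q0] := leP (sq y) 0.
    rewrite /kern ppow0//; under eq_fun do rewrite mulr0.
    by rewrite mulr0; exact: cvg_cst.
  have y0 : 0 < enorm y by rewrite sqrtr_gt0.
  apply: cvg_near_cst; near=> k; rewrite ifT//.
  by near: k; exact: (cvgr_lt (0 : R)).
- exact: L1Z (L1_kern n s01).
- move=> k y; rewrite normrM (ger0_norm (ppow_ge0 _ _)) mulrA.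
  rewrite ler_wpM2r ?ppow_ge0//; case: ifP => // _.
  by rewrite normr0 (le_trans _ (gC y)).
Unshelve. all: by end_near. Qed.

End principal_value.
End symmetrized_integral.

(** * Increments and second differences of t_+^s *)

Section ppow_estimates.
Context {R : realType}.
Variable s : R.
Hypothesis s01 : 0 < s < 1.
Local Notation mu := (@lebesgue_measure R).
Let s0 : 0 < s. Proof. by case/andP: s01. Qed.
Let s1 : s < 1. Proof. by case/andP: s01. Qed.
Local Notation pw := (@ppow R s).

(** A ratio z in (0, 1] satisfies z <= z^s; apply this to u/(u+v) and v/(u+v), which add up to 1. *)
Lemma powR_subadd (u v : R) : 0 <= u -> 0 <= v ->
  (u + v) `^ s <= u `^ s + v `^ s.
Proof.
rewrite le_eqVlt => /predU1P[<- v0|u0].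
  by rewrite add0r powR0 ?gt_eqF// add0r.
rewrite le_eqVlt => /predU1P[<-|v0].
  by rewrite addr0 (powR0 (x := s)) ?gt_eqF// addr0.
have uv0 : 0 < u + v by rewrite addr_gt0.
have H w : 0 < w -> w <= u + v -> w / (u + v) <= w `^ s / (u + v) `^ s.
  move=> w0 wuv.
  have -> : w `^ s / (u + v) `^ s = (w / (u + v)) `^ s.
    rewrite powRM ?invr_ge0 ?(ltW w0) ?(ltW uv0)//; congr (_ * _).
    by rewrite -powR_inv1 ?powR_ge0// -(powR_inv1 (ltW uv0)) -!powRrM mulrC.
  apply: ger1_powR; last exact: ltW.
  by rewrite divr_gt0//= ler_pdivrMr// mul1r.
have h1 : u / (u + v) <= u `^ s / (u + v) `^ s by apply: H; rewrite // lerDl ltW.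
have h2 : v / (u + v) <= v `^ s / (u + v) `^ s by apply: H; rewrite // lerDr ltW.
rewrite -(ler_pM2r (_ : 0 < ((u + v) `^ s)^-1)) ?invr_gt0 ?powR_gt0//.
rewrite divff ?gt_eqF ?powR_gt0// mulrDl.
apply: (@le_trans _ _ (u / (u + v) + v / (u + v))).
  by rewrite -mulrDl divff// gt_eqF.
by rewrite lerD.
Qed.

Lemma powR_le (r t t' : R) : 0 <= r -> 0 <= t -> t <= t' -> t `^ r <= t' `^ r.
Proof.
move=> r0 t0 tt'; apply: ge0_ler_powR => //; rewrite nnegrE//.
exact: le_trans tt'.
Qed.

Lemma pw_mono (t t' : R) : t <= t' -> pw t <= pw t'.
Proof.
move=> tt'; rewrite /ppow; case: ifPn => t0; last by case: ifP => // _; exact: powR_ge0.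
have t'0 : 0 < t' by rewrite (lt_le_trans t0).
by rewrite t'0; apply: powR_le => //; exact: ltW.
Qed.

Lemma pw_sub (t h : R) : 0 <= h -> pw (t + h) - pw t <= h `^ s.
Proof.
move=> h0; rewrite lerBlDr.
have [t0|t0] := leP t 0.
  rewrite [pw t]ppow0// addr0; have := @pw_mono (t + h) h; rewrite gerDr t0 => /(_ isT) H.
  rewrite (le_trans H)// /ppow; case: ifP => // _; exact: powR_ge0.
rewrite !ppowE ?ltr_wpDr// addrC; apply: powR_subadd => //; exact: ltW.
Qed.

Lemma pw_hoelder (t t' : R) : `|pw t - pw t'| <= `|t - t'| `^ s.
Proof.
wlog tt' : t t' / t' <= t.
  move=> H; have [|/ltW] := leP t' t; first exact: H.
  by move/H; rewrite distrC [`|t' - t|]distrC.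
rewrite !ger0_norm ?subr_ge0 ?pw_mono//.
by have := @pw_sub t' (t - t'); rewrite subrKC subr_ge0; apply.
Qed.

Lemma powR_increment (r t h : R) : 0 < t -> 0 < h ->
  exists2 c, t < c < t + h & (t + h) `^ r - t `^ r = r * c `^ (r - 1) * h.
Proof.
move=> t0 h0.
have tth : t < t + h by rewrite ltrDl.
have [||c] := @MVT _ (@powR R ^~ r) (fun x => r * x `^ (r - 1)) t (t + h) tth.
- move=> x; rewrite in_itv/= => /andP[tx _]; apply: is_derive1_powR.
  exact: lt_trans tx.
- apply: continuous_in_subspaceT => x /set_mem; rewrite /= in_itv/= => /andP[tx _].
  by apply: continuous_powR; exact: lt_le_trans tx.
- rewrite in_itv/= => H E.
  by exists c => //; rewrite E (_ : t + h - t = h)//; ring.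
Qed.

Lemma powR_le_anti (r t t' : R) : r <= 0 -> 0 < t -> t <= t' -> t' `^ r <= t `^ r.
Proof.
move=> r0 t0 tt'; have t'0 : 0 < t' by rewrite (lt_le_trans t0).
rewrite -[r]opprK (powRN t) (powRN t') lef_pV2 ?posrE ?powR_gt0//.
by apply: powR_le => //; [rewrite oppr_ge0|exact: ltW].
Qed.

Lemma pw_increment (t h : R) : 0 < t -> 0 < h ->
  pw (t + h) - pw t <= s * h * t `^ (s - 1).
Proof.
move=> t0 h0; have [c /andP[tc _] E] := powR_increment s t0 h0.
rewrite !ppowE ?addr_gt0// E [s * h * _]mulrAC ler_pM2r// ler_pM2l//.
by apply: powR_le_anti => //; [by rewrite subr_le0 ltW|exact: ltW].
Qed.

(** Unit step suffices: a step h follows by scaling in [Rint_pw_sd], which produces the factor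
    h^(s+1). *)
Definition pw_sd (t : R) : R := `|2 * pw t - pw (t - 1) - pw (t + 1)|.

Lemma measurable_pw_affine (c : R) : measurable_fun setT (fun t : R => pw (t + c)).
Proof.
by apply: measurableT_comp; [exact: measurable_ppow|exact: measurable_funD].
Qed.

Lemma measurable_pw_sd : measurable_fun setT pw_sd.
Proof.
apply: measurableT_comp => //; apply: measurable_funB.
  apply: measurable_funB; last exact: measurable_pw_affine.
  by apply: measurable_funM => //; exact: measurable_ppow.
exact: measurable_pw_affine.
Qed.

Lemma pw_sd_le2 t : pw_sd t <= 2.
Proof.
have h1 := pw_hoelder t (t - 1); have h2 := pw_hoelder t (t + 1).
rewrite (_ : t - (t - 1) = 1) in h1; last by ring.
rewrite (_ : t - (t + 1) = -1) in h2; last by ring.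
move: h1 h2; rewrite normrN normr1 powR1 /pw_sd => h1 h2.
rewrite (_ : _ - _ = (pw t - pw (t - 1)) + (pw t - pw (t + 1))); last by ring.
by rewrite (le_trans (ler_normD _ _))//; lra.
Qed.

(** Mean value theorem on [t-1, t] and on [t, t+1], then once more between the two points found.
    These are less than 2 apart and lie beyond t/2, whence 8 = 2 * 4. *)
Lemma pw_sd_far t : 2 <= t -> pw_sd t <= 8 * t `^ (s - 2).
Proof.
have hs0 := s0; have hs1 := s1.
move=> t2; have t0 : 0 < t by lra.
have t10 : 0 < t - 1 by lra.
have [c1 /andP[l1 u1] E1] := powR_increment s t10 ltr01.
have [c2 /andP[l2 u2] E2] := powR_increment s t0 ltr01.
rewrite subrK in u1 E1.
have E : pw_sd t = `|s * (c1 `^ (s - 1) - c2 `^ (s - 1))|.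
  have t11 : 0 < t + 1 by lra.
  rewrite /pw_sd !ppowE//; congr Num.norm.
  have := E1; have := E2; lra.
have c12 : 0 < c2 - c1 by lra.
have c10 : 0 < c1 by lra.
have [c3 /andP[l3 u3] E3] := powR_increment (s - 1) c10 c12.
rewrite subrKC in u3 E3.
rewrite E -opprB normrM normrN E3 !normrM (ger0_norm (powR_ge0 _ _)).
rewrite (gtr0_norm s0) (gtr0_norm c12) ler0_norm; last by lra.
have h3 : c3 `^ (s - 1 - 1) <= 4 * t `^ (s - 2).
  have -> : s - 1 - 1 = s - 2 by ring.
  apply: (@le_trans _ _ ((t / 2) `^ (s - 2))).
    by apply: powR_le_anti; lra.
  rewrite powRM ?(ltW t0)// mulrC ler_wpM2r ?powR_ge0//.
  rewrite -[2^-1]powR_inv1// -powRrM mulN1r opprB.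
  have : 2 `^ (2 - s) <= 2 `^ 2%:R :> R by apply: ler_powR; lra.
  by rewrite powR_mulrn//; lra.
have p0 := powR_ge0 t (s - 2); have p3 := powR_ge0 c3 (s - 1 - 1).
apply: (@le_trans _ _ (1 * (1 * c3 `^ (s - 1 - 1) * 2))); last by lra.
set X := c3 `^ _ in p3 *; rewrite !mul1r opprB.
have a1 : (1 - s) * X <= X by apply: ler_piMl => //; lra.
have a0 : 0 <= (1 - s) * X by apply: mulr_ge0 => //; lra.
have a2 : (1 - s) * X * (c2 - c1) <= X * 2 by apply: ler_pM => //; lra.
apply: le_trans a2; apply: ler_piMl; last exact: ltW.
by apply: mulr_ge0 => //; exact: ltW.
Qed.

Lemma L1_pw_sd : L1 mu pw_sd.
Proof.
have hs0 := s0; have hs1 := s1.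
(* [pw_sd] lives on t > -1, and the shift brings it to the half line of [L1_ppow_dom]. The constant
   32 below is 8 * 4, from (t/2)^(s-2) <= 4 t^(s-2); it also exceeds 2 * 3^2, which serves t <=
   3. *)
suff L : L1 mu (fun t => pw_sd (t - 1)).
  by apply: eq_L1 (L1_shift 1 L) => t /=; rewrite addrK.
apply: (@L1_ppow_dom _ _ 32 0 (s - 2)).
- apply: (measurableT_comp measurable_pw_sd); exact: measurable_funB.
- by [].
- by lra.
- by lra.
- by move=> t t0; rewrite /pw_sd !ppow0; [rewrite mulr0 !subr0 normr0|lra|lra|lra].
- move=> t _; rewrite powRr0 mulr1 ger0_norm ?normr_ge0//.
  by rewrite (le_trans (pw_sd_le2 _))//; lra.
- move=> t t1; rewrite ger0_norm ?normr_ge0//.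
  have [t3|t3] := leP t 3.
    rewrite (le_trans (pw_sd_le2 _))//.
    have : 3 `^ (s - 2) <= t `^ (s - 2) by apply: powR_le_anti; lra.
    have : 3 `^ (- 2%:R) <= 3 `^ (s - 2) :> R by apply: ler_powR; lra.
    by rewrite powR_invn//; lra.
  rewrite (le_trans (pw_sd_far _))//; first by lra.
  have : (t - 1) `^ (s - 2) <= (t / 2) `^ (s - 2) by apply: powR_le_anti; lra.
  rewrite powRM//; last by lra.
  rewrite -[2^-1]powR_inv1// -powRrM mulN1r opprB.
  have : 2 `^ (2 - s) <= 2 `^ 2%:R :> R by apply: ler_powR; lra.
  rewrite powR_mulrn// => h2.
  have : t `^ (s - 2) * 2 `^ (2 - s) <= t `^ (s - 2) * 4.
    by rewrite ler_wpM2l ?powR_ge0//; lra.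
  by lra.
Qed.

Lemma Rint_pw_sd (r h : R) : 0 < h ->
  L1 mu (fun t => `|2 * pw (t - r) - pw (t - r - h) - pw (t - r + h)|) /\
  \int[mu]_t `|2 * pw (t - r) - pw (t - r - h) - pw (t - r + h)| =
  h `^ (s + 1) * \int[mu]_t pw_sd t.
Proof.
move=> h0; have hi : 0 < h^-1 by rewrite invr_gt0.
pose f t := h `^ s * pw_sd (h^-1 * t).
have E t : `|2 * pw t - pw (t - h) - pw (t + h)| = f t.
  rewrite /f /pw_sd -[h `^ s]ger0_norm ?powR_ge0// -normrM; congr (Num.norm _).
  have Eh u : pw u = h `^ s * pw (h^-1 * u).
    by rewrite -ppowM// mulVKf// gt_eqF.
  rewrite (Eh t) (Eh (t - h)) (Eh (t + h)) mulrBr mulrDr mulVf ?gt_eqF//; ring.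
have Lf : L1 mu f by apply: L1Z; apply: L1_scale => //; exact: L1_pw_sd.
have E' t : `|2 * pw (t - r) - pw (t - r - h) - pw (t - r + h)| = f (t - r).
  by rewrite E.
split; first by apply: eq_L1 (L1_shift (- r) Lf) => t; rewrite E'.
under eq_Rintegral do rewrite E'.
rewrite Rint_shift// RintZ; last by apply: L1_scale => //; exact: L1_pw_sd.
rewrite Rint_scale ?invrK ?mulrA//; last exact: L1_pw_sd.
congr (_ * _); rewrite powRD; last by rewrite (gt_eqF h0) implybT.
by rewrite powRr1// ltW.
Qed.

End ppow_estimates.

(** * The integral identity for radial profiles *)

Section dot_product.
Context {R : realType}.
Variable n : nat.
Implicit Types x y : 'rV[R]_n.

Definition dotr x y : R := \sum_i x 0 i * y 0 i.

Lemma sqD x y : sq (x + y) = sq x + 2 * dotr x y + sq y.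
Proof.
rewrite /sq /dotr mulr_sumr -!big_split /=; apply: eq_bigr => i _.
by rewrite mxE; ring.
Qed.

Lemma sqB x y : sq (x - y) = sq x - 2 * dotr x y + sq y.
Proof.
rewrite sqD sqN (_ : dotr x (- y) = - dotr x y); first by ring.
by rewrite /dotr -sumrN; apply: eq_bigr => i _; rewrite mxE mulrN.
Qed.

Lemma sqZ (k : R) x : sq (k *: x) = k ^+ 2 * sq x.
Proof. by rewrite /sq mulr_sumr; apply: eq_bigr => i _; rewrite mxE exprMn. Qed.

Lemma dotrZ (k l : R) x y : dotr (k *: x) (l *: y) = k * l * dotr x y.
Proof. by rewrite /dotr mulr_sumr; apply: eq_bigr => i _; rewrite !mxE; ring. Qed.

Lemma sq_eq0 x : sq x = 0 -> x = 0.
Proof.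
move=> /eqP; rewrite psumr_eq0; last by move=> i _; exact: sqr_ge0.
move=> /allP x0; apply/rowP => i; rewrite mxE; apply/eqP.
by rewrite -sqrf_eq0; apply: x0; exact: mem_index_enum.
Qed.

Lemma dotr_sqr_le x y : dotr x y ^+ 2 <= sq x * sq y.
Proof.
have [/eqP/sq_eq0 -> |y0] := boolP (sq y == 0).
  rewrite (_ : dotr x 0 = 0) ?expr0n ?mulr_ge0 ?sq_ge0//.
  by apply: big1 => i _; rewrite mxE mulr0.
have q0 : 0 < sq y by rewrite lt_neqAle eq_sym y0 sq_ge0.
have := sq_ge0 (sq y *: x - dotr x y *: y).
rewrite sqB !sqZ dotrZ => h.
have : 0 <= sq y * (sq x * sq y - dotr x y ^+ 2) by apply: le_trans h _; rewrite le_eqVlt; apply/orP; left; apply/eqP; ring.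
by rewrite pmulr_rge0// subr_ge0.
Qed.

Lemma enorm_triangle x y : enorm (x + y) <= enorm x + enorm y.
Proof.
rewrite -(@ler_pXn2r _ 2) ?nnegrE ?addr_ge0 ?enorm_ge0//.
rewrite sqrrD !enorm_sqr sqD.
have : dotr x y <= enorm x * enorm y.
  rewrite (le_trans (ler_norm _))//.
  rewrite -(@ler_pXn2r _ 2) ?nnegrE ?mulr_ge0 ?enorm_ge0//.
  by rewrite exprMn !enorm_sqr real_normK ?num_real// dotr_sqr_le.
by rewrite mulr2n; lra.
Qed.

End dot_product.

(** * Profiles of bounded densities with exponential decay *)

Section profile.
Context {R : realType}.
Variable s : R.
Hypothesis s01 : 0 < s < 1.
Local Notation mu := (@lebesgue_measure R).
Let s0 : 0 < s. Proof. by case/andP: s01. Qed.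
Let s1 : s < 1. Proof. by case/andP: s01. Qed.
Let sN1 : -1 < s. Proof. by rewrite (lt_trans _ s0)// ltrN10. Qed.
Implicit Types (K : R -> R) (M : R).

Definition decay (t : R) : R := if 0 <= t then expR (- t) else 0.

Lemma decay_ge0 t : 0 <= decay t.
Proof. by rewrite /decay; case: ifP => // _; exact: expR_ge0. Qed.

Lemma decay_le1 t : decay t <= 1.
Proof.
rewrite /decay; case: ifPn => // t0.
by rewrite -expR0 ler_expR oppr_le0.
Qed.

(** The cutoff in [decay] makes K vanish for t < 0, since profiles are evaluated at r = |x|^2 >=
    0. *)
Definition good K M := measurable_fun setT K /\ forall t, `|K t| <= M * decay t.

(** [e = s] gives the function g of the overview, [e = 0] the tail integral H. *)
Definition prof (e : R) K (r : R) : R := \int[mu]_t (K t * ppow e (t - r)).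

Lemma good_ge0 K M : good K M -> 0 <= M.
Proof.
move=> [_ KM]; have := KM 0; rewrite /decay lexx oppr0 expR0 mulr1.
exact: le_trans.
Qed.

Lemma ppow_mono (e t t' : R) : 0 <= e -> t <= t' -> ppow e t <= ppow e t'.
Proof.
move=> e0 tt'; rewrite /ppow; case: ifPn => t0; last by case: ifP => // _; exact: powR_ge0.
by rewrite (lt_le_trans t0 tt'); apply: powR_le => //; exact: ltW.
Qed.

Lemma prof_dom e K M r t : good K M -> 0 <= e -> 0 <= r ->
  `|K t * ppow e (t - r)| <= M * (ppow e t * expR (- t)).
Proof.
move=> [mK KM] e0 r0; rewrite normrM (ger0_norm (ppow_ge0 _ _)).
have M0 : 0 <= M by apply: (good_ge0 (K := K)).
apply: (@le_trans _ _ (M * decay t * ppow e t)).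
  by apply: ler_pM; rewrite ?ppow_ge0// ppow_mono// gerBl.
rewrite -mulrA ler_wpM2l// mulrC /decay; case: ifPn => t0; first by [].
by rewrite mulr0 mulr_ge0 ?ppow_ge0 ?expR_ge0.
Qed.

Lemma measurable_prof_int e K r : measurable_fun setT K ->
  measurable_fun setT (fun t => K t * ppow e (t - r)).
Proof.
move=> mK; apply: measurable_funM => //.
by apply: measurableT_comp; [exact: measurable_ppow|exact: measurable_funB].
Qed.

Lemma L1_prof e K M r : good K M -> 0 <= e -> 0 <= r ->
  L1 mu (fun t => K t * ppow e (t - r)).
Proof.
move=> gK e0 r0; apply: (@L1_le _ _ _ mu _ (fun t => M * (ppow e t * expR (- t)))).
- by apply: measurable_prof_int; case: gK.
- by move=> t; exact: prof_dom.
- by apply: L1Z; apply: L1_Gam; rewrite (lt_le_trans _ e0)// ltrN10.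
Qed.

Lemma prof_bound e K M r : good K M -> 0 <= e -> 0 <= r -> `|prof e K r| <= M * Gam e.
Proof.
move=> gK e0 r0; have LG : L1 mu (fun t => ppow e t * expR (- t)).
  by apply: L1_Gam; rewrite (lt_le_trans _ e0)// ltrN10.
rewrite /Gam -RintZ//; apply: Rint_norm_le.
- by apply: measurable_prof_int; case: gK.
- exact: L1Z.
- by move=> t; exact: prof_dom.
Qed.

Lemma measurable_prof e K : measurable_fun setT K -> measurable_fun setT (prof e K).
Proof.
move=> mK; apply: (@measurable_Rint1 _ _ R (measurableTypeR R) R mu (fun r t => K t * ppow e (t - r))).
apply: measurable_funM; first by apply: (measurableT_comp mK); exact: measurable_snd.
apply: (measurableT_comp (measurable_ppow e)).
by apply: measurable_funB; [exact: measurable_snd|exact: measurable_fst].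
Qed.

Lemma prof_lin e K1 M1 K2 M2 k1 k2 r : good K1 M1 -> good K2 M2 -> 0 <= e -> 0 <= r ->
  prof e (fun t => k1 * K1 t + k2 * K2 t) r = k1 * prof e K1 r + k2 * prof e K2 r.
Proof.
move=> g1 g2 e0 r0; have l1 := L1_prof g1 e0 r0; have l2 := L1_prof g2 e0 r0.
rewrite /prof -!RintZ// -RintD; [|exact: L1Z|exact: L1Z].
by apply: eq_Rint => t; ring.
Qed.

Lemma good_lin K1 M1 K2 M2 k1 k2 : good K1 M1 -> good K2 M2 ->
  good (fun t => k1 * K1 t + k2 * K2 t) (`|k1| * M1 + `|k2| * M2).
Proof.
move=> [m1 h1] [m2 h2]; split.
  by apply: measurable_funD; apply: measurable_funM.
move=> t; rewrite (le_trans (ler_normD _ _))// mulrDl !normrM -!mulrA.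
by apply: lerD; rewrite ler_wpM2l.
Qed.

(** Up to t - r = 2h the increment of the power is at most h^s. Beyond, the mean value theorem gives
    s h (t - r - h)^(s-1), integrable against the decay. In total this is O(h) for h <= 1. *)
Lemma prof_drift K M r h : good K M -> 0 <= r -> 0 <= h ->
  `|prof s K r - prof s K (r + h)| <=
  M * (h `^ s * (2 * h) + s * h * Gam (s - 1)).
Proof.
move=> gK r0; have M0 := good_ge0 gK.
rewrite le_eqVlt => /predU1P[<-|h0].
  by rewrite addr0 subrr normr0 mulr0 mulr0 mulr0 mul0r addr0 mulr0.
have rh0 : 0 <= r + h by rewrite addr_ge0// ltW.
have ss1 : -1 < s - 1 by rewrite ltrBDr addrC subrr.
have h20 : 0 < 2 * h by rewrite mulr_gt0.
have [L2 I2] := Rint_ppow_near0 (ltrN10 R) h20.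
have L3 := L1_Gam ss1.
pose B t := h `^ s * (if t < 2 * h then ppow 0 t else 0) +
   s * h * (ppow (s - 1) (t - h) * expR (- (t - h))).
have LB1 : L1 mu (fun t => h `^ s * (if t < 2 * h then ppow 0 t else 0)) by exact: L1Z.
have LB2 : L1 mu (fun t => s * h * (ppow (s - 1) (t - h) * expR (- (t - h)))).
  by apply: L1Z; exact: (L1_shift (- h) L3).
have LB : L1 mu B by exact: L1D.
have IB : \int[mu]_t B t = h `^ s * (2 * h) + s * h * Gam (s - 1).
  rewrite /B RintD// RintZ// RintZ; last exact: (L1_shift (- h) L3).
  rewrite I2 (Rint_shift (- h) L3) add0r powRr1 ?(ltW h20)//.
  by rewrite invr1 mulr1.
rewrite /prof -RintB; [|exact: L1_prof gK (ltW s0) r0|exact: L1_prof gK (ltW s0) rh0].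
have LBr : L1 mu (fun t => B (t - r)) by exact: (L1_shift (- r) LB).
rewrite -IB -(Rint_shift (- r) LB) -RintZ//.
apply: Rint_norm_le; [|exact: L1Z|].
  by apply: measurable_funB; apply: measurable_prof_int; case: gK.
move=> t; rewrite -mulrBr normrM.
case: (gK) => _ /(_ t) Kt.
have pos : 0 <= ppow s (t - r) - ppow s (t - (r + h)).
  by rewrite subr_ge0 ppow_mono ?(ltW s0)// lerB// lerDl ltW.
rewrite (ger0_norm pos) (le_trans (ler_wpM2r pos Kt))// -mulrA ler_wpM2l//.
set u := t - r; have -> : t - (r + h) = u - h by rewrite /u; ring.
have B1 : 0 <= h `^ s * (if u < 2 * h then ppow 0 u else 0).
  by rewrite mulr_ge0 ?powR_ge0//; case: ifP => // _; exact: ppow_ge0.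
have B2 : 0 <= s * h * (ppow (s - 1) (u - h) * expR (- (u - h))).
  by rewrite !mulr_ge0 ?ppow_ge0 ?expR_ge0// ltW.
rewrite /B; have [u0|u0] := leP u 0.
  by rewrite [ppow s u]ppow0// [ppow s (u - h)]ppow0 ?subrr ?mulr0 ?addr_ge0//; lra.
have [u2|u2] := ltP u (2 * h).
  rewrite u2 in B1; apply: (@le_trans _ _ (h `^ s * ppow 0 u)); last by rewrite lerDl.
  rewrite [ppow 0 u]ppowE// powRr0 mulr1 -[leRHS]mul1r.
  apply: ler_pM; rewrite ?decay_ge0 ?decay_le1//.
    by rewrite subr_ge0 ppow_mono ?(ltW s0)// gerBl ltW.
  by have := @pw_sub _ _ s01 (u - h) h (ltW h0); rewrite subrK.
rewrite mulr0 add0r mulrC mulrA.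
have uh : 0 < u - h by lra.
apply: ler_pM; rewrite ?decay_ge0//.
- by rewrite subr_ge0 ppow_mono ?(ltW s0)// gerBl ltW.
- have := @pw_increment _ _ s01 (u - h) h uh h0.
  by rewrite subrK [ppow (s - 1) _]ppowE.
- rewrite /decay; case: ifPn => _; last exact: expR_ge0.
  by rewrite ler_expR lerN2 /u; lra.
Qed.

(** Bound K by M; the second difference of t_+^s with step h has L^1 norm of order h^(s+1). *)
Lemma prof_second_diff K M r h : good K M -> 0 < h -> h <= r ->
  `|2 * prof s K r - prof s K (r + h) - prof s K (r - h)| <=
  M * (h `^ (s + 1) * \int[mu]_t pw_sd s t).
Proof.
move=> gK h0 hr; have r0 : 0 <= r by lra.
have r1 : 0 <= r + h by lra.
have r2 : 0 <= r - h by lra.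
have l0 := L1_prof gK (ltW s0) r0; have l1 := L1_prof gK (ltW s0) r1.
have l2 := L1_prof gK (ltW s0) r2; have M0 := good_ge0 gK.
have [L I] := Rint_pw_sd s01 r h0.
rewrite /prof -RintZ// -RintB//; last exact: L1Z.
rewrite -RintB//; last by apply: L1B => //; exact: L1Z.
rewrite -I -RintZ//; apply: Rint_norm_le; [|exact: L1Z|].
  case: (gK) => mK _; do ?apply: measurable_funB; try exact: measurable_prof_int.
  by apply: measurable_funM => //; exact: measurable_prof_int.
move=> t; rewrite (_ : _ - _ - _ = K t *
    (2 * ppow s (t - r) - ppow s (t - r - h) - ppow s (t - r + h))); last first.
  have -> : t - (r + h) = t - r - h by ring.
  have -> : t - (r - h) = t - r + h by ring.
  by ring.
rewrite normrM ler_wpM2r//; case: gK => _ /(_ t) /le_trans; apply.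
by rewrite ler_piMr// decay_le1.
Qed.

Local Opaque Gam prof.

Let aux1 (p A B AB G : R) : p <= G -> A <= G -> B <= G -> AB <= A + B ->
  p + AB / 2 <= 2 * G.
Proof. lra. Qed.

Let aux3 (p a b : R) : 2 * p - a - b = 2 * p - b - a.
Proof. ring. Qed.

Let aux4 (a b c d : R) : a - (c + d) / 2 = (a - b) + (2 * b - c - d) / 2.
Proof. by field. Qed.

Let aux2 (A B X Y Z : R) : A <= X -> B <= Y -> 0 <= Y -> 0 <= Z ->
  A + B / 2 <= Z + X + Y.
Proof. lra. Qed.

(** |x + y|^2 and |x - y|^2 are |x|^2 + |y|^2 plus and minus 2 x.y. So the difference splits into a
    drift by |y|^2 and a centred second difference of step 2 |x.y|. That C is the same for all K is
    what the passage to the limit in K requires. *)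
Lemma second_diff_bound n (x : 'rV[R]_n) : exists2 C, 0 <= C &
  forall K M, good K M -> forall y,
  `|second_diff (prof s K) x y| <= M * C * Num.min 1 (ppow ((1 + s) / 2) (sq y)).
Proof.
have ss1 : -1 < s - 1 by rewrite ltrBDr addrC subrr.
have G0 := Gam_gt0 sN1; have G1 := Gam_gt0 ss1.
have [I0 I0E] : exists C, C = \int[mu]_t pw_sd s t by exists (\int[mu]_t pw_sd s t).
have I00 : 0 <= I0 by rewrite I0E; apply: Rint_ge0 => t; exact: normr_ge0.
have [C1 C1E] : exists C, C = 2 + Gam (s - 1) by exists (2 + Gam (s - 1)).
(* From h^(s+1) = (h^2)^((1+s)/2) and h^2 <= 4 |x|^2 |y|^2, by Cauchy-Schwarz. *)
have [C2 C2E] : exists C, C = (4 * sq x) `^ ((1 + s) / 2) * I0.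
  by exists ((4 * sq x) `^ ((1 + s) / 2) * I0).
have C10 : 0 <= C1 by rewrite C1E; exact: (addr_ge0 (ler0n R 2) (ltW G1)).
have C20 : 0 <= C2 by rewrite C2E mulr_ge0// powR_ge0.
exists (2 * Gam s + (C1 + C2)); first exact: (addr_ge0 (mulr_ge0 (ler0n R 2) (ltW G0)) (addr_ge0 C10 C20)).
move=> K M gK y; have M0 := good_ge0 gK.
set q := sq y; have q0 : 0 <= q by exact: sq_ge0.
have b0 : 0 < (1 + s) / 2 by rewrite divr_gt0// addr_gt0.
have e1 r : 1 `^ r = 1 :> R by rewrite powR1.
have [q1|q1] := leP 1 q.
  have -> : Num.min 1 (ppow ((1 + s) / 2) q) = 1.
    apply/min_idPl; rewrite ppowE ?(lt_le_trans _ q1)//.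
    by rewrite -[leLHS](e1 ((1 + s) / 2)); apply: powR_le => //; exact: ltW.
  rewrite mulr1 (@le_trans _ _ (M * (2 * Gam s)))//; last first.
    by rewrite ler_wpM2l// lerDl addr_ge0.
  have h1 := prof_bound gK (ltW s0) (sq_ge0 x).
  have h2 := prof_bound gK (ltW s0) (sq_ge0 (x + y)).
  have h3 := prof_bound gK (ltW s0) (sq_ge0 (x - y)).
  rewrite /second_diff (le_trans (ler_normB _ _))//.
  rewrite normrM (@ger0_norm _ 2^-1)//.
  have -> : M * (2 * Gam s) = 2 * (M * Gam s) by ring.
  exact: (aux1 h1 h2 h3 (ler_normD _ _)).
have -> : Num.min 1 (ppow ((1 + s) / 2) q) = ppow ((1 + s) / 2) q.
  apply/min_idPr; rewrite /ppow; case: ifPn => // _.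
  by rewrite -[leRHS](e1 ((1 + s) / 2)); apply: powR_le => //; exact: ltW.
move: q0; rewrite le_eqVlt => /predU1P[q0|q0].
  rewrite (sq_eq0 (esym q0)) /second_diff addr0 subr0.
  rewrite (_ : _ - _ / 2 = 0) ?normr0; last by field.
  exact: (mulr_ge0 (mulr_ge0 M0 (addr_ge0 (mulr_ge0 (ler0n R 2) (ltW G0))
    (addr_ge0 C10 C20))) (ppow_ge0 _ _)).
rewrite ppowE//.
have [q2 q3] : q <= q `^ ((1 + s) / 2) /\ q `^ s <= 1.
  split; first by apply: ger1_powR; [rewrite q0 ltW|have := s1; lra].
  by rewrite -[leRHS](e1 s); apply: powR_le; rewrite ?(ltW s0)// ltW.
have sd1 : `|prof s K (sq x) - prof s K (sq x + q)| <= M * C1 * q `^ ((1 + s) / 2).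
  apply: (le_trans (prof_drift gK (sq_ge0 x) (ltW q0))); rewrite -[leRHS]mulrA ler_wpM2l//.
  apply: (@le_trans _ _ (C1 * q)); last by rewrite ler_wpM2l.
  have -> : C1 * q = 2 * q + Gam (s - 1) * q by rewrite C1E; ring.
  apply: lerD; first by rewrite ler_piMl// mulr_ge0// ltW.
  by rewrite -mulrA [q * _]mulrC ler_piMl// ?mulr_ge0// ltW.
have sd2 : `|2 * prof s K (sq x + q) - prof s K (sq (x + y)) - prof s K (sq (x - y))|
    <= M * C2 * q `^ ((1 + s) / 2).
  pose h := `|2 * dotr x y|.
  have -> : 2 * prof s K (sq x + q) - prof s K (sq (x + y)) - prof s K (sq (x - y)) =
      2 * prof s K (sq x + q) - prof s K (sq x + q + h) - prof s K (sq x + q - h).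
    rewrite sqD sqB -/q /h.
    have [d0|d0] := leP 0 (2 * dotr x y); [rewrite (ger0_norm d0)|rewrite (ltr0_norm d0)].
      have -> : sq x + 2 * dotr x y + q = sq x + q + 2 * dotr x y by ring.
      by have -> : sq x - 2 * dotr x y + q = sq x + q - 2 * dotr x y by ring.
    have -> : sq x + 2 * dotr x y + q = sq x + q - - (2 * dotr x y) by ring.
    have -> : sq x - 2 * dotr x y + q = sq x + q + - (2 * dotr x y) by ring.
    exact: aux3.
  have hr : h <= sq x + q.
    have := sq_ge0 (x + y); have := sq_ge0 (x - y); rewrite sqB sqD -/q /h.
    by have [d0|d0] := leP 0 (2 * dotr x y); [rewrite (ger0_norm d0)|rewrite (ltr0_norm d0)]; lra.
  have [h0|h0] := ltP 0 h; last first.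
    have -> : h = 0 by apply/eqP; rewrite eq_le h0 normr_ge0.
    rewrite addr0 subr0 (_ : _ - _ - _ = 0) ?normr0; last by ring.
    by rewrite !mulr_ge0 ?powR_ge0.
  apply: (le_trans (prof_second_diff gK h0 hr)).
  rewrite -[leRHS]mulrA ler_wpM2l// C2E -I0E [leRHS]mulrAC ler_wpM2r//.
  rewrite -powRM ?mulr_ge0 ?sq_ge0//.
  have -> : h `^ (s + 1) = (h ^+ 2) `^ ((1 + s) / 2).
    by rewrite -powR_mulrn ?normr_ge0// -powRrM; congr (_ `^ _); field.
  apply: powR_le; rewrite ?(ltW b0) ?sqr_ge0//.
  rewrite /h real_normK ?num_real// exprMn.
  by have := dotr_sqr_le x y; rewrite -/q; lra.
have -> : second_diff (prof s K) x y = (prof s K (sq x) - prof s K (sq x + q)) +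
  (2 * prof s K (sq x + q) - prof s K (sq (x + y)) - prof s K (sq (x - y))) / 2.
  exact: aux4.
rewrite (le_trans (ler_normD _ _))// normrM (@ger0_norm _ 2^-1)//.
have p0 : 0 <= M * C2 * q `^ ((1 + s) / 2) by rewrite !mulr_ge0 ?powR_ge0.
have p1 : 0 <= M * (2 * Gam s) * q `^ ((1 + s) / 2).
  exact: (mulr_ge0 (mulr_ge0 M0 (mulr_ge0 (ler0n R 2) (ltW G0))) (powR_ge0 _ _)).
have -> : M * (2 * Gam s + (C1 + C2)) * q `^ ((1 + s) / 2) =
    M * (2 * Gam s) * q `^ ((1 + s) / 2) + M * C1 * q `^ ((1 + s) / 2) +
    M * C2 * q `^ ((1 + s) / 2) by ring.
exact: aux2.
Qed.

Local Transparent Gam prof.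

End profile.

(** * The identity for the fractional Laplacian: linearity and limits *)

Section identity.
Context {R : realType}.
Variables (n : nat) (s : R).
Hypothesis s01 : 0 < s < 1.
Local Notation mu := (@lebesgue_measure R).
Local Notation leb := (lebesgue_rV R n).
Local Notation a := (n%:R / 2 : R).
Let s0 : 0 < s. Proof. by case/andP: s01. Qed.
Let s1 : s < 1. Proof. by case/andP: s01. Qed.
Let ss1 : -1 < s - 1. Proof. by rewrite ltrBDr addrC subrr. Qed.
(* The power [-1] agrees with the inverse for [m > 0], the only relevant case. *)
Definition om (m : R) : R := m * (1 + m) `^ (-1).

Definition Efun (K : R -> R) (r : R) : R :=
  \int[mu]_m (ppow (s - 1) m *
    (prof 0 K r - om m `^ a * prof 0 K (om m * r))).

(** The dominating weight for [Efun]: the bracket is O(1 - w) and 1 - w = 1/(1 + m) tames m^(s-1) at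
    infinity. *)
Definition Eweight (m : R) : R := ppow (s - 1) m * (1 + m) `^ (-1).

Lemma omE m : 0 < m -> om m = m / (1 + m).
Proof. by move=> m0; rewrite /om powR_inv1// addr_ge0// ltW. Qed.

Lemma EweightE m : 0 < m -> Eweight m = m `^ (s - 1) / (1 + m).
Proof. by move=> m0; rewrite /Eweight ppowE// powR_inv1// addr_ge0// ltW. Qed.

Lemma om01 m : 0 < m -> 0 < om m < 1.
Proof.
move=> m0; have m1 : 0 < 1 + m by rewrite addr_gt0.
by rewrite omE// divr_gt0//= ltr_pdivrMr// mul1r ltrDr.
Qed.

Lemma onem_om m : 0 < m -> 1 - om m = (1 + m)^-1.
Proof. by move=> m0; rewrite omE//; field; rewrite gt_eqF// addr_gt0. Qed.

Lemma measurable_om : measurable_fun setT om.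
Proof.
apply: measurable_funM => //.
by apply: (measurableT_comp (measurable_powR _)); exact: measurable_funD.
Qed.

Lemma measurable_Eweight : measurable_fun setT Eweight.
Proof.
apply: measurable_funM; first exact: measurable_ppow.
by apply: (measurableT_comp (measurable_powR _)); exact: measurable_funD.
Qed.

Lemma L1_Eweight : L1 mu Eweight.
Proof.
apply: (@L1_ppow_dom _ _ 1 (s - 1) (s - 1 - 1)) => //.
- exact: measurable_Eweight.
- by rewrite ltrBlDr addNr subr_lt0.
- by move=> t t0; rewrite /Eweight ppow0// mul0r.
- move=> t /andP[t0 _]; rewrite mul1r EweightE//.
  rewrite ger0_norm ?divr_ge0 ?powR_ge0 ?addr_ge0 ?(ltW t0)//.
  by rewrite ler_pdivrMr ?addr_gt0// ler_peMr ?powR_ge0// lerDl ltW.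
- move=> t t1; have t0 : 0 < t by rewrite (lt_le_trans ltr01).
  rewrite mul1r EweightE//.
  rewrite ger0_norm ?divr_ge0 ?powR_ge0 ?addr_ge0 ?(ltW t0)//.
  rewrite [t `^ (s - 1 - 1)]powRB; last by rewrite (gt_eqF t0) implybT.
  rewrite powRr1 ?(ltW t0)// ler_wpM2l ?powR_ge0// lef_pV2 ?posrE ?addr_gt0//.
  by rewrite lerDr.
Qed.

(** The tail integral varies at rate at most M. The factor 2 arises because 0 < t - r <= h is
    covered by a strict truncation at 2h. *)
Lemma tail_lipschitz (K : R -> R) M r h : good K M -> 0 <= r -> 0 <= h ->
  `|prof 0 K r - prof 0 K (r + h)| <= M * (2 * h).
Proof.
move=> gK r0; have M0 := good_ge0 gK.
rewrite le_eqVlt => /predU1P[<-|h0].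
  by rewrite addr0 subrr normr0 !mulr0.
have rh0 : 0 <= r + h by rewrite addr_ge0// ltW.
have h20 : 0 < 2 * h by rewrite mulr_gt0.
have [L2 I2] := Rint_ppow_near0 (ltrN10 R) h20.
rewrite /prof -RintB; [|exact: L1_prof gK (lexx 0) r0|exact: L1_prof gK (lexx 0) rh0].
have IB : \int[mu]_t (if t < 2 * h then ppow 0 t else 0) = 2 * h.
  by rewrite I2 add0r powRr1 ?(ltW h20)// invr1 mulr1.
rewrite -IB -(Rint_shift (- r) L2) -RintZ; last exact: (L1_shift (- r) L2).
apply: Rint_norm_le; [|by apply: L1Z; exact: (L1_shift (- r) L2)|].
  by apply: measurable_funB; apply: measurable_prof_int; case: gK.
move=> t; rewrite -mulrBr normrM; case: (gK) => _ /(_ t) Kt.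
apply: ler_pM => //.
  by rewrite (le_trans Kt)// ler_piMr// decay_le1.
set u := t - r; have -> : t - (r + h) = u - h by rewrite /u; ring.
have [u0|u0] := leP u 0.
  rewrite (ppow0 _ u0) ppow0 ?subrr ?normr0 ?if_same//.
  by rewrite subr_le0 (le_trans u0)// ltW.
have uE : ppow 0 u = 1 by rewrite ppowE// powRr0.
have [u2|u2] := ltP u (2 * h).
  rewrite uE /ppow powRr0; case: ifP => _; first by rewrite subrr normr0.
  by rewrite subr0 normr1.
rewrite uE [ppow 0 (u - h)]ppowE ?powRr0 ?subrr ?normr0//.
by rewrite subr_gt0 (lt_le_trans _ u2)// mulr2n mulrDl !mul1r ltrDl.
Qed.

(** Since w < 1, w^(n/2) >= w^n, and Bernoulli's inequality applies to the integer exponent. *)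
Lemma onem_powR_om m : 0 < m -> 0 <= 1 - om m `^ a <= n%:R / (1 + m).
Proof.
move=> m0; have /andP[w0 w1] := om01 m0; apply/andP; split.
  rewrite subr_ge0 -[leRHS](powRr0 (om m)).
  by apply: ger_powR => //; rewrite w0 ltW.
rewrite -(onem_om m0).
have h : om m ^+ n <= om m `^ a.
  rewrite -powR_mulrn ?(ltW w0)//; apply: ger_powR; first by rewrite w0 ltW.
  by rewrite ler_pdivrMr// ler_peMr// ler1n.
have B k : 1 - om m ^+ k <= k%:R * (1 - om m).
  elim: k => [|k IH]; first by rewrite expr0 subrr mul0r.
  rewrite exprS; have -> : 1 - om m * om m ^+ k =
    (1 - om m) + om m * (1 - om m ^+ k) by ring.
  rewrite -addn1 natrD mulrDl mul1r addrC lerD2r.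
  rewrite (le_trans _ IH)// ler_piMl// ?(ltW w1)//.
  by rewrite subr_ge0 exprn_ile1// ltW.
by rewrite (le_trans _ (B n))// lerB.
Qed.

(** Split H(r) - w^a H(w r) into H(r) - H(w r) and (1 - w^a) H(w r); both are O(1/(1 + m)). *)
Lemma Efun_dom (K : R -> R) M r m : good K M -> 0 <= r ->
  `|ppow (s - 1) m * (prof 0 K r - om m `^ a * prof 0 K (om m * r))| <=
  M * (2 * r + n%:R * Gam 0) * Eweight m.
Proof.
move=> gK r0; have M0 := good_ge0 gK; have G0 := Gam_gt0 (ltrN10 R).
have [m0|m0] := leP m 0; first by rewrite /Eweight ppow0// !mul0r normr0 mulr0.
have /andP[w0 w1] := om01 m0; have /andP[h1 h2] := onem_powR_om m0.
have wr0 : 0 <= om m * r by rewrite mulr_ge0// ltW.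
rewrite EweightE// normrM ppowE// (ger0_norm (powR_ge0 _ _)) mulrCA ler_wpM2l ?powR_ge0//.
have t1 := @tail_lipschitz K M (om m * r) ((1 - om m) * r) gK wr0 _.
have t1' : `|prof 0 K (om m * r) - prof 0 K r| <= M * (2 * ((1 - om m) * r)).
  have := t1 (mulr_ge0 _ r0); rewrite subr_ge0 (ltW w1) => /(_ isT).
  by rewrite (_ : om m * r + _ = r)//; ring.
have t2 := prof_bound gK (lexx 0) wr0.
have -> : prof 0 K r - om m `^ a * prof 0 K (om m * r) =
   - (prof 0 K (om m * r) - prof 0 K r) + (1 - om m `^ a) * prof 0 K (om m * r).
  by move: (prof _ _ _) (prof _ _ _) => A B; ring.
rewrite (le_trans (ler_normD _ _))// normrN normrM (ger0_norm h1).
have -> : M * (2 * r + n%:R * Gam 0) / (1 + m) =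
  M * (2 * ((1 + m)^-1 * r)) + n%:R / (1 + m) * (M * Gam 0).
  by move: (Gam _) => A; ring.
by rewrite -(onem_om m0) in h2 *; apply: lerD => //; apply: ler_pM.
Qed.

Lemma measurable_Efun_int (K : R -> R) r : measurable_fun setT K ->
  measurable_fun setT (fun m => ppow (s - 1) m *
    (prof 0 K r - om m `^ a * prof 0 K (om m * r))).
Proof.
move=> mK; apply: measurable_funM; first exact: measurable_ppow.
apply: measurable_funB; first exact: measurable_cst.
apply: measurable_funM.
  exact: (measurableT_comp (measurable_powR _) measurable_om).
apply: (measurableT_comp (measurable_prof 0 mK)).
by apply: measurable_funM => //; exact: measurable_om.
Qed.

Lemma L1_Efun (K : R -> R) M r : good K M -> 0 <= r ->
  L1 mu (fun m => ppow (s - 1) m *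
    (prof 0 K r - om m `^ a * prof 0 K (om m * r))).
Proof.
move=> gK r0; apply: (@L1_le _ _ _ mu _ (fun m => M * (2 * r + n%:R * Gam 0) * Eweight m)).
- by apply: measurable_Efun_int; case: gK.
- by move=> m; exact: Efun_dom.
- exact: (L1Z _ L1_Eweight).
Qed.

Lemma om_ge0 m r : 0 < m -> 0 <= r -> 0 <= om m * r.
Proof. by move=> /om01 /andP[/ltW w0 _] r0; rewrite mulr_ge0. Qed.

(** The constant is Gamma(s+1) pi^(n/2) / Gamma(n/2 + s), as found on exponentials; [Gam 0], the
    integral of e^(-t), is kept unevaluated. *)
Definition Ident (x : 'rV[R]_n) (K : R -> R) : Prop :=
  sym_int s (prof s K) x =
  Gam s * Num.sqrt pi ^+ n / (Gam (a + s - 1) * Gam 0) * Efun K (sq x).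

Lemma L1_sym_int (K : R -> R) M x : good K M ->
  L1 leb (fun y => second_diff (prof s K) x y * kern s y).
Proof.
move=> gK; have [C _ HC] := second_diff_bound s01 x.
apply: (L1_dominated_kern s01 _ (HC K M gK)).
by apply: measurable_second_diff; apply: measurable_prof; case: gK.
Qed.

Lemma ident_lin x K1 M1 K2 M2 k1 k2 : good K1 M1 -> good K2 M2 ->
  Ident x K1 -> Ident x K2 -> Ident x (fun t => k1 * K1 t + k2 * K2 t).
Proof.
move=> g1 g2 I1 I2; rewrite /Ident.
have E1 : sym_int s (prof s (fun t => k1 * K1 t + k2 * K2 t)) x =
    k1 * sym_int s (prof s K1) x + k2 * sym_int s (prof s K2) x.
  have L1' := L1_sym_int x g1; have L2' := L1_sym_int x g2.
  rewrite /sym_int -!RintZ// -RintD; [|exact: L1Z|exact: L1Z].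
  apply: eq_Rint => y; rewrite /second_diff !(prof_lin _ _ g1 g2 (ltW s0)) ?sq_ge0//.
  move: (kern _ _) (prof s K1 (sq x)) (prof s K1 (sq (x + y))) (prof s K1 (sq (x - y)))
    (prof s K2 (sq x)) (prof s K2 (sq (x + y))) (prof s K2 (sq (x - y))) => *.
  by field.
have E2 : Efun (fun t => k1 * K1 t + k2 * K2 t) (sq x) =
    k1 * Efun K1 (sq x) + k2 * Efun K2 (sq x).
  have L1' := L1_Efun g1 (sq_ge0 x); have L2' := L1_Efun g2 (sq_ge0 x).
  rewrite /Efun -!RintZ// -RintD; [|exact: L1Z|exact: L1Z].
  apply: eq_Rint => m; have [m0|m0] := leP m 0.
    by rewrite ppow0// !mul0r !mulr0 addr0.
  rewrite !(prof_lin _ _ g1 g2 (lexx 0)) ?sq_ge0 ?om_ge0 ?sq_ge0//.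
  move: (prof 0 K1 (sq x)) (prof 0 K1 (om m * sq x)) (prof 0 K2 (sq x))
    (prof 0 K2 (om m * sq x)) (ppow _ _) (powR _ _) => *.
  by ring.
rewrite E1 E2 I1 I2; move: (Efun K1 _) (Efun K2 _) (_ / _) => *.
by ring.
Qed.

Lemma prof_cvg e (K_ : nat -> R -> R) K M r : (forall k, good (K_ k) M) -> good K M ->
  {ae mu, forall t, K_ ^~ t @ \oo --> K t} -> 0 <= e -> 0 <= r ->
  prof e (K_ k) r @[k --> \oo] --> prof e K r.
Proof.
move=> gK_ gK cK e0 r0.
apply: (@Rint_dct _ _ _ mu (fun k t => K_ k t * ppow e (t - r)) _
  (fun t => M * (ppow e t * expR (- t)))).
- by move=> k; apply: measurable_prof_int; case: (gK_ k).
- by apply: measurable_prof_int; case: gK.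
- apply: filterS cK; first exact: (ae_filter_ringOfSetsType mu).
  by move=> t ct; apply: cvgMl.
- by apply: L1Z; apply: L1_Gam; rewrite (lt_le_trans _ e0)// ltrN10.
- by move=> k t; exact: prof_dom.
Qed.

(** Dominated convergence on both sides: [second_diff_bound] and [Efun_dom] involve the density only
    through M. *)
Lemma ident_closed x (K_ : nat -> R -> R) K M : (forall k, good (K_ k) M) -> good K M ->
  {ae mu, forall t, K_ ^~ t @ \oo --> K t} ->
  (forall k, Ident x (K_ k)) -> Ident x K.
Proof.
move=> gK_ gK cK IK; rewrite /Ident.
have [C C0 HC] := second_diff_bound s01 x.
have c1 : sym_int s (prof s (K_ k)) x @[k --> \oo] --> sym_int s (prof s K) x.
  apply: (@Rint_dct _ _ _ leb (fun k y => second_diff (prof s (K_ k)) x y * kern s y) _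
    (fun y => M * C * (Num.min 1 (ppow ((1 + s) / 2) (sq y)) * kern s y))).
  - move=> k; apply: measurable_funM; last exact: measurable_kern.
    by apply: measurable_second_diff; apply: measurable_prof; case: (gK_ k).
  - apply: measurable_funM; last exact: measurable_kern.
    by apply: measurable_second_diff; apply: measurable_prof; case: gK.
  - apply: aeW => y; apply: cvgMl; apply: cvgB.
      exact: prof_cvg gK_ gK cK (ltW s0) (sq_ge0 _).
    apply: cvgMl; apply: cvgD.
      exact: prof_cvg gK_ gK cK (ltW s0) (sq_ge0 _).
    exact: prof_cvg gK_ gK cK (ltW s0) (sq_ge0 _).
  - exact: (L1Z _ (L1_kern n s01)).
  - move=> k y; rewrite normrM (ger0_norm (ppow_ge0 _ _)) mulrA.
    by rewrite ler_wpM2r ?ppow_ge0//; exact: HC.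
have c2 : Efun (K_ k) (sq x) @[k --> \oo] --> Efun K (sq x).
  apply: (@Rint_dct _ _ _ mu (fun k m => ppow (s - 1) m *
      (prof 0 (K_ k) (sq x) - om m `^ a * prof 0 (K_ k) (om m * sq x))) _
    (fun m => M * (2 * sq x + n%:R * Gam 0) * Eweight m)).
  - by move=> k; apply: measurable_Efun_int; case: (gK_ k).
  - by apply: measurable_Efun_int; case: gK.
  - apply: aeW => m; have [m0|m0] := leP m 0.
      under eq_fun do rewrite ppow0// mul0r.
      by rewrite ppow0// mul0r; exact: cvg_cst.
    apply: cvgMr; apply: cvgB.
      exact: prof_cvg gK_ gK cK (lexx 0) (sq_ge0 _).
    apply: cvgMr.
    exact: prof_cvg gK_ gK cK (lexx 0) (om_ge0 m0 (sq_ge0 _)).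
  - exact: (L1Z _ L1_Eweight).
  - by move=> k m; apply: Efun_dom => //; exact: sq_ge0.
apply: (cvg_unique _ c1) => //.
rewrite (_ : (fun k => _) = (fun k => Gam s * Num.sqrt pi ^+ n /
  (Gam (a + s - 1) * Gam 0) * Efun (K_ k) (sq x))); last exact/funext.
by apply: cvgMr.
Qed.

End identity.

(** * The identity for exponential densities *)

Section exponentials.
Context {R : realType}.
Variables (n : nat) (s : R).
Hypothesis s01 : 0 < s < 1.
Local Notation mu := (@lebesgue_measure R).
Local Notation leb := (lebesgue_rV R n).
Local Notation a := (n%:R / 2 : R).
Let s0 : 0 < s. Proof. by case/andP: s01. Qed.
Let sN1 : -1 < s. Proof. by rewrite (lt_trans _ s0)// ltrN10. Qed.
Let ss1 : -1 < s - 1. Proof. by rewrite ltrBDr addrC subrr. Qed.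
Let as1 : -1 < a + s - 1. Proof. by rewrite -addrA ltr_wpDl. Qed.

Definition expK (p t : R) : R := if 0 <= t then expR (- (p * t)) else 0.

Lemma good_expK p : 1 <= p -> good (expK p) 1.
Proof.
move=> p1; split.
  apply: measurable_fun_ifT; [|exact: measurable_expRN|exact: measurable_cst].
  exact: measurable_fun_ler.
move=> t; rewrite mul1r /expK /decay; case: ifPn => t0; last by rewrite normr0.
by rewrite ger0_norm ?expR_ge0// ler_expR lerN2 ler_peMl.
Qed.

Lemma prof_expK e p r : 0 <= e -> 0 < p -> 0 <= r ->
  prof e (expK p) r = p `^ (- (e + 1)) * Gam e * expR (- (p * r)).
Proof.
move=> e0 p0 r0.
have [L I] := Rint_Gam (lt_le_trans (ltrN10 R) e0) p0.
have E t : expK p t * ppow e (t - r) =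
    expR (- (p * r)) * (ppow e (t - r) * expR (- (p * (t - r)))).
  have [tr|tr] := leP (t - r) 0; first by rewrite ppow0// mul0r !mulr0.
  rewrite /expK ifT; last by rewrite (le_trans r0)// -subr_ge0 ltW.
  rewrite mulrCA -expRD [LHS]mulrC; congr (_ * expR _); ring.
rewrite /prof; under eq_Rintegral do rewrite E.
rewrite RintZ; last exact: (L1_shift (- r) L).
by rewrite (Rint_shift (- r) L) I mulrC.
Qed.

Lemma gauss_constE (l : R) : 0 < l ->
  (Num.sqrt pi / Num.sqrt l) ^+ n = Num.sqrt pi ^+ n * l `^ (- a) :> R.
Proof.
move=> l0; rewrite expr_div_n; congr (_ * _).
rewrite -powR12_sqrt ?ltW// -powR_mulrn ?powR_ge0// -powRN -powRrM.
by congr (_ `^ _); ring.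
Qed.

Lemma powR_add (l u v : R) : 0 < l -> l `^ (u + v) = l `^ u * l `^ v.
Proof. by move=> l0; rewrite powRD// (gt_eqF l0) implybT. Qed.

Let sd p (x y : 'rV[R]_n) := second_diff (fun r => expR (- (p * r))) x y.

Let measurable_sd p x : measurable_fun setT (sd p x).
Proof. by apply: measurable_second_diff; exact: measurable_expRN. Qed.

Let ks p : R := p `^ (- (s + 1)) * Gam s.

Let ks_gt0 p : 0 < p -> 0 < ks p.
Proof. by move=> p0; rewrite mulr_gt0 ?powR_gt0 ?Gam_gt0. Qed.

Let sdE p x y : 0 < p -> second_diff (prof s (expK p)) x y = ks p * sd p x y.
Proof.
move=> p0; rewrite /sd /second_diff !(prof_expK (ltW s0) p0) ?sq_ge0// -/(ks p).
by move: (ks p) => k; field.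
Qed.

Let sd_bound p x : 1 <= p -> exists2 C, 0 <= C &
  forall y, `|sd p x y| <= C * Num.min 1 (ppow ((1 + s) / 2) (sq y)).
Proof.
move=> p1; have p0 : 0 < p by rewrite (lt_le_trans ltr01).
have k0 := ks_gt0 p0.
have [C C0 HC] := second_diff_bound s01 x.
exists (C / ks p); first by rewrite divr_ge0// ltW.
move=> y; have := HC _ _ (good_expK p1) y; rewrite sdE// normrM mul1r => h.
by rewrite mulrAC ler_pdivlMr// mulrC -{1}(gtr0_norm k0).
Qed.

Let sd0 p x y : sq y = 0 -> sd p x y = 0.
Proof.
move=> /sq_eq0 ->; rewrite /sd /second_diff addr0 subr0.
by move: (expR _) => e; field.
Qed.

(** The origin of w in [Efun]: with l = m p, the exponent p l / (p + l) is p w, and (p + l)^(-a) =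
    l^(-a) w^a. *)
Let Rint_sd_gauss p x m : 0 < p -> 0 < m ->
  L1 leb (fun y => sd p x y * expR (- (m * (p * sq y)))) /\
  \int[leb]_y (sd p x y * expR (- (m * (p * sq y)))) =
  Num.sqrt pi ^+ n * (m * p) `^ (- a) *
    (expR (- (p * sq x)) - om m `^ a * expR (- (p * (om m * sq x)))).
Proof.
move=> p0 m0; have mp0 : 0 < m * p by rewrite mulr_gt0.
have [L0 I0] := Rint_gauss0 n mp0.
have [L1p I1] := Rint_gauss x (ltW p0) mp0.
have [L2 I2] := Rint_gauss (- x) (ltW p0) mp0.
have sqE y : sq (- x + y) = sq (x - y) by rewrite -sqN opprD opprK.
have E y : sd p x y * expR (- (m * (p * sq y))) =
    expR (- (p * sq x)) * expR (- (m * p * sq y)) -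
    2^-1 * (expR (- (p * sq (x + y) + m * p * sq y)) +
            expR (- (p * sq (- x + y) + m * p * sq y))).
  rewrite sqE /sd /second_diff !opprD !expRD mulrA.
  by move: (expR _) (expR (- (p * sq (x + y)))) (expR (- (p * sq (x - y))))
    (expR (- (m * p * sq y))) => *; field.
have La : L1 leb (fun y => expR (- (p * sq x)) * expR (- (m * p * sq y))) by exact: L1Z.
have Lb : L1 leb (fun y => 2^-1 * (expR (- (p * sq (x + y) + m * p * sq y)) +
            expR (- (p * sq (- x + y) + m * p * sq y)))).
  by apply: L1Z; exact: L1D.
split; first by apply: eq_L1 (L1B La Lb) => y; rewrite E.
under eq_Rintegral do rewrite E.
rewrite RintB// RintZ// RintZ; last exact: L1D.
rewrite RintD// I0 I1 I2 sqN.
have pmp : 0 < p + m * p by rewrite addr_gt0.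
rewrite !gauss_constE//.
have w0 : 0 < om m by have /andP[] := om01 m0.
have pE : m * p = om m * (p + m * p).
  by rewrite omE//; field; rewrite gt_eqF// addr_gt0.
have -> : p * (m * p) / (p + m * p) * sq x = p * (om m * sq x).
  by rewrite {1}pE; field; rewrite gt_eqF.
have -> : (p + m * p) `^ (- a) = (m * p) `^ (- a) * om m `^ a.
  rewrite [in RHS]pE powRM ?(ltW w0) ?(ltW pmp)//.
  by rewrite mulrAC -powR_add// addNr powRr0 mul1r.
move: (_ `^ (- a)) (om m `^ a) (expR _) (expR (- (p * (om m * sq x)))) (_ ^+ n) => *.
by field.
Qed.

Let aux1 (w k e o e' : R) : w * (k * e - o * (k * e')) = k * (w * (e - o * e')).
Proof. by ring. Qed.

Let aux2 (ma mi S pa w d : R) :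
  ma * w * (S * (mi * pa) * d) = ma * mi * (S * pa * (w * d)).
Proof. by ring. Qed.

Let aux3 (Gs G0 G1 pa ps p01 S X : R) : pa != 0 -> ps != 0 -> G0 != 0 -> G1 != 0 ->
  pa * ps * pa^-1 * p01 * Gs * ((pa * ps * G1)^-1 * (S * pa * X)) =
  Gs * S / (G1 * G0) * (p01 * G0 * X).
Proof. by move=> *; field; do !(apply/andP; split). Qed.

(** Expand the kernel as a Gamma integral of Gaussians and exchange the integrals in m and y. *)
Lemma ident_exp p (x : 'rV[R]_n) : 1 <= p -> Ident s x (expK p).
Proof.
move=> p1; have p0 : 0 < p by rewrite (lt_le_trans ltr01).
have [C C0 HC] := sd_bound x p1.
(* The mixture parameter is m p rather than m, so that w = m / (1 + m) does not involve p and [Efun]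
   is linear in the density. *)
pose F m y := sd p x y * (ppow (a + s - 1) m * expR (- (m * (p * sq y)))).
have Fb m y : `|F m y| <= C * p `^ (- (a + s - 1)) * mixk s (p * m) y.
  have pw0 : 0 <= ppow (a + s - 1) m * expR (- (m * (p * sq y))).
    by rewrite mulr_ge0 ?ppow_ge0 ?expR_ge0.
  rewrite /F /mixk normrM (ger0_norm pw0) ppowM//.
  apply: (le_trans (ler_wpM2r pw0 (HC y))).
  have -> : p * m * sq y = m * (p * sq y) by ring.
  have pp : p `^ (- (a + s - 1)) * p `^ (a + s - 1) = 1.
    by rewrite -powR_add// addNr powRr0.
  rewrite le_eqVlt; apply/orP; left; apply/eqP.
  rewrite [RHS](_ : _ = C * Num.min 1 (ppow ((1 + s) / 2) (sq y)) *
    (ppow (a + s - 1) m * expR (- (m * (p * sq y)))) *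
    (p `^ (- (a + s - 1)) * p `^ (a + s - 1))); first by rewrite pp mulr1.
  by ring.
have mF : measurable_fun setT (fun z => F z.1 z.2).
  apply: measurable_funM.
    by apply: (measurableT_comp (measurable_sd p x)); exact: measurable_snd.
  apply: measurable_funM.
    by apply: (measurableT_comp (measurable_ppow _)); exact: measurable_fst.
  apply: measurableT_comp => //; apply: measurableT_comp => //.
  apply: measurable_funM; first exact: measurable_fst.
  apply: measurable_funM => //.
  by apply: (measurableT_comp (@measurable_sq R n)); exact: measurable_snd.
have mFm m : measurable_fun setT (F m) by exact: (measurableT_comp mF (measurable_pair1 m)).
have F1 m : L1 leb (F m).
  apply: (@L1_le _ _ _ leb _ (fun y => C * p `^ (- (a + s - 1)) * mixk s (p * m) y)) => //.
  by apply: L1Z; exact: L1_mixk.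
have LF : L1 mu (fun m => \int[leb]_y `|F m y|).
  apply: (@L1_le _ _ _ mu _ (fun m => C * p `^ (- (a + s - 1)) *
    \int[leb]_y mixk s (p * m) y)).
  - apply: (@measurable_Rint1 _ _ (measurableTypeR R) _ R leb (fun m y => `|F m y|)).
    exact: measurableT_comp.
  - move=> m; rewrite ger0_norm; last by apply: Rint_ge0 => y; exact: normr_ge0.
    rewrite -RintZ; last exact: L1_mixk.
    by apply: Rint_le => //; [exact: L1_norm|apply: L1Z; exact: L1_mixk].
  - apply: L1Z; exact: (L1_scale p0 (L1_Rint_mixk n s01)).
pose c1 := p `^ (- (a + s)) * Gam (a + s - 1).
have c10 : 0 < c1 by rewrite mulr_gt0 ?powR_gt0 ?Gam_gt0.
have F2 y : L1 mu (F^~ y) /\ \int[mu]_m F m y = c1 * (sd p x y * kern s y).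
  have [q0|q0] := leP (sq y) 0.
    have q00 : sq y = 0 by apply/eqP; rewrite eq_le q0 sq_ge0.
    have E : F^~ y = cst 0 by apply/funext => m; rewrite /F sd0// mul0r.
    rewrite E sd0// mul0r mulr0 Rintegral_cst ?mul0r//.
    by split => //; exact: L10.
  have [L I] := Rint_mixw s01 q0 p0.
  split; first exact: (L1Z _ L).
  by rewrite /F RintZ// I -/c1 mulrCA.
pose X := \int[mu]_m (ppow (s - 1) m *
  (expR (- (p * sq x)) - om m `^ a * expR (- (p * (om m * sq x))))).
pose k0 := p `^ (- (0 + 1)) * Gam 0.
have k00 : 0 < k0 by rewrite mulr_gt0 ?powR_gt0 ?Gam_gt0// ltrN10.
have LE := L1_Efun n s01 (good_expK p1) (sq_ge0 x).
have EX m : ppow (s - 1) m * (prof 0 (expK p) (sq x) -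
      om m `^ a * prof 0 (expK p) (om m * sq x)) =
    k0 * (ppow (s - 1) m * (expR (- (p * sq x)) -
      om m `^ a * expR (- (p * (om m * sq x))))).
  have [m0|m0] := leP m 0; first by rewrite ppow0// !mul0r mulr0.
  rewrite !(prof_expK (lexx 0) p0) ?sq_ge0 ?om_ge0 ?sq_ge0// -/k0.
have LX : L1 mu (fun m => ppow (s - 1) m * (expR (- (p * sq x)) -
      om m `^ a * expR (- (p * (om m * sq x))))).
  apply: eq_L1 (L1Z k0^-1 LE) => m; rewrite EX mulKf//.
  by rewrite gt_eqF.
have EE : Efun n s (expK p) (sq x) = k0 * X.
  rewrite /Efun; under eq_Rintegral do rewrite EX.
  by rewrite RintZ.
have FX m : \int[leb]_y F m y = Num.sqrt pi ^+ n * p `^ (- a) *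
    (ppow (s - 1) m * (expR (- (p * sq x)) - om m `^ a * expR (- (p * (om m * sq x))))).
  have [m0|m0] := leP m 0.
    rewrite (_ : F m = cst 0) ?Rintegral_cst ?mul0r// ?ppow0// ?mul0r ?mulr0//.
    by apply/funext => y; rewrite /F ppow0// mul0r mulr0.
  have [L I] := Rint_sd_gauss x p0 m0.
  rewrite (_ : F m = (fun y => ppow (a + s - 1) m *
    (sd p x y * expR (- (m * (p * sq y)))))); last first.
    by apply/funext => y; rewrite /F mulrCA.
  rewrite RintZ// I !ppowE// powRM ?(ltW m0) ?(ltW p0)//.
  have -> : a + s - 1 = a + (s - 1) by ring.
  rewrite powR_add//.
  have ma : m `^ a * m `^ (- a) = 1 by rewrite -powR_add// subrr powRr0.
  by rewrite aux2 ma mul1r.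
have I1 : \int[leb]_y (sd p x y * kern s y) = c1^-1 * (Num.sqrt pi ^+ n * p `^ (- a) * X).
  rewrite /X -RintZ//.
  transitivity (c1^-1 * \int[mu]_m \int[leb]_y F m y); last first.
    by congr (_ * _); apply: eq_Rint.
  rewrite (@Rint_Fubini _ _ (measurableTypeR R) _ R mu leb F mF F1 LF (fun y => (F2 y).1)).
  have LY := @L1_Fubini2 _ _ (measurableTypeR R) _ R mu leb F mF F1 LF (fun y => (F2 y).1).
  rewrite -RintZ//; apply: eq_Rint => y.
  by rewrite (F2 y).2 mulKf// gt_eqF.
have Lsd : L1 leb (fun y => sd p x y * kern s y).
  by apply: (L1_dominated_kern s01 (measurable_sd p x) HC).
rewrite /Ident EE /sym_int.
under eq_Rintegral do rewrite sdE// -mulrA.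
rewrite RintZ// I1 /k0 /c1 /ks.
have -> : - (s + 1) = - (a + s) + a + - (0 + 1) by ring.
rewrite !(powR_add _ _ p0).
have G1 := Gam_gt0 as1; have G0 := Gam_gt0 (ltrN10 R).
have p2 : 0 < p `^ (- a) by rewrite powR_gt0.
have p3 : 0 < p `^ (- s) by rewrite powR_gt0.
have p4 : p `^ a * p `^ (- a) = 1 by rewrite -powR_add// subrr powRr0.
have -> : - (a + s) = - a + - s by ring.
rewrite !(powR_add _ _ p0).
have -> : p `^ a = (p `^ (- a))^-1 by rewrite -powRN opprK.
apply: aux3; by rewrite gt_eqF.
Qed.

End exponentials.

(** * Bernstein averages *)

Section bernstein.
Context {R : realType}.
Implicit Types (q : R) (f : nat -> R).

(* The Bernstein average of [f] over the binomial law with parameters [m], [q],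
   by conditioning on the first trial. *)
Fixpoint bern q (m : nat) f : R :=
  if m is m'.+1 then q * bern q m' (f \o S) + (1 - q) * bern q m' f else f 0%N.

Lemma bern_lin q m f1 f2 (k1 k2 : R) :
  bern q m (fun i => k1 * f1 i + k2 * f2 i) = k1 * bern q m f1 + k2 * bern q m f2.
Proof.
elim: m f1 f2 => //= m IH f1 f2.
by rewrite (IH (f1 \o S) (f2 \o S)) (IH f1 f2); ring.
Qed.

Lemma bern_cst q m (k : R) : bern q m (fun=> k) = k.
Proof. by elim: m => //= m IH; rewrite IH; ring. Qed.

Lemma bern_le q m f1 f2 : 0 <= q <= 1 -> (forall i, f1 i <= f2 i) ->
  bern q m f1 <= bern q m f2.
Proof.
move=> /andP[q0 q1]; elim: m f1 f2 => [|m IH] f1 f2 f12 /=; first exact: f12.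
by apply: lerD; apply: ler_wpM2l; rewrite ?subr_ge0//; apply: IH => i /=.
Qed.

Lemma bern_norm q m f (M : R) : 0 <= q <= 1 -> (forall i, `|f i| <= M) ->
  `|bern q m f| <= M.
Proof.
move=> q01 fM; rewrite ler_norml; apply/andP; split.
  rewrite -(bern_cst q m (- M)); apply: bern_le => // i.
  by have := fM i; rewrite ler_norml => /andP[].
rewrite -(bern_cst q m M); apply: bern_le => // i.
by have := fM i; rewrite ler_norml => /andP[].
Qed.

(** The centre c is arbitrary because conditioning on the first trial shifts it by 1; c = m q gives
    the binomial variance. *)
Lemma bern_variance q m (c : R) :
  bern q m (fun i => (i%:R - c) ^+ 2) = m%:R * (q * (1 - q)) + (m%:R * q - c) ^+ 2.
Proof.
elim: m c => [|m IH] c /=; first by have -> : 0%:R = 0 :> R by []; ring.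
have -> : bern q m ((fun i => (i%:R - c) ^+ 2) \o S) =
    bern q m (fun i => (i%:R - (c - 1)) ^+ 2).
  by congr bern; apply/funext => i /=; rewrite -natr1; congr (_ ^+ 2); ring.
by rewrite !IH -natr1; ring.
Qed.

(** Bernstein's argument at a single continuity point: k differs from k q by at most e/2 + c (t -
    q)^2, and the variance of i/m is at most 1/m. *)
Lemma bern_cvg (k : R -> R) (M : R) q : 0 <= q <= 1 ->
  (forall t, `|k t| <= M) -> {for q, continuous k} ->
  bern q m (fun i => k (i%:R / m%:R)) @[m --> \oo] --> k q.
Proof.
move=> q01 kM kq; apply/cvgrPdist_le => e e0.
have M0 : 0 <= M by exact: le_trans (normr_ge0 _) (kM 0).
have e20 : 0 < e / 2 by rewrite divr_gt0.
move: (kq) => /cvgrPdist_le /(_ _ e20) /nbhs_ballP[d /= d0 hd].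
(* Where |t - q| >= d the trivial bound 2M is at most c (t - q)^2. *)
pose c := 2 * M / d ^+ 2.
have c0 : 0 <= c by apply: divr_ge0; [exact: mulr_ge0|exact: sqr_ge0].
have key t : `|k t - k q| <= e / 2 + c * (t - q) ^+ 2.
  have [tq|tq] := ltP `|q - t| d.
    by rewrite distrC (le_trans (hd _ _))// lerDl mulr_ge0// sqr_ge0.
  apply: (@le_trans _ _ (2 * M)).
    by rewrite (le_trans (ler_normB _ _))// mulr2n mulrDl !mul1r lerD.
  rewrite -[leLHS]add0r lerD ?(ltW e20)// /c mulrAC ler_pdivlMr ?exprn_gt0//.
  rewrite ler_wpM2l ?mulr_ge0//.
  rewrite -[(t - q) ^+ 2](real_normK (num_real _)) distrC.
  by rewrite ler_pXn2r ?nnegrE ?normr_ge0 ?(ltW d0).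
near=> m.
have m0 : 0 < m%:R :> R by rewrite ltr0n; near: m; exists 1%N.
pose f1 := fun i => k (i%:R / m%:R).
pose v : nat -> R := fun i => (i%:R - m%:R * q) ^+ 2.
have key2 i : `|f1 i - k q| <= e / 2 + (c / m%:R ^+ 2) * v i.
  apply: (le_trans (key _)); rewrite lerD2l le_eqVlt; apply/orP; left; apply/eqP.
  by rewrite /v; field; rewrite gt_eqF.
have E : bern q m f1 - k q = bern q m (fun i => 1 * f1 i + (-1) * k q).
  by rewrite (bern_lin q m f1 (fun=> k q)) bern_cst mul1r mulN1r.
have B1 : bern q m f1 - k q <= bern q m (fun i => 1 * (e / 2) + (c / m%:R ^+ 2) * v i).
  rewrite E; apply: bern_le => // i.
  by rewrite mul1r mulN1r mul1r (le_trans (ler_norm _)).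
have B2 : - (bern q m f1 - k q) <= bern q m (fun i => 1 * (e / 2) + (c / m%:R ^+ 2) * v i).
  have -> : - (bern q m f1 - k q) = bern q m (fun i => (-1) * f1 i + 1 * k q).
    by rewrite (bern_lin q m f1 (fun=> k q)) bern_cst mul1r mulN1r opprB addrC.
  apply: bern_le => // i.
  rewrite mul1r mulN1r mul1r addrC; apply: le_trans (key2 i).
  by rewrite distrC ler_norm.
have B3 : bern q m (fun i => 1 * (e / 2) + (c / m%:R ^+ 2) * v i) <= e.
  rewrite (bern_lin q m (fun=> e / 2) v) bern_cst bern_variance.
  rewrite subrr expr0n addr0 mul1r.
  have qq : q * (1 - q) <= 1.
    case/andP: q01 => q0 q1; rewrite -[leRHS]mul1r.
    by apply: ler_pM => //; rewrite ?subr_ge0// gerBl.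
  have h : c / m%:R ^+ 2 * (m%:R * (q * (1 - q))) <= c / m%:R.
    have -> : c / m%:R ^+ 2 * (m%:R * (q * (1 - q))) = c / m%:R * (q * (1 - q)).
      by field; rewrite gt_eqF.
    by rewrite ler_piMr// divr_ge0// ltW.
  have h2 : c / m%:R <= e / 2.
    rewrite ler_pdivrMr// mulrC -ler_pdivrMr//.
    by near: m; exact: nbhs_infty_ger.
  by lra.
rewrite distrC ler_norml; apply/andP; split.
  by rewrite lerNl (le_trans B2).
exact: le_trans B1 B3.
Unshelve. all: by end_near. Qed.

End bernstein.

(** * From exponentials to general densities *)

Section identity_general.
Context {R : realType}.
Variables (n : nat) (s : R).
Hypothesis s01 : 0 < s < 1.
Local Notation mu := (@lebesgue_measure R).
Implicit Types (x : 'rV[R]_n) (f : nat -> R).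

(** On t >= 0, e^(-j t) times a polynomial in e^(-t), hence a combination of the exponentials of
    rates j, ..., j + m; j >= 1 keeps all rates in the range of [ident_exp]. *)
Let Kb (j m : nat) f (t : R) : R :=
  expK j%:R t * bern (expR (- t)) m f.

Let KbS j m f : Kb j m.+1 f = (fun t => 1 * Kb j m f t +
  1 * (1 * Kb j.+1 m (f \o S) t + (-1) * Kb j.+1 m f t)).
Proof.
apply/funext => t; rewrite /Kb /= /expK; case: ifPn => _; last by ring.
have -> : expR (- (j.+1%:R * t)) = expR (- (j%:R * t)) * expR (- t).
  by rewrite -expRD; congr expR; rewrite -natr1; ring.
move: (expR (- (_ * _))) (expR (- t)) => a b.
by move: (bern _ m (f \o S)) (bern _ m f) => *; ring.
Qed.

Let Kb_ident x j m f : (0 < j)%N ->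
  (exists M, good (Kb j m f) M) /\ Ident s x (Kb j m f).
Proof.
elim: m j f => [|m IH] j f j0.
  have j1 : 1 <= j%:R :> R by rewrite ler1n.
  have E : Kb j 0 f = (fun t => f 0%N * expK j%:R t + 0 * expK j%:R t).
    by apply/funext => t; rewrite /Kb /= mul0r addr0 mulrC.
  rewrite E; have g := good_expK j1; split.
    by eexists; exact: (good_lin _ _ g g).
  by apply: (ident_lin s01 _ _ g g); exact: ident_exp.
have [[M1 g1] I1] := IH j f j0.
have [[M2 g2] I2] := IH j.+1 (f \o S) isT.
have [[M3 g3] I3] := IH j.+1 f isT.
have g23 := good_lin 1 (-1) g2 g3.
have I23 := ident_lin s01 1 (-1) g2 g3 I2 I3.
rewrite KbS; split; first by eexists; exact: (good_lin _ _ g1 g23).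
exact: (ident_lin s01 _ _ g1 g23).
Qed.

(** Put q = e^(-t) and write K(t) = q k(q). The decay of K is exactly what bounds k by M. The
    Bernstein averages of k, multiplied by q, are dominated by M e^(-t) and converge to K for every
    t outside {0, P}. *)
Lemma ident_general x (K : R -> R) (M P : R) : good K M ->
  (forall t, 0 < t -> t != P -> {for t, continuous K}) -> Ident s x K.
Proof.
move=> gK cK; have M0 := good_ge0 gK.
pose k q := if 0 < q <= 1 then K (- ln q) / q else 0.
have kM q : `|k q| <= M.
  rewrite /k; case: ifPn => [/andP[q0 q1]|_]; last by rewrite normr0.
  rewrite normrM normfV (gtr0_norm q0) ler_pdivrMr//.
  case: gK => _ /(_ (- ln q)); rewrite /decay oppr_ge0 ln_le0// opprK lnK//.
have gb m : good (Kb 1 m (fun i => k (i%:R / m%:R))) M.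
  split; first by have [[M' []]] := @Kb_ident x 1 m (fun i => k (i%:R / m%:R)) isT.
  move=> t; rewrite /Kb /expK /decay mul1r; case: ifPn => t0; last by rewrite mul0r mulr0 normr0.
  rewrite normrM (ger0_norm (expR_ge0 _)) mulrC ler_wpM2r ?expR_ge0//.
  apply: bern_norm => //; rewrite expR_ge0 -[leRHS]expR0 ler_expR oppr_le0//.
apply: (ident_closed s01 (K_ := fun m => Kb 1 m (fun i => k (i%:R / m%:R))) gb gK); last first.
  by move=> m; have [] := @Kb_ident x 1 m (fun i => k (i%:R / m%:R)) isT.
exists ([set 0] `|` [set P]); split.
- exact: measurableU.
- have h r : mu [set r] = 0%E by exact: lebesgue_measure_set1.
  by rewrite measureU0//; exact: h.
move=> t /= nt; apply: contrapT => tP; apply: nt.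
have t0' : t != 0 by apply/eqP => tE; apply: tP; left.
have tP' : t != P by apply/eqP => tE; apply: tP; right.
have [t0|t0] := ltP t 0.
  have tF : (0 <= (t : R)) = false by apply/negbTE; rewrite -ltNge.
  have K0 : K t = 0.
    case: gK => _ /(_ t); rewrite /decay tF mulr0.
    by rewrite normr_le0 => /eqP.
  rewrite K0; under eq_fun do rewrite /Kb /expK tF mul0r.
  exact: cvg_cst.
have tp : 0 < t by rewrite lt_neqAle eq_sym t0'.
have q0 : 0 < expR (- t) by exact: expR_gt0.
have q1 : expR (- t) < 1 by rewrite -[ltRHS]expR0 ltr_expR oppr_lt0.
have KE : K t = expR (- t) * k (expR (- t)).
  rewrite /k q0 (ltW q1) /= expRK opprK mulrC divfK// gt_eqF//.
rewrite KE; under eq_fun do rewrite /Kb /expK (ltW tp) mul1r.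
apply: cvgMr; apply: (bern_cvg _ kM); first by rewrite !ltW.
apply: (@cvg_trans _ ((K (- ln q) / q) @[q --> expR (- t)])).
  apply: near_eq_cvg; near=> q; rewrite /k ifT//.
  apply/andP; split; first by near: q; exact: lt_nbhsr.
  by apply/ltW; near: q; exact: lt_nbhsl.
have c1 : K (- ln q) @[q --> expR (- t)] --> K (- ln (expR (- t))).
  apply: (@continuous_cvg _ _ _ _ _ (fun q => - ln q) K).
    by rewrite expRK opprK; exact: cK.
  by apply: cvgN; exact: continuous_ln.
have c2 : q^-1 @[q --> expR (- t)] --> (expR (- t))^-1.
  by apply: cvgV; [rewrite gt_eqF|exact: cvg_id].
by rewrite /k q0 (ltW q1) /=; exact: (cvgM c1 c2).
Unshelve. all: by end_near. Qed.

End identity_general.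

(** * Abel inversion *)

Section double_integrals.
Context {R : realType}.
Local Notation mu := (@lebesgue_measure R).
Local Notation RR := (measurableTypeR R).

Lemma Rint_swap (F : R -> R -> R) (G : R -> R) :
  measurable_fun setT (fun z : RR * RR => F z.1 z.2) ->
  (forall x, L1 mu (F x)) -> (forall x, \int[mu]_y `|F x y| <= G x) -> L1 mu G ->
  (forall y, L1 mu (F^~ y)) ->
  [/\ L1 mu (fun x => \int[mu]_y F x y), L1 mu (fun y => \int[mu]_x F x y) &
      \int[mu]_x \int[mu]_y F x y = \int[mu]_y \int[mu]_x F x y].
Proof.
move=> mF F1 FG LG F2.
have mN : measurable_fun setT (fun z : RR * RR => `|F z.1 z.2|).
  exact: measurableT_comp.
have LF : L1 mu (fun x => \int[mu]_y `|F x y|).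
  apply: (@L1_le _ _ _ mu _ G) => //.
    exact: (@measurable_Rint1 _ _ RR RR R mu (fun x y => `|F x y|)).
  by move=> x; rewrite ger0_norm//; exact: Rint_ge0.
split.
- exact: (@L1_Fubini1 _ _ RR RR R mu mu F mF F1 LF).
- exact: (@L1_Fubini2 _ _ RR RR R mu mu F mF F1 LF F2).
- exact: (@Rint_Fubini _ _ RR RR R mu mu F mF F1 LF F2).
Qed.

Lemma eq_Rint_ae2 (f g : R -> R) (a b : R) :
  measurable_fun setT f -> measurable_fun setT g ->
  (forall x, x != a -> x != b -> f x = g x) -> \int[mu]_x f x = \int[mu]_x g x.
Proof.
move=> mf mg fg; congr fine; apply: ae_eq_integral => //.
- exact/measurable_EFinP.
- exact/measurable_EFinP.
exists ([set a] `|` [set b]); split.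
- exact: measurableU.
- have h r : mu [set r] = 0%E by exact: lebesgue_measure_set1.
  by rewrite measureU0//; exact: h.
move=> t /= nt; apply: contrapT => tab; apply: nt => _.
rewrite fg//; apply/eqP => tE; apply: tab; [left|right]; exact: tE.
Qed.

Lemma L1_itv (p q : R) : p <= q -> L1 mu (fun v => if p <= v <= q then 1 else 0).
Proof.
move=> pq; have d (x : R) : p <= x <= q -> is_derive x 1 id (1 : R).
  by move=> _; exact: is_derive_id.
have c (x : R) : p <= x <= q -> {for x, continuous (fun _ : R => 1 : R)}.
  by move=> _; exact: cst_continuous.
by have [] := Rint_FTC pq d c.
Qed.

Lemma L1_itv_bounded (f : R -> R) (C p : R) : 0 <= p -> measurable_fun setT f ->
  (forall v, 0 <= v <= 1 -> `|f v| <= C) ->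
  L1 mu (fun v => if p < v < 1 then f v else 0).
Proof.
move=> p0 mf fC; apply: (@L1_le _ _ _ mu _ (fun v => C * (if 0 <= v <= 1 then 1 else 0))).
- by apply: measurable_fun_ifT => //; apply: measurable_and; exact: measurable_fun_ltr.
- move=> v; case: ifPn => [/andP[v0 v1]|_].
    have v01 : 0 <= v <= 1 by rewrite (le_trans p0 (ltW v0)) (ltW v1).
    by rewrite v01 mulr1; exact: fC.
  case: ifPn => [v01|_]; last by rewrite mulr0 normr0.
  by rewrite mulr1 normr0 (le_trans (normr_ge0 _) (fC _ v01)).
- by apply: L1Z; exact: L1_itv.
Qed.

(** Euler's Beta at (a + 1, b + 1). *)
Definition Bet (a b : R) : R := \int[mu]_v (ppow a v * ppow b (1 - v)).

Lemma Bet_gt0 a b : -1 < a -> -1 < b -> 0 < Bet a b.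
Proof.
move=> a1 b1; apply: Rint_gt0 (L1_Beta a1 b1) _ _.
  by move=> t; rewrite mulr_ge0 ?ppow_ge0.
rewrite (_ : [set x | _] = `]0, 1[%classic); last first.
  apply/seteqP; split=> t /=; rewrite in_itv/=.
    apply: contraNT; rewrite negb_and -!leNgt => /orP[t0|t1].
      by rewrite ppow0// mul0r.
    by rewrite [X in _ * X]ppow0 ?mulr0// subr_le0.
  move=> /andP[t0 t1]; rewrite !ppowE ?subr_gt0//.
  by rewrite mulf_neq0// gt_eqF// powR_gt0// subr_gt0.
suff : (mu `]0%R, 1%R[%classic != 0)%E by [].
by rewrite lebesgue_measure_itv/= lte_fin ltr01 sube0 gt_eqF// lte_fin ltr01.
Qed.

Lemma Rint_Beta a b (r q : R) : -1 < a -> -1 < b -> r < q ->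
  L1 mu (fun v => ppow a (v - r) * ppow b (q - v)) /\
  \int[mu]_v (ppow a (v - r) * ppow b (q - v)) = (q - r) `^ (a + b + 1) * Bet a b.
Proof.
move=> a1 b1 rq; have c0 : 0 < q - r by rewrite subr_gt0.
set c := q - r in c0 *.
pose B v := ppow a v * ppow b (1 - v).
have E v : ppow a (v - r) * ppow b (q - v) = (c `^ (a + b)) * B (c^-1 * (v + - r)).
  have e1 : ppow a (v - r) = c `^ a * ppow a (c^-1 * (v + - r)).
    by rewrite -ppowM// mulrA mulfV ?gt_eqF// mul1r.
  have e2 : ppow b (q - v) = c `^ b * ppow b (1 - c^-1 * (v + - r)).
    rewrite -ppowM//; congr ppow; rewrite mulrBr mulrA mulfV ?gt_eqF// /c.
    by ring.
  by rewrite e1 e2 (powR_add _ _ c0) /B; ring.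
have ci : 0 < c^-1 by rewrite invr_gt0.
have LB : L1 mu B by exact: L1_Beta.
have L2 := L1_shift (- r) (L1_scale ci LB).
split; first by apply: eq_L1 (L1Z (c `^ (a + b)) L2) => v; rewrite E.
under eq_Rintegral do rewrite E.
rewrite (RintZ _ L2) (Rint_shift (- r) (L1_scale ci LB)) (Rint_scale ci LB) invrK.
by rewrite mulrA (powR_add (a + b) 1 c0) powRr1// ltW.
Qed.

End double_integrals.

Lemma om_lt (R : realType) (v m : R) : 0 < m -> (m * (1 - v) < v) = (om m < v).
Proof.
move=> m0; rewrite omE// ltr_pdivrMr ?addr_gt0// mulrBr mulr1 ltrBlDr.
by rewrite mulrDr mulr1 [v * m]mulrC.
Qed.

Lemma ppow_mul0 (R : realType) (e x y : R) : x <= 0 -> ppow e x * y = 0.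
Proof. by move=> x0; rewrite ppow0// mul0r. Qed.

(* Abel inversion: the fractional derivative (the integral in [m]) undoes the
   fractional integral [abel_int], up to a factor. *)
Section inversion.
Context {R : realType}.
Local Notation mu := (@lebesgue_measure R).
Local Notation RR := (measurableTypeR R).
Variables (s : R) (Psi D : R -> R) (M : R).
Hypothesis s01 : 0 < s < 1.
Hypothesis dPsi : forall r : R, is_derive r 1 Psi (D r).
Hypothesis cD : continuous D.
Hypothesis Psi0 : Psi 0 = 0.
Hypothesis DM : forall r, 0 <= r <= 1 -> `|D r| <= M.

Let s0 : 0 < s. Proof. by case/andP: s01. Qed.
Let s1 : s < 1. Proof. by case/andP: s01. Qed.
Let ss1 : -1 < s - 1. Proof. by rewrite ltrBDr addrC subrr. Qed.
Let Ns1 : -1 < - s. Proof. by rewrite ltrN2. Qed.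
Let M0 : 0 <= M.
Proof. by apply: le_trans (normr_ge0 _) (DM (r := 0) _); rewrite lexx ler01. Qed.

Let mD : measurable_fun setT D. Proof. exact: continuous_measurable_fun. Qed.

Let Q w := ppow 0 w * ppow (s - 1) (1 - w).

Let Q_ge0 w : 0 <= Q w. Proof. by rewrite mulr_ge0 ?ppow_ge0. Qed.
Let LQ : L1 mu Q. Proof. by apply: L1_Beta. Qed.

Let Q_out w : ~~ (0 < w < 1) -> Q w = 0.
Proof.
rewrite negb_and -!leNgt /Q => /orP[w0|w1]; first by rewrite ppow0// mul0r.
by rewrite [X in _ * X]ppow0 ?mulr0// subr_le0.
Qed.

Definition abel_int (v : R) : R :=
  \int[mu]_w (ppow (-1) w * ppow (s - 1) (1 - w) * Psi (v * w)).

(** The formal derivative of [abel_int]: the factor w from the chain rule cancels w^(-1). *)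
Let A v := \int[mu]_w (Q w * D (v * w)).

Let QD v w : 0 <= v <= 1 -> `|Q w * D (v * w)| <= M * Q w.
Proof.
move=> /andP[v0 v1]; have [/andP[w0 w1]|/Q_out ->] := boolP (0 < w < 1); last first.
  by rewrite mul0r mulr0 normr0.
rewrite normrM (ger0_norm (Q_ge0 w)) mulrC ler_wpM2r// DM// mulr_ge0//= ?(ltW w0)//.
by rewrite mulr_ile1// ltW.
Qed.

Let mQ : measurable_fun setT Q. Proof. exact: (L1_measurable LQ). Qed.

Let mQD v : measurable_fun setT (fun w => Q w * D (v * w)).
Proof.
by apply: measurable_funM => //; apply: (measurableT_comp mD); exact: measurable_funM.
Qed.

Let mQD2 : measurable_fun setT (fun z : RR * RR => Q z.2 * D (z.1 * z.2)).
Proof.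
apply: measurable_funM; first by apply: (measurableT_comp mQ); exact: measurable_snd.
by apply: (measurableT_comp mD); apply: measurable_funM; [exact: measurable_fst|exact: measurable_snd].
Qed.

Let mA : measurable_fun setT A.
Proof. exact: (@measurable_Rint1 _ _ RR RR R mu (fun v w => Q w * D (v * w)) mQD2). Qed.

Let A_bound v : 0 <= v <= 1 -> `|A v| <= M * \int[mu]_w Q w.
Proof.
move=> v01; rewrite -RintZ//; apply: (@Rint_norm_le _ _ _ mu _ (fun w => M * Q w)).
- exact: mQD.
- exact: L1Z.
- by move=> w; exact: QD.
Qed.

(** Instead of differentiating under the integral, A is integrated over [p, q]: Fubini, then the
    fundamental theorem of calculus in v for each fixed w. *)
Let stepA (p q : R) : 0 <= p -> p <= q -> q <= 1 ->
  L1 mu (fun w => ppow (-1) w * ppow (s - 1) (1 - w) * (Psi (q * w) - Psi (p * w))) /\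
  \int[mu]_w (ppow (-1) w * ppow (s - 1) (1 - w) * (Psi (q * w) - Psi (p * w))) =
  \int[mu]_v (if p <= v <= q then A v else 0).
Proof.
move=> p0 pq q1.
pose I (v : R) : R := if p <= v <= q then 1 else 0.
pose F w v := I v * (Q w * D (v * w)).
have mI : measurable_fun setT I.
  by apply: measurable_fun_ifT => //; apply: measurable_and; exact: measurable_fun_ler.
have LI : L1 mu I.
  exact: L1_itv.
have I01 v : 0 <= I v by rewrite /I; case: ifP.
have Fb w v : `|F w v| <= (M * Q w) * I v.
  rewrite /F /I; case: ifPn => [/andP[pv vq]|_]; last by rewrite mul0r normr0 mulr0.
  by rewrite mul1r mulr1 QD// (le_trans p0 pv) (le_trans vq).
have mF : measurable_fun setT (fun z : RR * RR => F z.1 z.2).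
  apply: measurable_funM; first by apply: (measurableT_comp mI); exact: measurable_snd.
  apply: measurable_funM; first by apply: (measurableT_comp mQ); exact: measurable_fst.
  by apply: (measurableT_comp mD); apply: measurable_funM; [exact: measurable_snd|exact: measurable_fst].
have F1 w : L1 mu (F w).
  apply: (@L1_le _ _ _ mu _ (fun v => (M * Q w) * I v)) => //; last exact: L1Z.
  apply: measurable_funM => //; apply: measurable_funM => //.
  by apply: (measurableT_comp mD); exact: measurable_funM.
have F2 v : L1 mu (F^~ v).
  apply: (@L1_le _ _ _ mu _ (fun w => (M * I v) * Q w)); last exact: L1Z.
    by apply: measurable_funM; [exact: measurable_cst|exact: mQD].
  by move=> w; rewrite (le_trans (Fb w v))// mulrAC.
have FG w : \int[mu]_v `|F w v| <= (M * \int[mu]_v I v) * Q w.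
  rewrite mulrAC -RintZ//; apply: Rint_le; [exact: L1_norm|exact: L1Z|].
  by move=> v; exact: Fb.
have [L _ E] := Rint_swap mF F1 FG (L1Z (M * \int[mu]_v I v) LQ) F2.
have inner w : \int[mu]_v F w v =
    ppow (-1) w * ppow (s - 1) (1 - w) * (Psi (q * w) - Psi (p * w)).
  have [w0|w0] := leP w 0.
    rewrite [ppow (-1) _]ppow0// !mul0r.
    rewrite (_ : F w = cst 0) ?Rintegral_cst ?mul0r//.
    by apply/funext => v; rewrite /F /Q ppow0// !mul0r mulr0.
  have dF (v : R) : p <= v <= q -> is_derive v 1 (fun v : R => Psi (v * w)) (w * D (v * w)).
    move=> _; have h1 : is_derive v 1 (fun v => v * w) w.
      have h := is_deriveM (is_derive_id v 1) (is_derive_cst w v 1).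
      apply: is_derive_eq h _.
      by rewrite scaler0 add0r /GRing.scale /= mulr1.
    have := @is_derive1_comp R Psi (fun v : R => v * w) v _ _ (dPsi (v * w)) h1.
    by rewrite mulrC.
  have cF (v : R) : p <= v <= q -> {for v, continuous (fun v : R => w * D (v * w))}.
    move=> _; apply: cvgM; first exact: cvg_cst.
    apply: (@continuous_cvg _ _ _ _ _ (fun v => v * w) D); first exact: cD.
    by apply: cvgM; [exact: cvg_id|exact: cvg_cst].
  have [LL II] := Rint_FTC pq dF cF.
  rewrite -II -RintZ//; apply: eq_Rint => v; rewrite /F /I.
  case: ifPn => _; last by rewrite mul0r mulr0.
  rewrite mul1r /Q [ppow 0 w]ppowE// powRr0 mul1r [ppow (-1) w]ppowE// powR_inv1 ?(ltW w0)//.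
  by rewrite mulrACA mulVf ?gt_eqF// mul1r.
split; first by apply: eq_L1 L => w; rewrite inner.
under eq_Rintegral do rewrite -inner.
rewrite E; apply: eq_Rint => v; rewrite /F /I; case: ifPn => vpq.
  by under eq_Rintegral do rewrite mul1r.
under eq_Rintegral do rewrite mul0r.
by rewrite Rintegral_cst// mul0r.
Qed.

Let L1_abel v : 0 <= v <= 1 ->
  L1 mu (fun w => ppow (-1) w * ppow (s - 1) (1 - w) * Psi (v * w)).
Proof.
move=> /andP[v0 v1]; have [+ _] := stepA (lexx 0) v0 v1.
by apply: eq_L1 => w; rewrite mul0r Psi0 subr0.
Qed.

Let abelB (p : R) : 0 <= p <= 1 ->
  abel_int 1 - abel_int p = \int[mu]_v (if p < v < 1 then A v else 0).
Proof.
move=> /andP[p0 p1]; have [_ E] := stepA p0 p1 (lexx 1).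
have h1 : ((0 : R) <= (1 : R)) && ((1 : R) <= (1 : R)) by rewrite ler01 /=.
rewrite /abel_int -RintB; [|exact: (L1_abel h1)|by apply: L1_abel; rewrite p0 p1].
transitivity (\int[mu]_w (ppow (-1) w * ppow (s - 1) (1 - w) * (Psi (1 * w) - Psi (p * w)))).
  by apply: eq_Rint => w; rewrite mulrBr.
rewrite E; apply: (eq_Rint_ae2 (a := p) (b := 1)).
- by apply: measurable_fun_ifT => //; apply: measurable_and; exact: measurable_fun_ler.
- by apply: measurable_fun_ifT => //; apply: measurable_and; exact: measurable_fun_ltr.
- by move=> v vp v1; rewrite (lt_neqAle p) (lt_neqAle v) eq_sym vp v1.
Qed.

(** The Riemann-Liouville integral of D of order s, without the factor 1/Gamma(s). The substitution
    r = v w relates it to A. *)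
Let J v := \int[mu]_r (ppow 0 r * ppow (s - 1) (v - r) * D r).

Let J_out v : v <= 0 -> J v = 0.
Proof.
move=> v0; rewrite /J (_ : (fun r => _) = cst 0) ?Rintegral_cst ?mul0r//.
apply/funext => r /=; have [r0|r0] := leP r 0; first by rewrite ppow0// !mul0r.
by rewrite [X in _ * X * _]ppow0 ?mulr0 ?mul0r// subr_le0 (le_trans v0)// ltW.
Qed.

Let JD v r : v <= 1 ->
  `|ppow 0 r * ppow (s - 1) (v - r) * D r| <= M * (ppow 0 r * ppow (s - 1) (v - r)).
Proof.
move=> v1; have [r0|r0] := leP r 0; first by rewrite ppow0// !mul0r mulr0 normr0.
have [vr|rv] := leP v r.
  by rewrite [X in _ * X * _]ppow0 ?subr_le0// [X in _ * (_ * X)]ppow0 ?subr_le0// !(mulr0,mul0r) normr0.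
rewrite normrM ger0_norm ?mulr_ge0 ?ppow_ge0// mulrC ler_wpM2r ?mulr_ge0 ?ppow_ge0//.
by rewrite DM// (ltW r0) (ltW (lt_le_trans rv v1)).
Qed.

Let LJ0 v : 0 < v -> L1 mu (fun r => ppow 0 r * ppow (s - 1) (v - r)) /\
  \int[mu]_r (ppow 0 r * ppow (s - 1) (v - r)) = v `^ s * Bet 0 (s - 1).
Proof.
move=> v0; have [] := @Rint_Beta R 0 (s - 1) 0 v (ltrN10 R) ss1 v0.
rewrite add0r subrK subr0 => L E.
by split; [apply: eq_L1 L => r; rewrite subr0|rewrite -E; apply: eq_Rint => r; rewrite subr0].
Qed.

Let mJ v : measurable_fun setT (fun r => ppow 0 r * ppow (s - 1) (v - r) * D r).
Proof.
apply: measurable_funM => //; apply: measurable_funM; first exact: measurable_ppow.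
by apply: (measurableT_comp (measurable_ppow _)); exact: measurable_funB.
Qed.

Let LJ v : v <= 1 -> L1 mu (fun r => ppow 0 r * ppow (s - 1) (v - r) * D r).
Proof.
move=> v1; have [v0|v0] := leP v 0.
  apply: eq_L1 (L10 mu) => r; have [r0|r0] := leP r 0; first by rewrite ppow0// !mul0r.
  by rewrite [X in _ * X * _]ppow0 ?mulr0 ?mul0r// subr_le0 (le_trans v0)// ltW.
apply: (@L1_le _ _ _ mu _ (fun r => M * (ppow 0 r * ppow (s - 1) (v - r)))).
- exact: mJ.
- by move=> r; exact: JD.
- by apply: L1Z; have [] := LJ0 v0.
Qed.

Let AJ v : 0 < v <= 1 -> A v = v `^ (- s) * J v.
Proof.
move=> /andP[v0 v1]; have vi : 0 < v^-1 by rewrite invr_gt0.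
have := Rint_scale v0 (LJ v1); rewrite -/(J v).
have -> : (fun t => ppow 0 (v * t) * ppow (s - 1) (v - v * t) * D (v * t)) =
    (fun t => v `^ (s - 1) * (Q t * D (v * t))).
  apply/funext => t; rewrite ppowM// powRr0 mul1r -{1}[v]mulr1 -mulrBr ppowM//.
  by rewrite /Q; ring.
rewrite RintZ; last first.
  apply: (@L1_le _ _ _ mu _ (fun w => M * Q w)).
  - exact: mQD.
  - by move=> w; apply: QD; rewrite (ltW v0).
  - exact: L1Z.
rewrite -/(A v) => E; have p0 : 0 < v `^ (s - 1) by rewrite powR_gt0.
apply: (mulfI (lt0r_neq0 p0)); rewrite E mulrA; congr (_ * _).
rewrite -powR_add// -[LHS]powR_inv1 ?(ltW v0)//; congr (_ `^ _); ring.
Qed.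

Let z1 v y : 1 <= v -> ppow (- s) (1 - v) * y = 0.
Proof. by move=> v1; apply: ppow_mul0; rewrite subr_le0. Qed.

Let G v r := ppow (- s) (1 - v) * (ppow 0 r * ppow (s - 1) (v - r) * D r).

Let G0 v r : ~~ (0 < r < v) || (1 <= v) -> G v r = 0.
Proof.
rewrite negb_and -!leNgt => /orP[/orP[r0|vr]|v1]; last exact: z1.
  by rewrite /G (ppow_mul0 _ _ r0) mul0r mulr0.
by rewrite /G -mulrA (ppow_mul0 (s - 1)) ?subr_le0// !mulr0.
Qed.

Let mG : measurable_fun setT (fun z : RR * RR => G z.1 z.2).
Proof.
apply: measurable_funM.
  apply: (measurableT_comp (measurable_ppow _)).
  by apply: measurable_funB => //; exact: measurable_fst.
apply: measurable_funM; last by apply: (measurableT_comp mD); exact: measurable_snd.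
apply: measurable_funM.
  by apply: (measurableT_comp (measurable_ppow _)); exact: measurable_snd.
apply: (measurableT_comp (measurable_ppow _)).
by apply: measurable_funB; [exact: measurable_fst|exact: measurable_snd].
Qed.

Let Gv v : 1 <= v -> G v = cst 0.
Proof. by move=> v1; apply/funext => r /=; rewrite (G0 (v := v) (r := r))// v1 orbT. Qed.

Let Rint_cst0 : \int[mu]_t (cst 0 t : R) = 0.
Proof. by rewrite Rintegral_cst// mul0r. Qed.

Let G1 v : L1 mu (G v).
Proof.
have [v1|v1] := leP 1 v; last by apply: L1Z; exact: LJ (ltW v1).
by rewrite (Gv v1); exact: L10.
Qed.

Let B00 : 0 < Bet 0 (s - 1).
Proof. by apply: Bet_gt0 => //; exact: ltrN10. Qed.

Let GG v : \int[mu]_r `|G v r| <= (M * Bet 0 (s - 1)) * (ppow s v * ppow (- s) (1 - v)).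
Proof.
have rhs0 : 0 <= (M * Bet 0 (s - 1)) * (ppow s v * ppow (- s) (1 - v)).
  by apply: mulr_ge0; apply: mulr_ge0; rewrite ?ppow_ge0// ltW.
have triv : (forall r, G v r = 0) ->
    \int[mu]_r `|G v r| <= (M * Bet 0 (s - 1)) * (ppow s v * ppow (- s) (1 - v)).
  move=> G00; rewrite (_ : (fun r => _) = cst 0) ?Rint_cst0//.
  by apply/funext => r; rewrite G00 normr0.
have [v1|v1] := leP 1 v.
  by apply: triv => r; apply: G0; rewrite v1 orbT.
have [v0|v0] := leP v 0.
  apply: triv => r; apply: G0; rewrite negb_and -!leNgt.
  have [r0|r0] := leP r 0; first by [].
  by rewrite (le_trans v0 (ltW r0)).
have [L I] := LJ0 v0.
have -> : (M * Bet 0 (s - 1)) * (ppow s v * ppow (- s) (1 - v)) =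
    \int[mu]_r ((ppow (- s) (1 - v) * M) * (ppow 0 r * ppow (s - 1) (v - r))).
  rewrite (RintZ _ L) I (ppowE s v0).
  by move: (ppow _ _) (v `^ s) (Bet _ _) => x y z; ring.
apply: Rint_le; [exact: L1_norm (G1 v)|exact: L1Z|] => r.
rewrite /G normrM (ger0_norm (ppow_ge0 _ _)) -[leRHS]mulrA; apply: ler_wpM2l; first exact: ppow_ge0.
exact: JD (ltW v1).
Qed.

Let E2 r : 0 < r -> G^~ r = fun v => D r * (ppow (s - 1) (v - r) * ppow (- s) (1 - v)).
Proof.
move=> r0; apply/funext => v; rewrite /G (ppowE 0 r0) powRr0.
by move: (ppow _ _) (ppow _ _) (D r) => x y z; ring.
Qed.

Let E0 r : ~~ (0 < r < 1) -> G^~ r = cst 0.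
Proof.
move=> r01; apply/funext => v; apply: G0; move: r01.
rewrite !negb_and -!leNgt => /orP[->//|r1].
by have [//|v1] := leP 1 v; [rewrite orbT|rewrite (le_trans (ltW v1) r1) orbT].
Qed.

Let G2 r : L1 mu (G^~ r).
Proof.
have [/andP[r0 r1]|/E0 ->] := boolP (0 < r < 1); last exact: L10.
by rewrite E2//; apply: L1Z; have [] := Rint_Beta ss1 Ns1 r1.
Qed.

Let LBs : L1 mu (fun v => ppow s v * ppow (- s) (1 - v)).
Proof. by apply: L1_Beta => //; rewrite (lt_trans _ s0)// ltrN10. Qed.

(** Abel's cancellation: over r < v < 1, (v - r)^(s-1) (1 - v)^(-s) integrates to a Beta constant
    independent of r, because the total power of 1 - r is 0. Then D integrates to Psi 1. *)
Let stepC : L1 mu (fun v => ppow (- s) (1 - v) * J v) /\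
  \int[mu]_v (ppow (- s) (1 - v) * J v) = Bet (s - 1) (- s) * Psi 1.
Proof.
have [L _ EG] := Rint_swap mG G1 GG (L1Z _ LBs) G2.
have EJ v : ppow (- s) (1 - v) * J v = \int[mu]_r G v r.
  have [v1|v1] := leP 1 v; first by rewrite (Gv v1) z1// Rint_cst0.
  by rewrite -(RintZ _ (LJ (ltW v1))).
split; first by apply: eq_L1 L => v; rewrite EJ.
under eq_Rintegral do rewrite EJ.
rewrite EG.
have d (v : R) : 0 <= v <= 1 -> is_derive v 1 Psi (D v) by [].
have c (v : R) : 0 <= v <= 1 -> {for v, continuous D} by move=> _; exact: cD.
have [LD ID] := Rint_FTC ler01 d c.
rewrite Psi0 subr0 in ID; rewrite -ID -(RintZ _ LD).
apply: (eq_Rint_ae2 (a := 0) (b := 1)).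
- apply: (@measurable_Rint1 _ _ RR RR R mu (fun r v => G v r)).
  apply: (@measurableT_comp _ _ _ _ _ _ (fun z : RR * RR => G z.1 z.2) _ (fun z : RR * RR => (z.2, z.1)) mG).
  exact: measurable_swap.
- by apply: measurable_funM => //; exact: (L1_measurable LD).
move=> r r0 r1; have [r01|nr01] := boolP (0 < r < 1); last first.
  rewrite E0// Rint_cst0.
  by rewrite !le_eqVlt (negbTE r1) eq_sym (negbTE r0) /= (negbTE nr01) mulr0.
case/andP: r01 => rp rl; rewrite (ltW rp) (ltW rl) /=.
have [L3 I3] := Rint_Beta ss1 Ns1 rl.
rewrite (E2 rp) (RintZ _ L3) I3 (_ : s - 1 + - s + 1 = 0); last by ring.
by rewrite powRr0 mul1r mulrC.
Qed.

(** Write the difference as the integral of A over (w, 1) and exchange. For fixed v the variable m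
    runs up to v/(1 - v), so m^(s-1) integrates to v^s (1 - v)^(-s) / s; v^s cancels the v^(-s) in
    [AJ] and [stepC] concludes. *)
Lemma abel_inversion :
  \int[mu]_m (ppow (s - 1) m * (abel_int 1 - abel_int (om m))) =
  s^-1 * Bet (s - 1) (- s) * Psi 1.
Proof.
pose X v := if 0 < v < 1 then A v else 0.
(* The condition is [om m < v] cleared of its denominator ([om_lt]). *)
pose F v m := X v * (if m * (1 - v) < v then ppow (s - 1) m else 0).
pose CA := M * \int[mu]_w Q w.
have CA0 : 0 <= CA by rewrite mulr_ge0// Rint_ge0.
have mX : measurable_fun setT X.
  by apply: measurable_fun_ifT => //; apply: measurable_and; exact: measurable_fun_ltr.
have XA v : `|X v| <= CA.
  rewrite /X; case: ifPn => [/andP[v0 v1]|_]; last by rewrite normr0.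
  by apply: A_bound; rewrite !ltW.
have near v : 0 < v < 1 ->
    L1 mu (fun m => if m * (1 - v) < v then ppow (s - 1) m else 0) /\
    \int[mu]_m (if m * (1 - v) < v then ppow (s - 1) m else 0) =
      s^-1 * (ppow s v * ppow (- s) (1 - v)).
  move=> /andP[v0 v1]; have v10 : 0 < 1 - v by rewrite subr_gt0.
  have b0 : 0 < v / (1 - v) by rewrite divr_gt0.
  have [L I] := Rint_ppow_near0 ss1 b0.
  have E : (fun m => if m * (1 - v) < v then ppow (s - 1) m else 0) =
     (fun t => if t < v / (1 - v) then ppow (s - 1) t else 0).
    by apply/funext => m; rewrite ltr_pdivlMr.
  rewrite E; split=> //; rewrite I subrK mulrC; congr (_ * _).
  rewrite !ppowE// powRM ?invr_ge0 ?(ltW v0) ?(ltW v10)//.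
  by rewrite -[(1 - v)^-1]powR_inv1 ?(ltW v10)// -powRrM mulN1r.
have mF : measurable_fun setT (fun z : RR * RR => F z.1 z.2).
  apply: measurable_funM; first by apply: (measurableT_comp mX); exact: measurable_fst.
  apply: measurable_fun_ifT => //.
    apply: measurable_fun_ltr; last exact: measurable_fst.
    apply: measurable_funM; first exact: measurable_snd.
    by apply: measurable_funB => //; exact: measurable_fst.
  by apply: (measurableT_comp (measurable_ppow _)); exact: measurable_snd.
have X0 v : ~~ (0 < v < 1) -> X v = 0 by rewrite /X => /negbTE ->.
have F1 v : L1 mu (F v).
  have [v01|/X0 v0] := boolP (0 < v < 1); first by apply: L1Z; have [] := near v v01.
  by apply: eq_L1 (L10 mu) => m; rewrite /F v0 mul0r.
have innerF v : \int[mu]_m F v m = s^-1 * (ppow (- s) (1 - v) * J v).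
  have [v01|v0] := boolP (0 < v < 1).
    have [L I] := near v v01; rewrite RintZ// I /X v01.
    case/andP: v01 => v0 v1; rewrite AJ ?v0 ?(ltW v1)// ppowE// powRN.
    move: (ppow _ _) (J v) => a b; field.
    by rewrite !gt_eqF ?powR_gt0.
  rewrite /F X0// (_ : (fun m => _) = cst 0) ?Rintegral_cst ?mul0r//; last first.
    by apply/funext => m; rewrite mul0r.
  move: v0; rewrite negb_and -!leNgt => /orP[v0|v1].
    by rewrite J_out// !mulr0.
  by rewrite ppow0 ?subr_le0// mul0r mulr0.
have FG v : \int[mu]_m `|F v m| <= (CA * s^-1) * (ppow s v * ppow (- s) (1 - v)).
  have [v01|/X0 v0] := boolP (0 < v < 1); last first.
    rewrite (_ : (fun m => _) = cst 0) ?Rintegral_cst ?mul0r//; last first.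
      by apply/funext => m; rewrite /F v0 mul0r normr0.
    by apply: mulr_ge0; [apply: divr_ge0 => //; exact: ltW|rewrite mulr_ge0 ?ppow_ge0].
  have [L I] := near v v01; rewrite -mulrA -I -RintZ//.
  apply: Rint_le; [exact: L1_norm|exact: L1Z|] => m.
  rewrite /F normrM [X in _ * X]ger0_norm; last by case: ifP => // _; exact: ppow_ge0.
  by rewrite ler_wpM2r//; case: ifP => // _; exact: ppow_ge0.
have LB : L1 mu (fun v => ppow s v * ppow (- s) (1 - v)).
  by apply: L1_Beta => //; rewrite (lt_trans _ s0)// ltrN10.
have F2 m : L1 mu (F^~ m).
  apply: (@L1_le _ _ _ mu _ (fun v => (CA * ppow (s - 1) m) * (if 0 <= v <= 1 then 1 else 0))).
  - apply: measurable_funM => //; apply: measurable_fun_ifT => //.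
    apply: measurable_fun_ltr => //; apply: measurable_funM => //.
    exact: measurable_funB.
  - move=> v; rewrite /F; have [v01|/X0 v0] := boolP (0 < v < 1); last first.
      rewrite v0 mul0r normr0 mulr_ge0//; last by case: ifP.
      by rewrite mulr_ge0// ppow_ge0.
    case/andP: v01 => v0 v1; rewrite (ltW v0) (ltW v1) mulr1 normrM.
    apply: ler_pM => //; rewrite ger0_norm; first by case: ifP => // _; exact: ppow_ge0.
    by case: ifP => // _; exact: ppow_ge0.
  - apply: L1Z.
    exact: L1_itv.
have [_ _ EF] := Rint_swap mF F1 FG (L1Z _ LB) F2.
transitivity (\int[mu]_m \int[mu]_v F v m).
  apply: eq_Rint => m; have [m0|m0] := leP m 0.
    have Fm : F^~ m = cst 0.
      by apply/funext => v; rewrite /F (ppow0 (s - 1) m0) if_same mulr0.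
    rewrite (ppow0 (s - 1) m0) mul0r Fm Rintegral_cst; last exact: measurableT.
    by rewrite mul0r.
  have /andP[p0 p1] := om01 m0.
  have p01 : 0 <= om m <= 1 by rewrite (ltW p0) (ltW p1).
  have LX : L1 mu (fun v => if om m < v < 1 then A v else 0).
    exact: (L1_itv_bounded (ltW p0) mA A_bound).
  rewrite (abelB p01) -(RintZ _ LX); apply: eq_Rint => v; rewrite /F /X.
  have [v1|v1] := ltP v 1; last by rewrite !andbF mul0r mulr0.
  rewrite !andbT.
  rewrite (om_lt v m0).
  have [ov|ov] := ltP (om m) v; last by rewrite (mulr0 (ppow _ _)) (mulr0 (if _ then _ else _)).
  by rewrite (lt_trans p0 ov) mulrC.
rewrite -EF.
under eq_Rintegral do rewrite innerF.
have [L I] := stepC; rewrite (RintZ _ L) I mulrA.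
by [].
Qed.

End inversion.

(** * Smooth functions *)

Section derivatives.
Context {R : realType}.
Implicit Types (f g : R -> R) (x a b p q : R).

Lemma is_derive_lin p q f g x a b : is_derive x 1 f a -> is_derive x 1 g b ->
  is_derive x 1 (fun t => p * f t + q * g t) (p * a + q * b).
Proof.
by move=> df dg; exact: (is_deriveD (is_deriveZ p df) (is_deriveZ q dg)).
Qed.

Lemma is_derive_prod f g x a b : is_derive x 1 f a -> is_derive x 1 g b ->
  is_derive x 1 (fun t => f t * g t) (a * g x + f x * b).
Proof.
move=> df dg; apply: is_derive_eq (is_deriveM df dg) _.
by rewrite /GRing.scale /= addrC mulrC.
Qed.

Lemma is_derive_comp1 f g x a b : is_derive (g x) 1 f a -> is_derive x 1 g b ->
  is_derive x 1 (fun t => f (g t)) (a * b).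
Proof. exact: is_derive1_comp. Qed.

Lemma is_derive_affine p q x : is_derive x 1 (fun t => p * t + q) p.
Proof.
have d := is_derive_lin p q (is_derive_id x 1) (is_derive_cst (1 : R) x 1).
by apply: is_derive_eq (_ : is_derive x 1 _ (p * 1 + q * 0)) _;
  [move: d; under eq_fun do rewrite mulr1|rewrite mulr1 mulr0 addr0].
Qed.

Lemma is_derive_inv f x a : f x != 0 -> is_derive x 1 f a ->
  is_derive x 1 (fun t => (f t)^-1) (- a * ((f x)^-1 * (f x)^-1)).
Proof.
move=> fx0 df; apply: is_derive_eq (is_deriveV fx0 df) _.
by rewrite /GRing.scale /= -exprVn expr2; ring.
Qed.

Lemma is_derive_continuous f x a : is_derive x 1 f a -> {for x, continuous f}.
Proof.
by move=> [df _]; apply: differentiable_continuous; apply/derivable1_diffP.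
Qed.

Lemma is_derive_derive1 f x a : is_derive x 1 f a -> (derive1 f) x = a.
Proof. by move=> df; rewrite derive1E derive_val. Qed.

Lemma derivable_derive1 f x : derivable f x 1 -> is_derive x 1 f ((derive1 f) x).
Proof. by move=> df; rewrite derive1E; exact: derivableP. Qed.

Lemma is_derive_flat f x (C : R) : f x = 0 -> (forall t, `|f t| <= C * (t - x) ^+ 2) ->
  is_derive x 1 f 0.
Proof.
move=> fx0 fC.
have H : (fun h : R => h^-1 *: ((f \o shift x) (h *: (1 : R)) - f x)) @ 0^' --> (0 : R).
  apply/cvgr0Pnorm_le => e e0; near=> h.
  have h0 : h != 0 by near: h; exact: nbhs_dnbhs_neq.
  rewrite fx0 subr0 /= /GRing.scale /= mulr1 normrM normfV.
  have hn : 0 < `|h| by rewrite normr_gt0.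
  rewrite mulrC ler_pdivrMr//; apply: (le_trans (fC _)).
  rewrite addrK -[h ^+ 2](real_normK (num_real _)) expr2 mulrA.
  rewrite ler_wpM2r ?normr_ge0//.
  apply: (@le_trans _ _ ((`|C| + 1) * `|h|)).
    by rewrite ler_wpM2r ?normr_ge0// (le_trans (ler_norm _))// lerDl.
  rewrite mulrC -ler_pdivlMr ?ltr_wpDl//; near: h.
  apply: dnbhs0_le; exact: divr_gt0.
by apply: DeriveDef; [apply/cvg_ex; exists 0|exact: cvg_lim H].
Unshelve. all: by end_near. Qed.

End derivatives.

(** * Functions with bounded derivatives, averages and bumps *)

Section bounded_smooth.
Context {R : realType}.
Local Notation mu := (@lebesgue_measure R).
Implicit Types (f g : R -> R) (p q : R) (k : nat).

(** The derivatives up to order k are bounded, which gives domination under integrals; the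
    derivative of order k + 1 exists, which gives continuity of the one before. *)
Fixpoint Bk k f : Prop := (exists M, forall x, `|f x| <= M) /\
  exists2 f', forall x : R, is_derive x 1 f (f' x) & if k is k'.+1 then Bk k' f' else True.

Lemma BkS k f : Bk k.+1 f -> Bk k f.
Proof.
elim: k f => [|k IH] f [bf [f' df Bf]]; split=> //; exists f' => //.
exact: IH.
Qed.

Lemma Bk0 k f : Bk k f -> Bk 0 f.
Proof. by elim: k f => // k IH f /BkS /IH. Qed.

Lemma Bk_bound k f : Bk k f -> exists2 M, 0 <= M & forall x, `|f x| <= M.
Proof.
move=> /Bk0 [[M fM] _]; exists M => //.
exact: le_trans (normr_ge0 _) (fM 0).
Qed.

Lemma Bk_continuous k f : Bk k f -> continuous f.
Proof. by move=> /Bk0 [_ [f' df _]] x; exact: is_derive_continuous (df x). Qed.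

Lemma Bk_derive1 k f : Bk k.+1 f ->
  (forall x : R, is_derive x 1 f (derive1 f x)) /\ Bk k (derive1 f).
Proof.
move=> [_ [f' df Bf]]; have <- : f' = derive1 f.
  by apply/funext => x; rewrite (is_derive_derive1 (df x)).
by [].
Qed.

Lemma Bk_lin k p q f g : Bk k f -> Bk k g -> Bk k (fun t => p * f t + q * g t).
Proof.
elim: k f g => [|k IH] f g [[M fM] [f' df Bf]] [[N gN] [g' dg Bg]]; split.
- exists (`|p| * M + `|q| * N) => x.
  by rewrite (le_trans (ler_normD _ _))// !normrM lerD// ler_wpM2l.
- by exists (fun t => p * f' t + q * g' t) => // x; exact: is_derive_lin.
- exists (`|p| * M + `|q| * N) => x.
  by rewrite (le_trans (ler_normD _ _))// !normrM lerD// ler_wpM2l.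
- exists (fun t => p * f' t + q * g' t); last exact: IH.
  by move=> x; exact: is_derive_lin.
Qed.

Lemma Bk_mul k f g : Bk k f -> Bk k g -> Bk k (fun t => f t * g t).
Proof.
elim: k f g => [|k IH] f g Bf Bg; have := Bf; have := Bg;
    move=> [[N gN] [g' dg Bg']] [[M fM] [f' df Bf']]; split.
- by exists (M * N) => x; rewrite normrM ler_pM.
- by exists (fun t => f' t * g t + f t * g' t) => // x; exact: is_derive_prod.
- by exists (M * N) => x; rewrite normrM ler_pM.
- exists (fun t => f' t * g t + f t * g' t); first by move=> x; exact: is_derive_prod.
  have := Bk_lin 1 1 (IH _ _ Bf' (BkS Bg)) (IH _ _ (BkS Bf) Bg').
  by congr Bk; apply/funext => t; rewrite !mul1r.
Qed.

Lemma Bk_affine k p q f : Bk k f -> Bk k (fun t => f (p * t + q)).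
Proof.
elim: k f => [|k IH] f [[M fM] [f' df Bf]]; split; try by exists M.
- exists (fun t => f' (p * t + q) * p) => // x.
  by apply: is_derive_comp1; exact: is_derive_affine.
- exists (fun t => f' (p * t + q) * p).
    by move=> x; apply: is_derive_comp1; exact: is_derive_affine.
  have B := IH _ Bf; have := Bk_lin p 0 B B.
  by congr Bk; apply/funext => t; rewrite mul0r addr0 mulrC.
Qed.

(** The common form of [absum] and [innerprof]. A derivative is again of this form with weight w c,
    still integrable when |c| <= 1. *)
Definition average (w c d : R -> R) f (x : R) : R := \int[mu]_v (w v * f (c v * x + d v)).

Section average.
Variables (c d : R -> R).
Hypotheses (mc : measurable_fun setT c) (md : measurable_fun setT d).
Hypothesis c1 : forall v, `|c v| <= 1.

Lemma measurable_average_int w f x : L1 mu w -> continuous f ->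
  measurable_fun setT (fun v => w v * f (c v * x + d v)).
Proof.
move=> Lw cf; apply: measurable_funM; first exact: (L1_measurable Lw).
apply: (measurableT_comp (continuous_measurable_fun cf)).
by apply: measurable_funD => //; exact: measurable_funM.
Qed.

Lemma average_dom w f M v x : (forall t, `|f t| <= M) ->
  `|w v * f (c v * x + d v)| <= M * `|w v|.
Proof. by move=> fM; rewrite normrM mulrC ler_wpM2r. Qed.

Lemma L1_average w f M x : L1 mu w -> continuous f -> (forall t, `|f t| <= M) ->
  L1 mu (fun v => w v * f (c v * x + d v)).
Proof.
move=> Lw cf fM; apply: (@L1_le _ _ _ mu _ (fun v => M * `|w v|)).
- exact: measurable_average_int.
- by move=> v; exact: average_dom.
- by apply: L1Z; exact: L1_norm.
Qed.

Lemma average_bound w f M x : L1 mu w -> continuous f -> (forall t, `|f t| <= M) ->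
  `|average w c d f x| <= M * \int[mu]_v `|w v|.
Proof.
move=> Lw cf fM; rewrite -(RintZ _ (L1_norm Lw)).
apply: (@Rint_norm_le _ _ _ mu _ (fun v => M * `|w v|)).
- exact: measurable_average_int.
- by apply: L1Z; exact: L1_norm.
- by move=> v; exact: average_dom.
Qed.

Lemma is_derive_average w f f' (x : R) : L1 mu w -> (exists M, forall t, `|f t| <= M) ->
  (exists M, forall t, `|f' t| <= M) -> continuous f' ->
  (forall t : R, is_derive t 1 f (f' t)) ->
  is_derive x 1 (average w c d f) (average (fun v => w v * c v) c d f' x).
Proof.
move=> Lw [M fM] [M' f'M] cf' df.
have cf : continuous f by move=> t; exact: is_derive_continuous (df t).
have M'0 : 0 <= M' by exact: le_trans (normr_ge0 _) (f'M 0).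
pose F (x v : R) := w v * f (c v * x + d v).
have dF (t v : R) : is_derive t 1 (F^~ v) (w v * c v * f' (c v * t + d v)).
  have h := is_derive_comp1 (g := fun t => c v * t + d v) (df (c v * t + d v)) (is_derive_affine (c v) (d v) t).
  apply: is_derive_eq (is_deriveZ (w v) h) _.
  by rewrite /GRing.scale /=; ring.
have d1F (t v : R) : partial1of2 F t v = w v * c v * f' (c v * t + d v).
  by rewrite /partial1of2 (is_derive_derive1 (dF t v)).
have xI : `]x - 1, x + 1[%classic x.
  by rewrite /= in_itv /= ltrBlDr ltrDl ltr01.
have iF (t : R) : `]x - 1, x + 1[%classic t -> mu.-integrable setT (EFin \o F t).
  by move=> _; exact: L1_average Lw cf fM.
have dv (t v : R) : `]x - 1, x + 1[%classic t -> setT v -> derivable (F^~ v) t 1.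
  by move=> _ _; have [] := dF t v.
have G0 v : 0 <= M' * `|w v| by rewrite mulr_ge0.
have LG : mu.-integrable setT (EFin \o (fun v => M' * `|w v|)).
  by apply: L1Z; exact: L1_norm.
have GU (t v : R) : `]x - 1, x + 1[%classic t -> setT v -> `|partial1of2 F t v| <= M' * `|w v|.
  move=> _ _; rewrite d1F !normrM mulrC ler_pM//.
  by rewrite ler_piMr.
have h1 := derivable_under_integral measurableT xI iF dv G0 LG GU.
have h2 := differentiation_under_integral measurableT xI iF dv G0 LG GU.
apply: DeriveDef; first exact: h1.
rewrite -derive1E h2; apply: eq_Rint => v.
by rewrite d1F.
Qed.

Lemma Bk_average k w f : L1 mu w -> Bk k.+1 f -> Bk k (average w c d f).
Proof.
move: w f; have step : forall w f f', L1 mu w -> Bk 0 f -> Bk 0 f' -> (forall t : R, is_derive t 1 f (f' t)) ->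
    (exists M, forall x, `|average w c d f x| <= M) /\
    (forall x : R, is_derive x 1 (average w c d f) (average (fun v => w v * c v) c d f' x)).
  move=> w f f' Lw Bf Bf' df; have [M _ fM] := Bk_bound Bf; have [M' _ f'M] := Bk_bound Bf'.
  have cf := Bk_continuous Bf; have cf' := Bk_continuous Bf'; split.
    by exists (M * \int[mu]_v `|w v|) => x; exact: average_bound.
  by move=> x; apply: is_derive_average => //; [exists M|exists M'].
elim: k => [|k IH] w f Lw Bf.
  have [_ [f' df Bf']] := Bf; have [b d'] := step _ _ _ Lw (Bk0 Bf) Bf' df.
  by split=> //; exists (average (fun v => w v * c v) c d f').
have [_ [f' df Bf']] := Bf; have [b d'] := step _ _ _ Lw (Bk0 Bf) (Bk0 (k := k.+1) Bf') df.
split=> //; exists (average (fun v => w v * c v) c d f') => //.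
apply: IH => //; apply: (@L1_le _ _ _ mu _ (fun v => `|w v|)); last exact: L1_norm.
  by apply: measurable_funM => //; exact: (L1_measurable Lw).
by move=> v; rewrite normrM ler_piMr.
Qed.

End average.

(** The powers t^(-m) are included to make the family stable under differentiation, up to linear
    combinations; m = 0 is the usual cutoff e^(-1/t). *)
Definition flat (m : nat) (t : R) : R := if 0 < t then t^-1 ^+ m * expR (- t^-1) else 0.

Lemma flat_ge0 m t : 0 <= flat m t.
Proof.
rewrite /flat; case: ifPn => // t0.
by rewrite mulr_ge0 ?expR_ge0// exprn_ge0// invr_ge0 ltW.
Qed.

(** With y = 1/t >= 1, y^m <= y^(m+1) <= (m+1)! e^y by the exponential series; for y <= 1 already
    y^m <= 1. *)
Lemma flat_bound m t : `|flat m t| <= m.+1`!%:R.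
Proof.
rewrite ger0_norm ?flat_ge0// /flat; case: ifPn => // t0.
have ti0 : 0 <= t^-1 by rewrite invr_ge0 ltW.
rewrite expRN ler_pdivrMr ?expR_gt0//.
have [ti1|ti1] := leP t^-1 1.
  apply: (@le_trans _ _ 1); first exact: exprn_ile1.
  rewrite -[leLHS]mul1r ler_pM//; first by rewrite ler1n fact_gt0.
  by rewrite -expR0 ler_expR.
rewrite mulrC -ler_pdivrMr ?ltr0n ?fact_gt0//.
apply: le_trans (expR_ge1Dxn m ti0).
rewrite -[leLHS]add0r lerD// ler_pM2r ?invr_gt0 ?ltr0n ?fact_gt0//.
by rewrite exprS ler_peMl ?exprn_ge0// ltW.
Qed.

Lemma flat_pos_derive m (t : R) : 0 < t ->
  is_derive t 1 (fun t => t^-1 ^+ m * expR (- t^-1))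
    (- m%:R * (t^-1 ^+ m.+1 * expR (- t^-1)) + t^-1 ^+ m.+2 * expR (- t^-1)).
Proof.
move=> t0; have tn0 : t != 0 by rewrite gt_eqF.
have di : is_derive t 1 (fun t : R => t^-1) (- (t^-1 * t^-1)).
  by have := is_derive_inv tn0 (is_derive_id t 1); rewrite mulN1r.
elim: m => [|m IH].
  have de := is_derive_comp1 (g := fun t : R => - t^-1) (is_derive_expR (- t^-1)) (is_deriveN di).
  rewrite (_ : (fun t => _) = fun t : R => expR (- t^-1)); last first.
    by apply/funext => u; rewrite expr0 mul1r.
  by apply: is_derive_eq de _; rewrite opprK oppr0 mul0r add0r expr2 mulrC.
rewrite (_ : (fun t => _) = fun t : R => t^-1 * (t^-1 ^+ m * expR (- t^-1))); last first.
  by apply/funext => u; rewrite exprS mulrA.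
apply: is_derive_eq (is_derive_prod di IH) _.
rewrite -(natr1 m) !exprS; move: (expR (- t^-1)) => e.
by move: (t^-1 ^+ m) => v; move: (t^-1) => u; ring.
Qed.

Lemma is_derive_flat_fun m (t : R) :
  is_derive t 1 (flat m) (- m%:R * flat m.+1 t + 1 * flat m.+2 t).
Proof.
have [t0|t0|<-] := ltgtP 0 t.
- rewrite {2 3}/flat t0 mul1r; apply: near_eq_is_derive (flat_pos_derive m t0).
  by near=> u; rewrite /flat ifT//; near: u; exact: lt_nbhsr.
- rewrite /flat [0 < t]ltNge (ltW t0) /= !mulr0 addr0.
  apply: near_eq_is_derive (is_derive_cst (0 : R) t 1).
  by near=> u; rewrite ltNge ltW//; near: u; exact: lt_nbhsl.
(* At the origin the function is u^2 times the bounded member of index m + 2, hence flat to second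
   order. *)
- rewrite {2 3}/flat ltxx !mulr0 addr0.
  apply: (is_derive_flat (C := m.+3`!%:R)); first by rewrite /flat ltxx.
  move=> u; rewrite subr0; have [u0|u0] := leP u 0.
    by rewrite /flat ltNge u0 /= normr0 mulr_ge0// sqr_ge0.
  have -> : flat m u = flat m.+2 u * u ^+ 2.
    by rewrite /flat u0 !exprS; move: (expR _) => e; field; rewrite gt_eqF.
  by rewrite normrM [X in _ * X <= _]ger0_norm ?sqr_ge0// ler_wpM2r ?sqr_ge0// flat_bound.
Unshelve. all: by end_near. Qed.

Lemma Bk_flat k m : Bk k (flat m).
Proof.
elim: k m => [|k IH] m; split; try by exists m.+1`!%:R => x; exact: flat_bound.
- by exists (fun t => - m%:R * flat m.+1 t + 1 * flat m.+2 t) => // x; exact: is_derive_flat_fun.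
- exists (fun t => - m%:R * flat m.+1 t + 1 * flat m.+2 t); last exact: Bk_lin.
  by move=> x; exact: is_derive_flat_fun.
Qed.

Definition bump (p q t : R) : R := flat 0 (t - p) * flat 0 (q - t).

Lemma Bk_bump k p q : Bk k (bump p q).
Proof.
have := Bk_mul (Bk_affine 1 (- p) (Bk_flat k 0)) (Bk_affine (-1) q (Bk_flat k 0)).
by congr Bk; apply/funext => t; rewrite /bump mul1r mulN1r [_ + q]addrC.
Qed.

Lemma bump_ge0 p q t : 0 <= bump p q t.
Proof. by rewrite mulr_ge0// flat_ge0. Qed.

Lemma bump_gt0 p q t : p < t -> t < q -> 0 < bump p q t.
Proof.
move=> pt tq; rewrite /bump /flat !subr_gt0 pt tq !expr0 !mul1r.
by rewrite mulr_gt0// expR_gt0.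
Qed.

Lemma bump_out p q t : ~~ (p < t < q) -> bump p q t = 0.
Proof.
rewrite negb_and -!leNgt /bump /flat !subr_gt0 => /orP[tp|qt].
  by rewrite ltNge tp mul0r.
by rewrite [t < q]ltNge qt mulr0.
Qed.

End bounded_smooth.

(** * Differentiability of finite order on open sets *)

Section local_smooth.
Context {R : realType}.
Implicit Types (f g : R -> R) (U : set R) (k : nat).

(** A local notion without bounds, stable under inverses of nonvanishing functions, as the quotient
    f / g demands. *)
Fixpoint Ck k U f : Prop := (forall x, U x -> derivable f x 1) /\
  if k is k'.+1 then Ck k' U (derive1 f) else True.

Lemma CkS k U f : Ck k.+1 U f -> Ck k U f.
Proof. by elim: k f => [|k IH] f [df Cf]; split=> //; exact: IH. Qed.

Lemma Ck_eq k U f g : open U -> (forall x, U x -> f x = g x) -> Ck k U f -> Ck k U g.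
Proof.
move=> oU; elim: k f g => [|k IH] f g fg [df Cf].
all: have near_fg x : U x -> \forall y \near x, f y = g y by
  move=> Ux; have : nbhs x U by [exact: open_nbhs_nbhs]; apply: filterS => y /fg.
all: split; first by move=> x Ux; exact: near_eq_derivable (near_fg x Ux) (df x Ux).
- by [].
- apply: IH Cf => x Ux; rewrite !derive1E; exact: near_eq_derive (near_fg x Ux).
Qed.

Lemma Ck_intro k U f f' : open U -> (forall x, U x -> is_derive x 1 f (f' x)) ->
  Ck k U f' -> Ck k.+1 U f.
Proof.
move=> oU df Cf'; split; first by move=> x /df[].
by apply: Ck_eq Cf' => // x Ux; rewrite (is_derive_derive1 (df x Ux)).
Qed.

Lemma Ck_sub k U V f : U `<=` V -> Ck k V f -> Ck k U f.
Proof.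
move=> UV; elim: k f => [|k IH] f [df Cf]; split=> //.
- by move=> x /UV /df.
- by move=> x /UV /df.
- exact: IH.
Qed.

Lemma Ck_setU k U V f : Ck k U f -> Ck k V f -> Ck k (U `|` V) f.
Proof.
elim: k f => [|k IH] f [df Cf] [df' Cf']; split=> //.
- by move=> x [/df|/df'].
- by move=> x [/df|/df'].
- exact: IH.
Qed.

Lemma Ck_Bk k U f : open U -> Bk k f -> Ck k U f.
Proof.
move=> oU; elim: k f => [|k IH] f [_ [f' df Bf]]; first by split=> // x _; have [] := df x.
by apply: (Ck_intro (f' := f')) => //; exact: IH.
Qed.

Lemma Ck_cst k U (p : R) : Ck k U (cst p).
Proof.
elim: k p => [|k IH] p; split=> //; rewrite (_ : derive1 _ = cst 0)//.
by apply/funext => x; rewrite derive1_cst.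
Qed.

Lemma Ck_lin k U (p q : R) f g : open U -> Ck k U f -> Ck k U g ->
  Ck k U (fun t => p * f t + q * g t).
Proof.
move=> oU; elim: k f g => [|k IH] f g [df Cf] [dg Cg].
  split=> // x Ux; have := is_derive_lin p q (derivableP (df x Ux)) (derivableP (dg x Ux)).
  by case.
apply: (Ck_intro (f' := fun t => p * (derive1 f) t + q * (derive1 g) t)) => //; last exact: IH.
by move=> x Ux; apply: is_derive_lin; apply: derivable_derive1; [exact: df|exact: dg].
Qed.

Lemma Ck_mul k U f g : open U -> Ck k U f -> Ck k U g -> Ck k U (fun t => f t * g t).
Proof.
move=> oU; elim: k f g => [|k IH] f g Cf Cg.
  case: Cf => df _; case: Cg => dg _; split=> // x Ux.
  by have [] := is_derive_prod (derivableP (df x Ux)) (derivableP (dg x Ux)).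
have [df Cf'] := Cf; have [dg Cg'] := Cg.
apply: (Ck_intro (f' := fun t => (derive1 f) t * g t + f t * (derive1 g) t)) => //.
  by move=> x Ux; apply: is_derive_prod; apply: derivable_derive1; [exact: df|exact: dg].
have := Ck_lin 1 1 oU (IH _ _ Cf' (CkS Cg)) (IH _ _ (CkS Cf) Cg').
by congr Ck; apply/funext => t; rewrite !mul1r.
Qed.

Lemma Ck_inv k U f : open U -> (forall x, U x -> f x != 0) -> Ck k U f ->
  Ck k U (fun t => (f t)^-1).
Proof.
move=> oU f0; elim: k => [|k IH] Cf.
  case: Cf => df _; split=> // x Ux.
  by have [] := is_derive_inv (f0 x Ux) (derivableP (df x Ux)).
have [df Cf'] := Cf; have Ci := IH (CkS Cf).
apply: (Ck_intro (f' := fun t => - (derive1 f) t * ((f t)^-1 * (f t)^-1))) => //.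
  by move=> x Ux; apply: is_derive_inv; [exact: f0|apply: derivable_derive1; exact: df].
have CN := Ck_lin (-1) 0 oU Cf' Cf'.
have := Ck_mul oU CN (Ck_mul oU Ci Ci).
by congr Ck; apply/funext => t; rewrite mulN1r mul0r addr0.
Qed.

Lemma Ck_powRB k (P r : R) : Ck k [set t : R | t < P] (fun t => (P - t) `^ r).
Proof.
have d r' (t : R) : t < P ->
    is_derive t 1 (fun t => (P - t) `^ r') (- r' * (P - t) `^ (r' - 1)).
  move=> tP; have t0 : 0 < -1 * t + P by rewrite mulN1r addrC subr_gt0.
  have h := is_derive_comp1 (g := fun t => -1 * t + P) (is_derive1_powR r' t0) (is_derive_affine (-1) P t).
  rewrite (_ : (fun t => _) = fun t => (-1 * t + P) `^ r'); last first.
    by apply/funext => u; rewrite mulN1r addrC.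
  by apply: is_derive_eq h _; rewrite !mulN1r [- t + P]addrC; ring.
have oP : open [set t : R | t < P] by exact: open_lt.
elim: k r => [|k IH] r; first by split=> // t tP; have [] := d r t tP.
apply: (Ck_intro (f' := fun t => - r * (P - t) `^ (r - 1)) oP).
have C := IH (r - 1); have := Ck_lin (- r) 0 oP C C.
by congr Ck; apply/funext => t; rewrite mul0r addr0.
Qed.

End local_smooth.

(** * A profile as the Abel integral of its tail *)

Section abel_profile.
Context {R : realType}.
Local Notation mu := (@lebesgue_measure R).
Local Notation RR := (measurableTypeR R).
Variable s : R.
Hypothesis s01 : 0 < s < 1.

Let s0 : 0 < s. Proof. by case/andP: s01. Qed.
Let ss1 : -1 < s - 1. Proof. by rewrite ltrBDr addrC subrr. Qed.

Lemma Rint_abel_kernel (r t : R) :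
  L1 mu (fun u => ppow (s - 1) (u - r) * ppow 0 (t - u)) /\
  \int[mu]_u (ppow (s - 1) (u - r) * ppow 0 (t - u)) = s^-1 * ppow s (t - r).
Proof.
have [tr|rt] := leP t r.
  have E : (fun u => ppow (s - 1) (u - r) * ppow 0 (t - u)) = cst 0.
    apply/funext => u; have [ur|ur] := leP u r.
      by rewrite ppow_mul0// subr_le0.
    by rewrite mulrC ppow_mul0// subr_le0 (le_trans tr)// ltW.
  rewrite E [ppow s _]ppow0 ?subr_le0// mulr0 Rintegral_cst// mul0r.
  by split=> //; exact: L10.
have b0 : 0 < t - r by rewrite subr_gt0.
have [L I] := Rint_ppow_near0 ss1 b0.
have E u : ppow (s - 1) (u - r) * ppow 0 (t - u) =
   (fun u => if u < t - r then ppow (s - 1) u else 0) (u + - r).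
  rewrite /= ltrD2r; have [ut|tu] := ltP u t.
    by rewrite [ppow 0 _]ppowE ?subr_gt0// powRr0 mulr1.
  by rewrite [ppow 0 _]ppow0 ?subr_le0// mulr0.
split; first by apply: eq_L1 (L1_shift (- r) L) => u; rewrite E.
under eq_Rintegral do rewrite E.
by rewrite (Rint_shift (- r) L) I subrK ppowE// mulrC.
Qed.

(** (t - r)_+^s is s times the integral of (u - r)_+^(s-1) over u < t, and Fubini turns K into its
    tail. The sign of g is read off in this form, where the tail is H0. *)
Lemma prof_abel (K : R -> R) M (r : R) : good K M -> 0 <= r ->
  L1 mu (fun t => ppow (s - 1) (t - r) * prof 0 K t) /\
  prof s K r = s * \int[mu]_t (ppow (s - 1) (t - r) * prof 0 K t).
Proof.
move=> gK r0; have mK : measurable_fun setT K by case: gK.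
pose F (t u : R) := K t * (ppow (s - 1) (u - r) * ppow 0 (t - u)).
have mF : measurable_fun setT (fun z : RR * RR => F z.1 z.2).
  apply: measurable_funM; first by apply: (measurableT_comp mK); exact: measurable_fst.
  apply: measurable_funM; apply: (measurableT_comp (measurable_ppow _)).
    by apply: measurable_funB => //; exact: measurable_snd.
  by apply: measurable_funB; [exact: measurable_fst|exact: measurable_snd].
have F1 t : L1 mu (F t) by apply: L1Z; have [] := Rint_abel_kernel r t.
have FG t : \int[mu]_u `|F t u| <= s^-1 * `|K t * ppow s (t - r)|.
  have [L I] := Rint_abel_kernel r t.
  rewrite normrM [X in _ * (_ * X)]ger0_norm ?ppow_ge0// mulrCA -I -(RintZ _ L).
  apply: Rint_le; [exact: L1_norm|exact: L1Z|] => u.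
  by rewrite /F normrM [X in _ * X <= _]ger0_norm// mulr_ge0 ?ppow_ge0.
have LG : L1 mu (fun t => s^-1 * `|K t * ppow s (t - r)|).
  by apply: L1Z; apply: L1_norm; exact: (L1_prof gK (ltW s0) r0).
have E2 u : F^~ u = fun t => ppow (s - 1) (u - r) * (K t * ppow 0 (t - u)).
  by apply/funext => t; rewrite /F mulrCA.
have Lp u : 0 <= u -> L1 mu (fun t => K t * ppow 0 (t - u)).
  by move=> u0; exact: (L1_prof gK (lexx 0) u0).
have z u : u <= r -> ppow (s - 1) (u - r) = 0 by move=> ur; rewrite ppow0// subr_le0.
have F2 u : L1 mu (F^~ u).
  rewrite E2; have [ur|ur] := leP u r.
    by rewrite z//; apply: eq_L1 (L10 mu) => t; rewrite mul0r.
  by apply: L1Z; apply: Lp; rewrite (le_trans r0)// ltW.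
have I2 u : \int[mu]_t F t u = ppow (s - 1) (u - r) * prof 0 K u.
  rewrite E2; have [ur|ur] := leP u r.
    rewrite z// mul0r (_ : (fun t => _) = cst 0) ?Rintegral_cst ?mul0r//.
    by apply/funext => t; rewrite mul0r.
  by rewrite RintZ//; apply: Lp; rewrite (le_trans r0)// ltW.
have [_ L E] := Rint_swap mF F1 FG LG F2.
split; first by apply: eq_L1 L => u; rewrite I2.
under eq_Rintegral do rewrite -I2.
rewrite -E.
have I1 t : \int[mu]_u F t u = s^-1 * (K t * ppow s (t - r)).
  by have [L' I] := Rint_abel_kernel r t; rewrite (RintZ _ L') I mulrCA.
under eq_Rintegral do rewrite I1.
by rewrite (RintZ _ (L1_prof gK (ltW s0) r0)) (mulVKf (lt0r_neq0 s0)).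
Qed.

End abel_profile.

(** * The density producing a prescribed right-hand side *)

Section profile.
Context {R : realType}.
Local Notation mu := (@lebesgue_measure R).
Variables (n : nat) (s P eps : R) (f : R -> R).
Hypothesis s01 : 0 < s < 1.
Hypothesis eps0 : 0 < eps.
Hypothesis Bf : forall k, Bk k f.
Hypothesis f0 : forall t, t < eps -> f t = 0.

Let s0 : 0 < s. Proof. by case/andP: s01. Qed.
Let ss1 : -1 < s - 1. Proof. by rewrite ltrBDr addrC subrr. Qed.
Local Notation a := (n.+1%:R / 2 : R).
Let a1 : -1 < a - 1. Proof. by rewrite ltrBDr addrC subrr. Qed.

(** Satisfies the bound |c| <= 1 of averages on the whole line; the weights used with it live on (0,
    1), where it is the identity. *)
Definition clip (v : R) : R := if 0 <= v <= 1 then v else 0.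

Lemma measurable_clip : measurable_fun setT clip.
Proof.
by apply: measurable_fun_ifT => //; apply: measurable_and; exact: measurable_fun_ler.
Qed.

Lemma clip_le1 v : `|clip v| <= 1.
Proof.
rewrite /clip; case: ifPn => [/andP[v0 v1]|_]; last by rewrite normr0.
by rewrite ger0_norm.
Qed.

Lemma clipE v : 0 <= v <= 1 -> clip v = v.
Proof. by rewrite /clip => ->. Qed.

Definition absum : R -> R :=
  average (fun v => ppow (a - 1) v * ppow (s - 1) (1 - v)) clip (cst 0) f.

Lemma absumE t : absum t =
  \int[mu]_v (ppow (a - 1) v * ppow (s - 1) (1 - v) * f (t * v)).
Proof.
apply: eq_Rint => v; rewrite addr0 /=.
have [v0|v0] := leP v 0; first by rewrite [ppow _ v]ppow0// !mul0r.
have [v1|v1] := leP 1 v; first by rewrite [ppow (s - 1) _]ppow0 ?subr_le0// mulr0 !mul0r.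
by rewrite clipE ?(ltW v0) ?(ltW v1)// mulrC [v * t]mulrC mulrC.
Qed.

Lemma Bk_absum k : Bk k absum.
Proof.
apply: Bk_average => //; [exact: measurable_clip|exact: clip_le1|exact: L1_Beta].
Qed.

Let dH (x : R) : is_derive x 1 absum (derive1 absum x).
Proof. by have [] := Bk_derive1 (Bk_absum 1). Qed.

Let BH k : Bk k (derive1 absum).
Proof. by have [] := Bk_derive1 (Bk_absum k.+1). Qed.

(** K of the overview, with [absum] as H0. Its possible jump at P is the exceptional point allowed
    in [ident_general]. *)
Definition cutder (t : R) : R := if 0 <= t < P then - derive1 absum t else 0.

Lemma good_cutder : exists M, good cutder M.
Proof.
have [M M0 HM] := Bk_bound (BH 0); exists (M * expR P); split.
  apply: measurable_fun_ifT => //.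
    by apply: measurable_and; [exact: measurable_fun_ler|exact: measurable_fun_ltr].
  apply: measurableT_comp => //.
  exact: continuous_measurable_fun (Bk_continuous (BH 0)).
move=> t; rewrite /cutder /decay; case: ifPn => [/andP[t0 tP]|_].
  rewrite t0 normrN -mulrA -expRD (le_trans (HM t))// ler_peMr//.
  by rewrite -expR0 ler_expR subr_ge0 ltW.
by rewrite normr0 !mulr_ge0 ?expR_ge0//; case: ifP => // _; exact: expR_ge0.
Qed.

Lemma continuous_cutder t : 0 < t -> t != P -> {for t, continuous cutder}.
Proof.
move=> t0 tP; have [tP'|Pt|/eqP] := ltgtP t P; last by rewrite (negbTE tP).
  have c : {for t, continuous (fun t => - derive1 absum t)}.
    by apply: cvgN; exact: (Bk_continuous (BH 0)).
  rewrite /prop_for /continuous_at {2}/cutder (ltW t0) tP' /=.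
  apply: cvg_trans c; apply: near_eq_cvg; near=> u.
  rewrite /cutder ifT//; apply/andP; split.
    by apply: ltW; near: u; exact: lt_nbhsr.
  by near: u; exact: lt_nbhsl.
rewrite /prop_for /continuous_at {2}/cutder [t < P]ltNge (ltW Pt) andbF.
have c : cst (0 : R) x @[x --> t] --> (0 : R) by exact: cvg_cst.
apply: cvg_trans c; apply: near_eq_cvg; near=> u.
have Pu : P < u by near: u; exact: lt_nbhsr.
by rewrite /= /cutder [u < P]ltNge (ltW Pu) andbF.
Unshelve. all: by end_near. Qed.

Hypothesis HP : absum P = 0.

(** Integrating the derivative gives H0(t) - H0(P); this is where the normalization [HP] enters. *)
Lemma prof0_cutder t : 0 <= t <= P -> prof 0 cutder t = absum t.
Proof.
move=> /andP[t0 tP].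
have d (x : R) : t <= x <= P -> is_derive x 1 absum (derive1 absum x).
  by move=> _; exact: dH.
have c (x : R) : t <= x <= P -> {for x, continuous (derive1 absum)}.
  by move=> _; exact: (Bk_continuous (BH 0)).
have [L I] := Rint_FTC tP d c.
have -> : absum t = (-1) * (absum P - absum t) by rewrite HP; ring.
rewrite -I -(RintZ _ L); have [M gK] := good_cutder.
apply: (eq_Rint_ae2 (a := t) (b := P)).
- by apply: measurable_prof_int; case: gK.
- by apply: measurable_funM => //; exact: (L1_measurable L).
move=> x xt xP; rewrite /cutder /ppow subr_gt0 powRr0.
have -> : (t <= x) = (t < x) by rewrite le_eqVlt eq_sym (negbTE xt).
have -> : (x <= P) = (x < P) by rewrite le_eqVlt (negbTE xP).
have [tx|tx] := ltP t x; last by rewrite /= !mulr0.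
rewrite (ltW (le_lt_trans t0 tx)) /= mulr1; case: ifP => _; last by rewrite mulr0.
by rewrite mulN1r.
Qed.

Lemma prof_cutder_out e t : P <= t -> prof e cutder t = 0.
Proof.
move=> Pt; rewrite /prof (_ : (fun x => _) = cst 0) ?Rintegral_cst ?mul0r//.
apply/funext => x /=; rewrite /cutder; case: ifPn => [/andP[_ xP]|_]; last by rewrite mul0r.
by rewrite ppow0 ?mulr0// subr_le0 (le_trans (ltW xP)).
Qed.

(** w^a H0(w r) is [abel_int] at w for Psi(v) = v^a f(r v), and Psi(1) = f(r). As f vanishes near 0,
    Psi is differentiable at v = 0 even when a < 1. *)
Lemma Efun_cutder r : 0 <= r < P ->
  Efun n.+1 s cutder r = s^-1 * Bet (s - 1) (- s) * f r.
Proof.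
move=> /andP[r0 rP].
have r10 : 0 < r + 1 by rewrite ltr_wpDl.
(* v < e forces r v < eps; r + 1 instead of r admits r = 0. *)
pose e := eps / (r + 1).
have e0 : 0 < e by rewrite divr_gt0.
have fe v : v < e -> f (r * v) = 0.
  move=> ve; apply: f0; have [v0|v0] := leP v 0.
    by rewrite (le_lt_trans _ eps0)// mulr_ge0_le0.
  apply: (@le_lt_trans _ _ ((r + 1) * v)); first by rewrite ler_wpM2r ?(ltW v0)// lerDl.
  by rewrite mulrC -ltr_pdivlMr.
have [df Bf'] := Bk_derive1 (Bf 1).
pose Psi (v : R) := ppow a v * f (r * v).
pose D (v : R) := a * ppow (a - 1) v * f (r * v) + ppow a v * (derive1 f (r * v) * r).
have f'e v : v < e -> derive1 f (r * v) * r = 0.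
  move=> ve; have d : is_derive v 1 (fun v => f (r * v + 0)) (derive1 f (r * v + 0) * r).
    exact: (is_derive_comp1 (g := fun v => r * v + 0) (df (r * v + 0)) (is_derive_affine r 0 v)).
  rewrite -[r * v]addr0 -(is_derive_derive1 d) -[RHS](derive1_cst (0 : R) v) !derive1E.
  apply: near_eq_derive; near=> u; rewrite addr0 fe//.
  by near: u; exact: lt_nbhsl.
have De v : v < e -> D v = 0 by move=> ve; rewrite /D fe// f'e// !mulr0 addr0.
have dPsi (v : R) : is_derive v 1 Psi (D v).
  have [ve|ev] := ltP v e.
    rewrite De//; apply: near_eq_is_derive (is_derive_cst (0 : R) v 1).
    near=> u; rewrite /Psi fe ?mulr0//; near: u; exact: lt_nbhsl.
  have v0 : 0 < v by rewrite (lt_le_trans e0).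
  have d : is_derive v 1 (fun v => f (r * v + 0)) (derive1 f (r * v + 0) * r).
    exact: (is_derive_comp1 (g := fun v => r * v + 0) (df (r * v + 0)) (is_derive_affine r 0 v)).
  have d2 := is_derive_prod (is_derive1_powR a v0) d.
  rewrite /D !ppowE//.
  apply: (near_eq_is_derive (f := fun v => v `^ a * f (r * v + 0))).
    near=> u; rewrite /Psi ppowE ?addr0//; near: u; exact: lt_nbhsr.
  by apply: is_derive_eq d2 _; rewrite !addr0.
have cD : continuous D.
  move=> v; have [ve|ev] := ltP v e.
    rewrite /continuous_at De//; have c : cst (0 : R) x @[x --> v] --> (0 : R) by exact: cvg_cst.
    apply: cvg_trans c; apply: near_eq_cvg.
    near=> u; rewrite De//; near: u; exact: lt_nbhsl.
  have v0 : 0 < v by rewrite (lt_le_trans e0).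
  have cr : {for v, continuous (fun v : R => r * v)}.
    by apply: cvgM; [exact: cvg_cst|exact: cvg_id].
  have cf : {for v, continuous (fun v : R => f (r * v))}.
    by apply: (@continuous_cvg _ _ _ _ _ (fun v => r * v) f) cr; exact: (Bk_continuous (Bf 0)).
  have cf' : {for v, continuous (fun v : R => derive1 f (r * v))}.
    by apply: (@continuous_cvg _ _ _ _ _ (fun v => r * v) (derive1 f)) cr; exact: (Bk_continuous Bf').
  have cp b : {for v, continuous (ppow b)}.
    have := @continuous_powR R b v v0; rewrite /prop_for /continuous_at ppowE// => c.
    apply: cvg_trans c; apply: near_eq_cvg; near=> u.
    by rewrite ppowE//; near: u; exact: lt_nbhsr.
  apply: cvgD; apply: cvgM => //; last by apply: cvgM => //; exact: cvg_cst.
    by apply: cvgM; [exact: cvg_cst|exact: cp].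
  exact: cp.
have Psi0 : Psi 0 = 0 by rewrite /Psi ppow0// mul0r.
have [M DM] : exists M, forall v, 0 <= v <= 1 -> `|D v| <= M.
  have cN : {within `[0, 1], continuous (fun v : R => `|D v|)}.
    by apply: continuous_subspaceT => v; apply: cvg_norm; exact: cD.
  have [c _ hc] := EVT_max ler01 cN.
  by exists `|D c| => v v01; apply: hc; rewrite in_itv.
have key v : 0 < v <= 1 -> abel_int s Psi v = v `^ a * prof 0 cutder (v * r).
  move=> /andP[v0 v1]; rewrite prof0_cutder; last first.
    by rewrite mulr_ge0 ?(ltW v0)//= (le_trans _ (ltW rP))// ler_piMl.
  rewrite absumE -RintZ; last first.
    have cf := Bk_continuous (Bf 0); have [N _ fN] := Bk_bound (Bf 0).
    apply: (@L1_le _ _ _ mu _ (fun w => N * (ppow (a - 1) w * ppow (s - 1) (1 - w)))).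
    - apply: measurable_funM; first by apply: (@L1_measurable _ _ _ mu); exact: L1_Beta.
      by apply: (measurableT_comp (continuous_measurable_fun cf)); exact: measurable_funM.
    - by move=> w; rewrite normrM ger0_norm ?mulr_ge0 ?ppow_ge0// mulrC ler_wpM2r ?mulr_ge0 ?ppow_ge0.
    - by apply: L1Z; exact: L1_Beta.
  apply: eq_Rint => w; have [w0|w0] := leP w 0.
    by rewrite [ppow (-1) w]ppow0// [ppow (a - 1) w]ppow0// !mul0r mulr0.
  rewrite /Psi ppowM// [ppow (-1) w]ppowE// [ppow a w]ppowE// [ppow (a - 1) w]ppowE//.
  rewrite [a - 1]addrC (powR_add (-1) a w0).
  rewrite (_ : r * (v * w) = v * r * w); last by ring.
  by move: (w `^ _) (w `^ _) (v `^ _) (ppow _ _) (f _) => *; ring.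
have := abel_inversion s01 dPsi cD Psi0 DM.
rewrite {3}/Psi ppowE// powR1 mul1r mulr1 => <-.
apply: eq_Rint => m; have [m0|m0] := leP m 0; first by rewrite !(ppow_mul0 _ _ m0).
have /andP[p0 p1] := om01 m0.
rewrite key ?ltr01 ?lexx// key ?p0 ?(ltW p1)// powR1 !mul1r.
by [].
Unshelve. all: by end_near. Qed.

(** What remains of g after extracting (P - r)^(s+1) through t = r + (P - r) w; H0' is taken at the
    convex combination (1 - w) r + w P. It yields both the order of vanishing at the sphere and the
    smoothness of g inside. *)
Definition innerprof : R -> R :=
  average (fun w => if w < 1 then ppow s w else 0) (fun w => clip (1 - w))
    (fun w => P * clip w) (fun t => - derive1 absum t).

Lemma Bk_innerprof k : Bk k innerprof.
Proof.
apply: Bk_average.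
- by apply: (measurableT_comp measurable_clip); exact: measurable_funB.
- by apply: measurable_funM => //; exact: measurable_clip.
- by move=> v; exact: clip_le1.
- by have [] := Rint_ppow_near0 (lt_trans (ltrN10 R) s0) ltr01.
- have := Bk_lin (-1) 0 (BH k.+1) (BH k.+1).
  by congr Bk; apply/funext => t; rewrite mul0r addr0 mulN1r.
Qed.

Lemma prof_innerprof r : 0 <= r < P -> prof s cutder r = (P - r) `^ (s + 1) * innerprof r.
Proof.
move=> /andP[r0 rP]; have c0 : 0 < P - r by rewrite subr_gt0.
have [M gK] := good_cutder.
have L := L1_prof gK (ltW s0) r0.
have L2 := L1_shift r L.
have := Rint_scale c0 L2; rewrite (Rint_shift r L) -/(prof s cutder r) => E.
have -> : prof s cutder r = (P - r) * ((P - r)^-1 * prof s cutder r).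
  by rewrite mulrA mulfV ?mul1r// gt_eqF.
rewrite -E (powR_add s 1 c0) powRr1 ?(ltW c0)// [_ * (P - r)]mulrC -mulrA; congr (_ * _).
have cN : continuous (fun t => - derive1 absum t).
  by move=> t; apply: cvgN; exact: (Bk_continuous (BH 0)).
have [N _ HN] := Bk_bound (BH 0).
have NN t : `|- derive1 absum t| <= N by rewrite normrN.
rewrite -RintZ; last first.
  apply: L1_average cN NN.
  - by apply: (measurableT_comp measurable_clip); exact: measurable_funB.
  - by apply: measurable_funM => //; exact: measurable_clip.
  - by have [] := Rint_ppow_near0 (lt_trans (ltrN10 R) s0) ltr01.
apply: eq_Rint => w; rewrite addrK ppowM//.
have [w0|w0] := leP w 0.
  by rewrite [ppow s w]ppow0// !mulr0 if_same mul0r mulr0.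
rewrite /cutder; have [w1|w1] := ltP w 1; last first.
  have -> : ((P - r) * w + r < P) = false.
    by apply/negbTE; rewrite -leNgt -lerBlDr ler_peMr// ltW.
  by rewrite andbF !mul0r mulr0.
rewrite !clipE ?subr_ge0 ?(ltW w1) ?(ltW w0)// ?gerBl ?(ltW w0)//.
rewrite addr_ge0 ?mulr_ge0 ?(ltW w0) ?(ltW c0)//= ifT; last first.
  by rewrite -ltrBrDr -[ltRHS]mulr1 ltr_pM2l.
rewrite (_ : (P - r) * w + r = (1 - w) * r + P * w); last by ring.
by move: (derive1 absum _) (ppow s w) (_ `^ s) => *; ring.
Qed.

End profile.

(** * Sign of the profile *)

Section potential.
Context {R : realType}.
Local Notation mu := (@lebesgue_measure R).
Local Notation RR := (measurableTypeR R).
Variables (s P p r C : R) (phi : R -> R).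
Hypothesis s01 : 0 < s < 1.
Hypothesis mphi : measurable_fun setT phi.
Hypothesis phi0 : forall q, 0 <= phi q.
Hypothesis phiC : forall q, phi q <= C.
Hypothesis phi_out : forall q, ~~ (p < q < r) -> phi q = 0.
Hypothesis rP : r < P.

Let s0 : 0 < s. Proof. by case/andP: s01. Qed.
Let s1 : s < 1. Proof. by case/andP: s01. Qed.
Let ss1 : -1 < s - 1. Proof. by rewrite ltrBDr addrC subrr. Qed.

(** Riemann-Liouville potential of a nonnegative density carried by the shell (p, r); up to a power
    of t, H0 is a difference of two of these. *)
Definition pot (t : R) : R := \int[mu]_q (phi q * ppow (s - 1) (t - q)).

Let C0 : 0 <= C. Proof. exact: le_trans (phi0 0) (phiC 0). Qed.

Let mker (t : R) : measurable_fun setT (fun q : R => ppow (s - 1) (t - q)).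
Proof. by apply: (measurableT_comp (measurable_ppow _)); exact: measurable_funB. Qed.

Lemma L1_pot t : L1 mu (fun q => phi q * ppow (s - 1) (t - q)).
Proof.
have [tp|pt] := leP t p.
  apply: eq_L1 (L10 mu) => q; have [/andP[pq _]|/phi_out ->] := boolP (p < q < r); last by rewrite mul0r.
  by rewrite mulrC ppow_mul0// subr_le0 (le_trans tp)// ltW.
have [L _] := Rint_Beta (ltrN10 R) ss1 pt.
apply: (@L1_le _ _ _ mu _ (fun q => C * (ppow 0 (q - p) * ppow (s - 1) (t - q)))).
- by apply: measurable_funM; [exact: mphi|exact: mker].
- move=> q; rewrite ger0_norm ?mulr_ge0 ?ppow_ge0// mulrA ler_wpM2r ?ppow_ge0//.
  have [/andP[pq _]|/phi_out ->] := boolP (p < q < r); last by rewrite mulr_ge0 ?ppow_ge0.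
  by rewrite ppowE ?subr_gt0// powRr0 mulr1.
- exact: L1Z.
Qed.

Lemma pot_ge0 t : 0 <= pot t.
Proof. by apply: Rint_ge0 => q; rewrite mulr_ge0 ?ppow_ge0. Qed.

Lemma pot_out t : t <= p -> pot t = 0.
Proof.
move=> tp; rewrite /pot (_ : (fun q => _) = cst 0) ?Rintegral_cst ?mul0r//.
apply/funext => q; have [/andP[pq _]|/phi_out ->] := boolP (p < q < r); last by rewrite mul0r.
by rewrite mulrC ppow_mul0// subr_le0 (le_trans tp)// ltW.
Qed.

(** (P - q)/(t - q) increases with q because t <= P, and its power 1 - s is the kernel at t over the
    kernel at P. So among potentials normalized at P, the one with mass closer to the sphere is the
    larger. *)
Lemma ratio_le q q' t : q <= q' -> q' < t -> t <= P ->
  ((P - q) / (t - q)) `^ (1 - s) <= ((P - q') / (t - q')) `^ (1 - s).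
Proof.
move=> qq q't tP; have a1 : 0 < t - q' by rewrite subr_gt0.
have a2 : 0 < t - q by rewrite subr_gt0 (le_lt_trans qq).
have b1 : 0 < P - q' by rewrite subr_gt0 (lt_le_trans q't).
have b2 : 0 < P - q by rewrite subr_gt0 (le_lt_trans qq)// (lt_le_trans q't).
apply: ge0_ler_powR; rewrite ?subr_ge0 ?(ltW s1)// ?nnegrE ?divr_ge0 ?(ltW b1) ?(ltW b2) ?(ltW a1) ?(ltW a2)//.
rewrite ler_pdivrMr// mulrAC ler_pdivlMr// -subr_ge0.
have -> : (P - q') * (t - q) - (P - q) * (t - q') = (P - t) * (q' - q) by ring.
by rewrite mulr_ge0// subr_ge0.
Qed.

Let kerE q t : q < t -> t <= P ->
  ppow (s - 1) (t - q) = ppow (s - 1) (P - q) * ((P - q) / (t - q)) `^ (1 - s).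
Proof.
move=> qt tP; have a1 : 0 < t - q by rewrite subr_gt0.
have b1 : 0 < P - q by rewrite subr_gt0 (lt_le_trans qt).
rewrite !ppowE// powRM ?invr_ge0 ?(ltW a1) ?(ltW b1)// mulrA.
rewrite -(powR_add _ _ b1) (_ : s - 1 + (1 - s) = 0); last by ring.
rewrite powRr0 mul1r -[(t - q)^-1]powR_inv1 ?(ltW a1)// -powRrM.
by congr (_ `^ _); ring.
Qed.

Hypothesis potP : pot P = 1.

(** By [kerE] the kernel at t is the kernel at P times a ratio that is smallest at q = p, and the
    kernel at P integrates to 1. *)
Lemma pot_lower t : r <= t -> t <= P -> ((P - p) / (t - p)) `^ (1 - s) <= pot t.
Proof.
move=> rt tP; set c := _ `^ _; have -> : c = c * pot P by rewrite potP mulr1.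
rewrite -(RintZ _ (L1_pot P)).
apply: Rint_le; [exact: L1Z (L1_pot P)|exact: L1_pot|] => q.
have [/andP[pq qr]|/phi_out ->] := boolP (p < q < r); last by rewrite !mul0r mulr0.
have qt : q < t by rewrite (lt_le_trans qr).
rewrite (kerE qt tP) mulrCA; apply: ler_wpM2l => //.
rewrite mulrC; apply: ler_wpM2l; first exact: ppow_ge0.
exact: ratio_le (ltW pq) qt tP.
Qed.

Lemma pot_upper t : r < t -> t <= P -> pot t <= ((P - r) / (t - r)) `^ (1 - s).
Proof.
move=> rt tP; set c := leRHS; have -> : c = c * pot P by rewrite potP mulr1.
rewrite -(RintZ _ (L1_pot P)).
apply: Rint_le; [exact: L1_pot|exact: L1Z (L1_pot P)|] => q.
have [/andP[pq qr]|/phi_out ->] := boolP (p < q < r); last by rewrite !mul0r mulr0.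
have qt : q < t by rewrite (lt_trans qr).
rewrite (kerE qt tP) [leRHS]mulrCA; apply: ler_wpM2l => //.
rewrite mulrC; apply: ler_wpM2r; first exact: ppow_ge0.
exact: ratio_le (ltW qr) rt tP.
Qed.

(** For each q the integral in t is (P - q)^s / s, that is (P - q)/s times the kernel at P. A
    normalized shell close to the sphere therefore has a small total effect. *)
Lemma Rint_pot : L1 mu (fun t => pot t * ppow 0 (P - t)) /\
  \int[mu]_t (pot t * ppow 0 (P - t)) <= s^-1 * (P - p).
Proof.
pose F q t := phi q * (ppow (s - 1) (t - q) * ppow 0 (P - t)).
have mF : measurable_fun setT (fun z : RR * RR => F z.1 z.2).
  apply: measurable_funM; first by apply: (measurableT_comp mphi); exact: measurable_fst.
  apply: measurable_funM; apply: (measurableT_comp (measurable_ppow _)).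
    by apply: measurable_funB; [exact: measurable_snd|exact: measurable_fst].
  by apply: measurable_funB => //; exact: measurable_snd.
have F1 q : L1 mu (F q) by apply: L1Z; have [] := Rint_abel_kernel s01 q P.
have F0 q t : 0 <= F q t by rewrite !mulr_ge0 ?ppow_ge0.
have I1 q : \int[mu]_t F q t = phi q * (s^-1 * ppow s (P - q)).
  by have [L I] := Rint_abel_kernel s01 q P; rewrite (RintZ _ L) I.
have ID q : phi q * (s^-1 * ppow s (P - q)) <= (s^-1 * (P - p)) * (phi q * ppow (s - 1) (P - q)).
  have [/andP[pq qr]|/phi_out ->] := boolP (p < q < r); last by rewrite !mul0r mulr0.
  have b1 : 0 < P - q by rewrite subr_gt0 (lt_trans qr).
  rewrite !ppowE// [leRHS]mulrCA; apply: ler_wpM2l => //.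
  rewrite -mulrA; apply: ler_wpM2l; first by rewrite invr_ge0 ltW.
  have -> : (P - q) `^ s = (P - q) * (P - q) `^ (s - 1).
    by rewrite -[X in X * _]powRr1 ?(ltW b1)// -(powR_add _ _ b1); congr (_ `^ _); ring.
  by apply: ler_wpM2r; rewrite ?powR_ge0// lerB// ltW.
have LG := L1Z (s^-1 * (P - p)) (L1_pot P).
have FG q : \int[mu]_t `|F q t| <= (s^-1 * (P - p)) * (phi q * ppow (s - 1) (P - q)).
  by under eq_Rintegral do rewrite (ger0_norm (F0 _ _)); rewrite I1.
have E2 t : F^~ t = fun q => ppow 0 (P - t) * (phi q * ppow (s - 1) (t - q)).
  by apply/funext => q; rewrite /F; ring.
have F2 t : L1 mu (F^~ t) by rewrite E2; apply: L1Z; exact: L1_pot.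
have I2 t : \int[mu]_q F q t = pot t * ppow 0 (P - t).
  by rewrite E2 (RintZ _ (L1_pot t)) mulrC.
have [L' L E] := Rint_swap mF F1 FG LG F2.
split; first by apply: eq_L1 L => t; rewrite I2.
under eq_Rintegral do rewrite -I2.
rewrite -E; set c := leRHS; have -> : c = c * pot P by rewrite potP mulr1.
rewrite -(RintZ _ (L1_pot P)).
apply: Rint_le; [exact: L'|exact: L1Z (L1_pot P)|] => q.
by rewrite I1; exact: ID.
Qed.

End potential.

Section absum_pot.
Context {R : realType}.
Local Notation mu := (@lebesgue_measure R).
Variables (n : nat) (s : R).
Hypothesis s01 : 0 < s < 1.
Local Notation a := (n.+1%:R / 2 : R).

Let ss1 : -1 < s - 1. Proof. by case/andP: s01 => s0 _; rewrite ltrBDr addrC subrr. Qed.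
Let a1 : -1 < a - 1. Proof. by rewrite ltrBDr addrC subrr divr_gt0. Qed.

(** The substitution q = t v turns H0 into a potential, to which the comparison at P applies. *)
Lemma absum_pot (f : R -> R) C t : measurable_fun setT f -> (forall x, `|f x| <= C) -> 0 < t ->
  absum n s f t = t `^ (1 - s - a) * pot s (fun q => ppow (a - 1) q * f q) t.
Proof.
move=> mf fC t0; rewrite absumE /pot.
pose F q := ppow (a - 1) q * f q * ppow (s - 1) (t - q).
have LB : L1 mu (fun q => ppow (a - 1) q * ppow (s - 1) (t - q)).
  have [+ _] := Rint_Beta a1 ss1 t0.
  by apply: eq_L1 => q; rewrite subr0.
have LF : L1 mu F.
  apply: (@L1_le _ _ _ mu _ (fun q => C * (ppow (a - 1) q * ppow (s - 1) (t - q)))).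
  - apply: measurable_funM; first by apply: measurable_funM => //; exact: measurable_ppow.
    by apply: (measurableT_comp (measurable_ppow _)); exact: measurable_funB.
  - move=> q; rewrite /F mulrAC normrM ger0_norm ?mulr_ge0 ?ppow_ge0// mulrC.
    by apply: ler_wpM2r; rewrite ?mulr_ge0 ?ppow_ge0.
  - exact: L1Z.
have := Rint_scale t0 LF.
have -> : (fun v => F (t * v)) =
    fun v => t `^ (a - 1 + (s - 1)) * (ppow (a - 1) v * ppow (s - 1) (1 - v) * f (t * v)).
  apply/funext => v; rewrite /F (_ : t - t * v = t * (1 - v)); last by ring.
  rewrite !ppowM// (powR_add (a - 1) (s - 1) t0).
  by move: (t `^ _) (t `^ _) (ppow _ _) (ppow _ _) (f _) => *; ring.
have LB1 : L1 mu (fun v => ppow (a - 1) v * ppow (s - 1) (1 - v) * f (t * v)).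
  apply: (@L1_le _ _ _ mu _ (fun q => C * (ppow (a - 1) q * ppow (s - 1) (1 - q)))).
  - apply: measurable_funM; first by apply: (@L1_measurable _ _ _ mu); exact: L1_Beta.
    by apply: (measurableT_comp mf); exact: measurable_funM.
  - move=> q; rewrite normrM ger0_norm ?mulr_ge0 ?ppow_ge0// mulrC.
    by apply: ler_wpM2r; rewrite ?mulr_ge0 ?ppow_ge0.
  - by apply: L1Z; exact: L1_Beta.
rewrite (RintZ _ LB1) => E.
have p0 : 0 < t `^ (a - 1 + (s - 1)) by rewrite powR_gt0.
apply: (mulfI (lt0r_neq0 p0)); rewrite E mulrA; congr (_ * _).
by rewrite -(powR_add _ _ t0) -[LHS]powR_inv1 ?(ltW t0)//; congr (_ `^ _); ring.
Qed.

End absum_pot.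

(** * Sign estimates for the difference of two normalized potentials *)

Section sign_estimates.
Context {R : realType}.
Local Notation mu := (@lebesgue_measure R).
Variables (s P d b m0 M0 : R) (h J1 J2 : R -> R).
Hypothesis s01 : 0 < s < 1.
Hypothesis P0 : 0 < P.
(** Two nested scales: b0 lies at distance D = d P from P, and the shell (b0, b1) takes only the
    fraction d of that distance. *)
Let D := d * P.
Let b0 := P - D.
Let b1 := b0 + d * D.
(** Lower bound of J2 - J1 on the window [b0 + D/4, b0 + D/2]: there the ratio for J2 is at least 2,
    and the one for J1 at most (P/2) / (3P/8) = 4/3. *)
Let c0 : R := 2 `^ (1 - s) - (4 / 3) `^ (1 - s).
Hypothesis d0 : 0 < d.
Hypothesis d8 : d <= 8^-1.
Hypothesis m00 : 0 < m0.
Hypothesis mM : forall t, P / 2 <= t <= P -> m0 <= t `^ b <= M0.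
(* [d] is the relative thickness of the outer shell: [dA] is what positivity on
   that shell requires, [dB] what negativity on the inner one does. *)
Hypothesis dA : d `^ s * (8 * M0) < s * m0 * c0.
Hypothesis dB : d * (32 * M0) < s * m0.
Hypothesis J1_ge0 : forall t, 0 <= J1 t.
Hypothesis J1_ge1 : forall t, P / 2 <= t <= P -> 1 <= J1 t.
Hypothesis J1_le : forall t, P / 2 < t -> t <= P ->
  J1 t <= ((P - P / 2) / (t - P / 2)) `^ (1 - s).
Hypothesis J2_ge0 : forall t, 0 <= J2 t.
Hypothesis J2_out : forall t, t <= b0 -> J2 t = 0.
Hypothesis J2_ge : forall t, b1 <= t -> t <= P -> ((P - b0) / (t - b0)) `^ (1 - s) <= J2 t.
Hypothesis LJ2 : L1 mu (fun t => J2 t * ppow 0 (P - t)).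
Hypothesis IJ2 : \int[mu]_t (J2 t * ppow 0 (P - t)) <= s^-1 * (P - b0).
Hypothesis hE : forall t, 0 < t < P -> h t = t `^ b * (J2 t - J1 t).
Hypothesis h_out : forall t, P <= t -> h t = 0.
Hypothesis Lh : forall r, 0 <= r -> L1 mu (fun t => ppow (s - 1) (t - r) * h t).

Let s0 : 0 < s. Proof. by case/andP: s01. Qed.
Let s1 : s < 1. Proof. by case/andP: s01. Qed.
Let N1s : s - 1 <= 0. Proof. by rewrite subr_le0 ltW. Qed.
Let D0 : 0 < D. Proof. exact: mulr_gt0. Qed.
Let D8 : D <= P / 8. Proof. by rewrite /D mulrC ler_pM2l. Qed.
Let dD8 : d * D <= D / 8. Proof. by rewrite mulrC ler_pM2l. Qed.
Let dD0 : 0 < d * D. Proof. exact: mulr_gt0. Qed.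
Let b0P : P - b0 = D. Proof. by rewrite /b0; ring. Qed.
Let M00 : 0 < M0.
Proof.
have /mM/andP[h1 h2] : P / 2 <= P <= P by rewrite lexx andbT; have := P0; lra.
exact: lt_le_trans (lt_le_trans m00 h1) h2.
Qed.

Lemma Rint_itv (p q : R) : p <= q -> \int[mu]_v (if p <= v <= q then 1 else 0) = q - p.
Proof.
move=> pq; have di (x : R) : p <= x <= q -> is_derive x 1 id (1 : R).
  by move=> _; exact: is_derive_id.
have ci (x : R) : p <= x <= q -> {for x, continuous (fun _ : R => 1 : R)}.
  by move=> _; exact: cst_continuous.
by have [] := Rint_FTC pq di ci.
Qed.

Let J12 t : b1 <= t -> t < P -> J1 t <= J2 t.
Proof.
move=> bt tP; have bb : b0 < t by rewrite (lt_le_trans _ bt)// /b1 ltrDl.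
have Pb : P / 2 <= b0 by rewrite /b0; have := D8; have := P0; lra.
apply: le_trans (J1_le (le_lt_trans Pb bb) (ltW tP)) _.
apply: le_trans (J2_ge bt (ltW tP)).
exact: (ratio_le s01 Pb bb (ltW tP)).
Qed.

Let b2P t : b0 <= t -> t < P -> P / 2 <= t <= P.
Proof.
by move=> bt tP; rewrite (ltW tP) andbT; move: bt; rewrite /b0; have := D8; have := P0; lra.
Qed.

Let pos t : b0 <= t -> 0 < t.
Proof. by rewrite /b0; have := D8; have := P0; lra. Qed.

Lemma profile_ge0 r : b1 <= r -> 0 <= \int[mu]_t (ppow (s - 1) (t - r) * h t).
Proof.
move=> br; apply: Rint_ge0 => t.
have [tr|rt] := leP t r; first by rewrite ppow_mul0// subr_le0.
have [Pt|tP] := leP P t; first by rewrite h_out// mulr0.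
have b1t : b1 <= t by rewrite (le_trans br)// ltW.
have b0t : b0 <= t by rewrite (le_trans _ b1t)// /b1 lerDl ltW.
rewrite mulr_ge0 ?ppow_ge0// hE ?(pos b0t)//.
by rewrite mulr_ge0 ?powR_ge0// subr_ge0 J12.
Qed.

Let c00 : 0 < c0.
Proof.
by rewrite subr_gt0; apply: gt0_ltr_powR; rewrite ?subr_gt0// ?nnegrE ?divr_ge0//; lra.
Qed.

(** Beyond b1 the integrand is nonnegative, and the window [u, v] with kernel at least D^(s-1) gains
    m0 c0 D^s / 4. The loss comes from (r, b1), of length at most d D, where J1 <= 2: it is at most
    2 M0 (d D)^s / s. [dA] compares the two. *)
Lemma profile_gt0 r : b0 <= r <= b1 -> 0 < \int[mu]_t (ppow (s - 1) (t - r) * h t).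
Proof.
move=> /andP[br rb]; have r0 : 0 <= r by exact: ltW (pos br).
pose u := b0 + D / 4; pose v := b0 + D / 2.
pose A := D `^ (s - 1) * (m0 * c0).
have A0 : 0 <= A by rewrite mulr_ge0 ?powR_ge0// mulr_ge0// ltW.
have uv : u <= v by rewrite /u /v; have := D0; lra.
have [Lk Ik] := Rint_abel_kernel s01 r b1.
have Li := L1_itv uv.
pose L t := A * (if u <= t <= v then 1 else 0) -
  (2 * M0) * (ppow (s - 1) (t - r) * ppow 0 (b1 - t)).
have LL : L1 mu L by apply: L1B; exact: L1Z.
apply: (@lt_le_trans _ _ (\int[mu]_t L t)).
  rewrite /L (RintB (L1Z A Li) (L1Z (2 * M0) Lk)) (RintZ _ Li) (RintZ _ Lk) Ik Rint_itv//.
  have h1 : ppow s (b1 - r) <= (d * D) `^ s.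
    rewrite -(ppowE s dD0); apply: ppow_mono; first exact: ltW.
    by move: br; rewrite /b1; lra.
  have -> : A * (v - u) = D `^ s * (m0 * c0 / 4).
    have -> : D `^ s = D `^ (s - 1) * D.
      rewrite -[X in _ * X]powRr1 ?(ltW D0)// -(powR_add _ _ D0).
      by congr (_ `^ _); ring.
    by rewrite /A /v /u; move: (D `^ _) c0 => *; field.
  rewrite subr_gt0; apply: (@le_lt_trans _ _ (2 * M0 * (s^-1 * (d * D) `^ s))).
    by rewrite !ler_wpM2l// ?invr_ge0 ?mulr_ge0 ?(ltW s0) ?(ltW M00).
  rewrite powRM ?(ltW d0) ?(ltW D0)//.
  have Ds : 0 < D `^ s by rewrite powR_gt0.
  rewrite (_ : _ * _ = D `^ s * (2 * M0 * d `^ s / s)); last first.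
    by move: (D `^ s) (d `^ s) => *; ring.
  rewrite ltr_pM2l// ltr_pdivrMr//; have := dA.
  by move: (d `^ s) c0 => x y; lra.
apply: Rint_le => //; first exact: Lh.
move=> t; rewrite /L.
have k0 x y : 0 <= ppow (s - 1) x * ppow 0 y by rewrite mulr_ge0 ?ppow_ge0.
have M20 : 0 <= 2 * M0 by rewrite mulr_ge0// ltW.
have [tr|rt] := leP t r.
  have z y : ppow (s - 1) (t - r) * y = 0 by apply: ppow_mul0; rewrite subr_le0.
  rewrite !z mulr0 subr0.
  rewrite ifF ?mulr0//; apply/negbTE; rewrite negb_and -ltNge.
  by apply/orP; left; move: tr rb; rewrite /u /b1; have := dD8; have := D0; lra.
have b0t : b0 <= t by exact: le_trans br (ltW rt).
have [Pt|tP] := leP P t.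
  rewrite h_out// mulr0 subr_le0 ifF ?mulr0; first by rewrite mulr_ge0.
  apply/negbTE; rewrite negb_and -!ltNge; apply/orP; right.
  by move: Pt; rewrite /v /b0; have := D0; lra.
rewrite hE ?(pos b0t)//; have /andP[tm tM] := mM (b2P b0t tP).
have tr0 : 0 < t - r by rewrite subr_gt0.
have [b1t|tb1] := leP b1 t; last first.
  rewrite ifF ?mulr0 ?sub0r; last first.
    apply/negbTE; rewrite negb_and -!ltNge; apply/orP; left.
    by move: tb1; rewrite /u /b1; have := dD8; have := D0; lra.
  rewrite [ppow 0 _]ppowE ?subr_gt0// powRr0 mulr1 -mulNr mulrC ler_wpM2l ?ppow_ge0//.
  have J1t : J1 t <= 2.
    have P2t : P / 2 < t by move: b0t; rewrite /b0; have := D8; have := P0; lra.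
    apply: le_trans (J1_le P2t (ltW tP)) _.
    apply: (@le_trans _ _ (2 `^ (1 - s))).
      apply: ge0_ler_powR; rewrite ?subr_ge0 ?(ltW s1)// ?nnegrE.
      - by apply: divr_ge0; move: P2t; have := P0; lra.
      - exact: ler0n.
      rewrite ler_pdivrMr ?subr_gt0//.
      by move: b0t; rewrite /b0; have := D8; have := P0; lra.
    by rewrite -[leRHS]powRr1//; apply: ler_powR; rewrite ?ler1n//; have := s0; lra.
  have h3 : t `^ b * J1 t <= M0 * 2 by apply: ler_pM; rewrite ?powR_ge0.
  have h4 : 0 <= t `^ b * J2 t by rewrite mulr_ge0 ?powR_ge0.
  by move: h3 h4; rewrite mulrBr; move: (_ * J1 t) (_ * J2 t) => *; lra.
rewrite (ppow0 0 (_ : b1 - t <= 0)) ?subr_le0// !mulr0 subr0.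
case: ifPn => [/andP[ut tv]|_]; last first.
  by rewrite mulr0 mulr_ge0 ?ppow_ge0// mulr_ge0 ?powR_ge0// subr_ge0 J12.
rewrite mulr1 /A ppowE//; apply: ler_pM; rewrite ?powR_ge0 ?mulr_ge0 ?(ltW m00) ?(ltW c00)//.
  apply: powR_le_anti => //; move: tr0 br tv; rewrite /v; have := D0; lra.
apply: ler_pM => //; rewrite ?(ltW m00) ?(ltW c00)//.
have bt : b0 < t by move: ut; rewrite /u; have := D0; lra.
apply: lerB.
  apply: le_trans (J2_ge b1t (ltW tP)); rewrite b0P.
  apply: ge0_ler_powR; rewrite ?subr_ge0 ?(ltW s1)// ?nnegrE//.
    by rewrite divr_ge0 ?subr_ge0// ltW.
  by rewrite ler_pdivlMr ?subr_gt0//; move: tv; rewrite /v; lra.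
have P2t : P / 2 < t by move: b0t; rewrite /b0; have := D8; have := P0; lra.
apply: le_trans (J1_le P2t (ltW tP)) _.
apply: ge0_ler_powR; rewrite ?subr_ge0 ?(ltW s1)// ?nnegrE ?divr_ge0//.
- by move: P0; lra.
- by rewrite subr_ge0 ltW.
rewrite ler_pdivrMr ?subr_gt0//.
by move: b0t; rewrite /b0; have := D8; have := P0; lra.
Qed.

(** Below b0 only the inner shell acts, and [5P/8, 3P/4] alone contributes at most - m0 P^s / 8. The
    outer shell adds at most the kernel at distance P/4 times M0 times the integral of J2, which is
    at most D/s. [dB] compares the two. *)
Lemma profile_lt0 r : P / 4 <= r <= P / 2 -> \int[mu]_t (ppow (s - 1) (t - r) * h t) < 0.
Proof.
move=> /andP[Pr rP]; have r0 : 0 <= r by move: Pr; have := P0; lra.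
pose u := P * 5 / 8; pose v := P * 3 / 4.
have uv : u <= v by rewrite /u /v; have := P0; lra.
pose A := P `^ (s - 1) * m0; pose C1 := (P / 4) `^ (s - 1) * M0.
have A0 : 0 <= A by rewrite mulr_ge0 ?powR_ge0// ltW.
have C10 : 0 <= C1 by rewrite mulr_ge0 ?powR_ge0// ltW.
have Li := L1_itv uv.
pose U t := C1 * (J2 t * ppow 0 (P - t)) - A * (if u <= t <= v then 1 else 0).
have LU : L1 mu U by apply: L1B; exact: L1Z.
apply: (@le_lt_trans _ _ (\int[mu]_t U t)); last first.
  rewrite /U (RintB (L1Z C1 LJ2) (L1Z A Li)) (RintZ _ Li) (RintZ _ LJ2) Rint_itv//.
  rewrite subr_lt0; apply: (@le_lt_trans _ _ (C1 * (s^-1 * (P - b0)))).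
    by rewrite ler_wpM2l.
  rewrite b0P /A /C1.
  have Ps : 0 < P `^ (s - 1) by rewrite powR_gt0.
  have h1 : (P / 4) `^ (s - 1) <= P `^ (s - 1) * 4.
    rewrite powRM ?(ltW P0)// ler_wpM2l ?powR_ge0//.
    rewrite -[4^-1]powR_inv1// -powRrM -[leRHS]powRr1//.
    by apply: ler_powR; [rewrite ler1n|have := s0; lra].
  apply: (@le_lt_trans _ _ (P `^ (s - 1) * 4 * M0 * (s^-1 * D))).
    apply: ler_wpM2r; first by rewrite mulr_ge0 ?invr_ge0// ltW.
    by apply: ler_wpM2r; [exact: ltW|exact: h1].
  rewrite (_ : P `^ (s - 1) * 4 * M0 * (s^-1 * D) = P `^ (s - 1) * (4 * M0 * d * P / s)); last first.
    by rewrite /D; move: (P `^ _) => *; ring.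
  rewrite -[ltRHS]mulrA ltr_pM2l// ltr_pdivrMr// /u /v.
  have := dB; rewrite -(ltr_pM2r P0) => dBP.
  have -> : m0 * (P * 3 / 4 - P * 5 / 8) * s = s * m0 * P / 8 by field.
  by rewrite ltr_pdivlMr//; move: dBP; lra.
apply: Rint_le => //; first exact: Lh.
move=> t; rewrite /U.
have JJ x y : 0 <= C1 * (J2 x * ppow 0 y) by rewrite mulr_ge0// mulr_ge0// ppow_ge0.
have [tr|rt] := leP t r.
  rewrite ppow_mul0 ?subr_le0// ifF ?mulr0 ?subr0//.
  apply/negbTE; rewrite negb_and -!ltNge; apply/orP; left.
  by move: tr rP; rewrite /u; have := P0; lra.
have t0 : 0 < t by rewrite (le_lt_trans r0).
have tr0 : 0 < t - r by rewrite subr_gt0.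
have [Pt|tP] := leP P t.
  rewrite h_out// mulr0 [ppow 0 _]ppow0 ?subr_le0// !mulr0 ifF ?mulr0 ?subr0//.
  apply/negbTE; rewrite negb_and -!ltNge; apply/orP; right.
  by move: Pt; rewrite /v; have := P0; lra.
rewrite hE ?t0//; case: ifPn => [/andP[ut tv]|_].
  have tb0 : t <= b0 by move: tv; rewrite /v /b0; have := D8; have := P0; lra.
  rewrite J2_out// mul0r mulr0 !sub0r mulr1 mulrN mulrN lerN2 ppowE//.
  have t12 : P / 2 <= t <= P by rewrite (ltW tP) andbT; move: ut; rewrite /u; have := P0; lra.
  have /andP[tm tM] := mM t12.
  rewrite /A; apply: ler_pM; rewrite ?powR_ge0 ?(ltW m00)//.
    by apply: powR_le_anti => //; move: r0 tP; lra.
  by rewrite -[leLHS]mulr1; apply: ler_pM; rewrite ?(ltW m00)// J1_ge1.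
rewrite mulr0 subr0.
have [tb0|b0t] := leP t b0.
  rewrite J2_out// mul0r mulr0 sub0r mulrN mulrN oppr_le0.
  by rewrite mulr_ge0 ?ppow_ge0// mulr_ge0 ?powR_ge0.
rewrite [ppow 0 _]ppowE ?subr_gt0// powRr0 mulr1 ppowE// /C1.
have /andP[tm tM] := mM (b2P (ltW b0t) tP).
apply: (@le_trans _ _ ((t - r) `^ (s - 1) * (t `^ b * J2 t))).
  apply: ler_wpM2l; first exact: powR_ge0.
  by apply: ler_wpM2l; [exact: powR_ge0|rewrite gerBl].
rewrite -[leRHS]mulrA; apply: ler_pM; rewrite ?mulr_ge0 ?powR_ge0//.
  apply: powR_le_anti => //; first by rewrite divr_gt0.
  by move: b0t rP; rewrite /b0; have := D8; have := P0; lra.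
exact: ler_wpM2r.
Qed.

End sign_estimates.

(** * Bumps with unit potential at P *)

Section normalized_bump.
Context {R : realType}.
Local Notation mu := (@lebesgue_measure R).
Variables (e s P p r : R).
Hypothesis s01 : 0 < s < 1.
Hypothesis p0 : 0 < p.
Hypothesis pr : p < r.
Hypothesis rP : r < P.

(** Used with e = a - 1, the weight that [absum_pot] puts in front of f. *)
Definition wbump (q : R) : R := ppow e q * bump p r q.

Lemma measurable_wbump : measurable_fun setT wbump.
Proof.
apply: measurable_funM; first exact: measurable_ppow.
exact: continuous_measurable_fun (Bk_continuous (Bk_bump 0 p r)).
Qed.

Lemma wbump_ge0 q : 0 <= wbump q.
Proof. by rewrite mulr_ge0 ?ppow_ge0 ?bump_ge0. Qed.

Lemma wbump_out q : ~~ (p < q < r) -> wbump q = 0.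
Proof. by move=> out; rewrite /wbump bump_out ?mulr0. Qed.

Lemma wbump_bound : exists C, forall q, wbump q <= C.
Proof.
have [M M0 BM] := Bk_bound (Bk_bump 0 p r).
(* q^e is monotone, so the sum of its end values bounds it for either sign of e. *)
exists ((p `^ e + r `^ e) * M) => q.
have C0 : 0 <= (p `^ e + r `^ e) * M by rewrite mulr_ge0// addr_ge0 ?powR_ge0.
have [/andP[pq qr]|/wbump_out ->//] := boolP (p < q < r).
have q0 : 0 < q by rewrite (lt_trans p0).
rewrite /wbump ppowE//; apply: ler_pM; rewrite ?powR_ge0 ?bump_ge0//; last first.
  by rewrite (le_trans (ler_norm _)).
have [e0|e0] := leP 0 e.
  by rewrite (le_trans (powR_le e0 (ltW q0) (ltW qr)))// lerDr powR_ge0.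
by rewrite (le_trans (powR_le_anti (ltW e0) p0 (ltW pq)))// lerDl powR_ge0.
Qed.

Lemma L1_wbump t : L1 mu (fun q => wbump q * ppow (s - 1) (t - q)).
Proof.
have [C wC] := wbump_bound.
exact: (L1_pot s01 measurable_wbump wbump_ge0 wC wbump_out).
Qed.

Lemma pot_wbump_gt0 : 0 < pot s wbump P.
Proof.
apply: Rint_gt0 (L1_wbump P) _ _.
  by move=> q; rewrite mulr_ge0 ?wbump_ge0 ?ppow_ge0.
rewrite (_ : [set x | _] = `]p, r[%classic); last first.
  apply/seteqP; split=> t /=; rewrite in_itv/=.
    by apply: contraNT => /wbump_out ->; rewrite mul0r.
  move=> /andP[pt tr]; have t0 : 0 < t by rewrite (lt_trans p0).
  have tP : t < P by rewrite (lt_trans tr).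
  have tP0 : 0 < P - t by rewrite subr_gt0.
  rewrite gt_eqF//; apply: mulr_gt0; last by rewrite ppowE// powR_gt0.
  by apply: mulr_gt0; [rewrite ppowE// powR_gt0|exact: bump_gt0].
suff : (mu `]p, r[%classic != 0)%E by [].
by rewrite lebesgue_measure_itv/= lte_fin pr gt_eqF// -EFinB lte_fin subr_gt0.
Qed.

Definition nbump (q : R) : R := (pot s wbump P)^-1 * wbump q.

Lemma measurable_nbump : measurable_fun setT nbump.
Proof. by apply: measurable_funM => //; exact: measurable_wbump. Qed.

Lemma nbump_ge0 q : 0 <= nbump q.
Proof. by rewrite mulr_ge0 ?wbump_ge0// invr_ge0 ltW// pot_wbump_gt0. Qed.

Lemma nbump_out q : ~~ (p < q < r) -> nbump q = 0.
Proof. by move=> out; rewrite /nbump wbump_out// mulr0. Qed.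

Lemma nbump_bound : exists C, forall q, nbump q <= C.
Proof.
have [C wC] := wbump_bound; exists ((pot s wbump P)^-1 * C) => q.
by rewrite ler_wpM2l// invr_ge0 ltW// pot_wbump_gt0.
Qed.

Lemma pot_nbump : pot s nbump P = 1.
Proof.
rewrite /pot; under eq_Rintegral do rewrite -mulrA.
by rewrite (RintZ _ (L1_wbump P)) mulVf// gt_eqF// pot_wbump_gt0.
Qed.

End normalized_bump.

(** * Choice of the function f *)

Section sign_data.
Context {R : realType}.
Local Notation mu := (@lebesgue_measure R).
Variables (n : nat) (s P : R).
Hypothesis s01 : 0 < s < 1.
Hypothesis P0 : 0 < P.
Local Notation a := (n.+1%:R / 2 : R).
Let b := 1 - s - a.
Let s0 : 0 < s. Proof. by case/andP: s01. Qed.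
Let s1 : s < 1. Proof. by case/andP: s01. Qed.

Let powR_bounds : exists m0 M0 : R, 0 < m0 /\
  forall t, P / 2 <= t <= P -> m0 <= t `^ b <= M0.
Proof.
have P2 : P / 2 <= P by have := P0; lra.
have dp : {in `[(P / 2), P], forall x, derivable (@powR R ^~ b) x 1}.
  move=> x; rewrite in_itv/= => /andP[x1 _]; apply: derivable_powR.
  by rewrite in_itv/= andbT (lt_le_trans _ x1)// divr_gt0.
have cp := derivable_within_continuous dp.
have cn : {within `[(P / 2), P], continuous (fun t : R => - t `^ b)}.
  apply: derivable_within_continuous => x /dp d.
  exact: derivableN.
have [c1 _ h1] := EVT_max P2 cp.
have [c2 c2i h2] := EVT_max P2 cn.
exists (c2 `^ b), (c1 `^ b); split.
  move: c2i; rewrite in_itv/= => /andP[x1 _].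
  by rewrite powR_gt0// (lt_le_trans _ x1)// divr_gt0.
move=> t tP; rewrite -lerN2 h2 ?h1// in_itv//.
Qed.

(** Dividing each bump by its own potential at P makes q^(a-1) f a difference of two densities with
    potential 1 there, which gives H0(P) = 0. *)
Lemma sign_data : exists (f : R -> R) (b0 b1 : R),
  [/\ forall k, Bk k f,
      forall t, f t != 0 -> (P / 4 < t < P / 2) || (b0 < t < b1),
      [/\ P / 2 < b0, b0 < b1 & b1 < P],
      absum n s f P = 0 &
      [/\ forall r, P / 4 <= r <= P / 2 -> prof s (cutder n s P f) r < 0,
          forall r, b0 <= r <= b1 -> 0 < prof s (cutder n s P f) r &
          forall r, b1 <= r -> 0 <= prof s (cutder n s P f) r]].
Proof.
have [m0 [M0 [m00 mM]]] := powR_bounds.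
have M00 : 0 < M0.
  have /mM/andP[h1 h2] : P / 2 <= P <= P by rewrite lexx andbT; have := P0; lra.
  exact: lt_le_trans (lt_le_trans m00 h1) h2.
pose c0 : R := 2 `^ (1 - s) - (4 / 3) `^ (1 - s).
have c00 : 0 < c0.
  by rewrite subr_gt0; apply: gt0_ltr_powR; rewrite ?subr_gt0// ?nnegrE ?divr_ge0//; lra.
(* Half of the thresholds for d^s and d in [dA] and [dB], so that these hold strictly. The further
   bound 1/8 on d keeps b0 at or above 7P/8, away from the inner shell. *)
pose k1 := s * m0 * c0 / (16 * M0); pose k2 := s * m0 / (64 * M0).
have k10 : 0 < k1 by rewrite divr_gt0 ?mulr_gt0.
have k20 : 0 < k2 by rewrite divr_gt0 ?mulr_gt0.
pose d := Num.min 8^-1 (Num.min k2 (k1 `^ s^-1)).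
have d0 : 0 < d by rewrite !lt_min invr_gt0 ltr0n k20 powR_gt0.
have d8 : d <= 8^-1 by rewrite ge_min lexx.
have dk2 : d <= k2 by rewrite !ge_min lexx orbT.
have dk1 : d <= k1 `^ s^-1 by rewrite !ge_min lexx !orbT.
have dA : d `^ s * (8 * M0) < s * m0 * c0.
  have : d `^ s <= k1.
    rewrite (le_trans (powR_le (ltW s0) (ltW d0) dk1))// -powRrM mulVf ?gt_eqF//.
    by rewrite powRr1// ltW.
  rewrite ler_pdivlMr ?mulr_gt0// => h; apply: le_lt_trans (_ : s * m0 * c0 / 2 < _).
    by rewrite ler_pdivlMr//; move: h; lra.
  by rewrite gtr_pMr ?mulr_gt0// invf_lt1// ltr1n.
have dB : d * (32 * M0) < s * m0.
  move: dk2; rewrite ler_pdivlMr ?mulr_gt0// => h; apply: le_lt_trans (_ : s * m0 / 2 < _).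
    by rewrite ler_pdivlMr//; move: h; lra.
  by rewrite gtr_pMr ?mulr_gt0// invf_lt1// ltr1n.
clear dk1 dk2; move: (d) d0 d8 dA dB => {}d d0 d8 dA dB.
pose D := d * P; pose b0 := P - D; pose b1 := b0 + d * D.
have D0 : 0 < D by exact: mulr_gt0.
have D8 : D <= P / 8 by rewrite /D mulrC ler_pM2l.
have dD8 : d * D <= D / 8 by rewrite mulrC ler_pM2l.
have dD0 : 0 < d * D by exact: mulr_gt0.
have P4 : 0 < P / 4 by rewrite divr_gt0.
have P42 : P / 4 < P / 2 by have := P0; lra.
have P2P : P / 2 < P by have := P0; lra.
have P2b : P / 2 < b0 by rewrite /b0; have := D8; have := P0; lra.
have b00 : 0 < b0 by have := P2b; have := P0; lra.
have b01 : b0 < b1 by rewrite /b1 ltrDl.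
have b1P : b1 < P by rewrite /b1 /b0; have := dD8; have := D0; lra.
pose phi1 := nbump (a - 1) s P (P / 4) (P / 2).
pose phi2 := nbump (a - 1) s P b0 b1.
have [C1 phiC1] := nbump_bound (a - 1) s01 P4 P42 P2P.
have [C2 phiC2] := nbump_bound (a - 1) s01 b00 b01 b1P.
have mphi1 := measurable_nbump (a - 1) s P (P / 4) (P / 2).
have mphi2 := measurable_nbump (a - 1) s P b0 b1.
have phi10 := nbump_ge0 (a - 1) s01 P4 P42 P2P.
have phi20 := nbump_ge0 (a - 1) s01 b00 b01 b1P.
have out1 := @nbump_out R (a - 1) s P (P / 4) (P / 2).
have out2 := @nbump_out R (a - 1) s P b0 b1.
have n1 := pot_nbump (a - 1) s01 P4 P42 P2P.
have n2 := pot_nbump (a - 1) s01 b00 b01 b1P.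
rewrite -/phi1 in phiC1 mphi1 phi10 out1 n1; rewrite -/phi2 in phiC2 mphi2 phi20 out2 n2.
pose j1 := pot s (wbump (a - 1) (P / 4) (P / 2)) P.
pose j2 := pot s (wbump (a - 1) b0 b1) P.
pose f q := j2^-1 * bump b0 b1 q + (- j1^-1) * bump (P / 4) (P / 2) q.
have Bf k : Bk k f by apply: Bk_lin; exact: Bk_bump.
have fE q : ppow (a - 1) q * f q = phi2 q - phi1 q.
  rewrite /f /phi2 /phi1 /nbump /wbump -/j1 -/j2.
  by move: (ppow _ _) (bump _ _ _) (bump _ _ _) => *; ring.
have L1p t := L1_pot s01 mphi1 phi10 phiC1 out1 t.
have L2p t := L1_pot s01 mphi2 phi20 phiC2 out2 t.
have fpot t : 0 < t -> absum n s f t = t `^ b * (pot s phi2 t - pot s phi1 t).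
  move=> t0; have [M _ fM] := Bk_bound (Bf 0).
  have mf := continuous_measurable_fun (Bk_continuous (Bf 0)).
  rewrite (absum_pot n s01 mf fM t0) -/b; congr (_ * _).
  rewrite -(RintB (L2p t) (L1p t)); apply: eq_Rint => q.
  by rewrite fE mulrBl.
have HP : absum n s f P = 0 by rewrite fpot// n1 n2 subrr mulr0.
have fsupp t : f t != 0 -> (P / 4 < t < P / 2) || (b0 < t < b1).
  apply: contraR; rewrite negb_or => /andP[t1 t2].
  by rewrite /f !bump_out// !mulr0 addr0.
have [M gK] := good_cutder n P s01 Bf.
pose h := prof 0 (cutder n s P f).
have hE t : 0 < t < P -> h t = t `^ b * (pot s phi2 t - pot s phi1 t).
  move=> /andP[t0 tP]; rewrite -fpot//; apply: (prof0_cutder s01 Bf HP).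
  by rewrite (ltW t0) (ltW tP).
have h_out t : P <= t -> h t = 0 by exact: prof_cutder_out.
have Lh r : 0 <= r -> L1 mu (fun t => ppow (s - 1) (t - r) * h t).
  by move=> r0; have [] := prof_abel s01 gK r0.
have gE r : 0 <= r -> prof s (cutder n s P f) r = s * \int[mu]_t (ppow (s - 1) (t - r) * h t).
  by move=> r0; have [] := prof_abel s01 gK r0.
have J1_ge1 t : P / 2 <= t <= P -> 1 <= pot s phi1 t.
  move=> /andP[t2 tP]; have t4 : P / 4 < t by rewrite (lt_le_trans P42).
  apply: le_trans (pot_lower s01 mphi1 phi10 phiC1 out1 n1 t2 tP).
  apply: (@le_trans _ _ (1 `^ (1 - s))); first by rewrite powR1.
  apply: powR_le; rewrite ?subr_ge0 ?(ltW s1)//.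
  by rewrite ler_pdivlMr ?subr_gt0// mul1r lerB.
have J1_le t : P / 2 < t -> t <= P -> pot s phi1 t <= ((P - P / 2) / (t - P / 2)) `^ (1 - s).
  exact: (pot_upper s01 mphi1 phi10 phiC1 out1 n1).
have J2_ge t : b1 <= t -> t <= P -> ((P - b0) / (t - b0)) `^ (1 - s) <= pot s phi2 t.
  exact: (pot_lower s01 mphi2 phi20 phiC2 out2 n2).
have J2_out t : t <= b0 -> pot s phi2 t = 0 by exact: (pot_out s out2).
have [LJ2 IJ2] := Rint_pot s01 mphi2 phi20 phiC2 out2 b1P n2.
have J10 t := pot_ge0 s phi10 t.
have J20 t := pot_ge0 s phi20 t.
exists f, b0, b1; split=> //; split=> [r r12|r r12|r br].
- rewrite gE; last by case/andP: r12 => r1 _; exact: le_trans (ltW P4) r1.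
  rewrite pmulr_rlt0//.
  exact: (profile_lt0 s01 P0 d0 d8 m00 mM dB J10 J1_ge1 J20 J2_out LJ2 IJ2 hE h_out Lh r12).
- rewrite gE; last by case/andP: r12 => r1 _; exact: le_trans (ltW b00) r1.
  rewrite pmulr_rgt0//.
  exact: (profile_gt0 s01 P0 d0 d8 m00 mM dA J10 J1_le J20 J2_ge hE h_out Lh r12).
- have r0 : 0 <= r by rewrite (le_trans _ br)// (le_trans (ltW b00))// ltW.
  rewrite gE// mulr_ge0 ?(ltW s0)//.
  exact: (profile_ge0 s01 P0 d0 d8 J1_le J2_ge hE h_out br).
Qed.

End sign_data.

(** * Calculus of continuously differentiable functions of several variables *)

Section class_C_calculus.
Context {R : realType}.
Variable n : nat.
Implicit Types (f g : 'rV[R]_n -> R) (x v : 'rV[R]_n).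

Lemma is_derive_line f x v (d : R) :
  is_derive (0 : R) 1 (fun h : R => f (h *: v + x)) d -> is_derive x v f d.
Proof.
have E : (fun h : R => h^-1 *: ((f \o shift x) (h *: v) - f x)) =
    (fun h : R => h^-1 *: (((fun h : R => f (h *: v + x)) \o shift 0) (h *: (1 : R)) -
      (fun h : R => f (h *: v + x)) 0)).
  apply/funext => h /=; rewrite scale0r add0r addr0.
  by rewrite [h *: (1 : R)]mulr1.
by move=> [dl ddl]; apply: DeriveDef; [rewrite /derivable E|rewrite /derive E].
Qed.

Lemma class_CS k f : class_C k.+1 f -> class_C k f.
Proof.
elim: k f => [|k IH] f [cf df]; split=> // i; have [d C] := df i.
by split=> //; exact: IH.
Qed.

Lemma class_C_cst k (p : R) : class_C k (fun _ : 'rV[R]_n => p).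
Proof.
elim: k p => [|k IH] p; split; try exact: cst_continuous; first by [].
move=> i; split=> [x|]; first exact: derivable_cst.
rewrite (_ : 'D_ _ _ = fun=> 0); first exact: IH.
by apply/funext => x; have d := is_derive_cst p x (delta_mx 0 i); rewrite derive_val.
Qed.

Lemma class_C_add k f g : class_C k f -> class_C k g -> class_C k (fun x => f x + g x).
Proof.
elim: k f g => [|k IH] f g [cf df] [cg dg]; split=> //.
- by move=> x; exact: (continuousD (cf x) (cg x)).
- by move=> x; exact: (continuousD (cf x) (cg x)).
move=> i; have [d1 C1] := df i; have [d2 C2] := dg i; split=> [x|].
  exact: derivableD.
have := IH _ _ C1 C2; congr class_C; apply/funext => x.
by rewrite -deriveD.
Qed.

Lemma class_C_mul k f g : class_C k f -> class_C k g -> class_C k (fun x => f x * g x).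
Proof.
elim: k f g => [|k IH] f g Cf Cg; have [cf df] := Cf; have [cg dg] := Cg; split=> //.
- by move=> x; exact: (continuousM (cf x) (cg x)).
- by move=> x; exact: (continuousM (cf x) (cg x)).
move=> i; have [d1 C1] := df i; have [d2 C2] := dg i; split=> [x|].
  exact: derivableM.
have := class_C_add (IH _ _ (class_CS Cf) C2) (IH _ _ (class_CS Cg) C1).
congr class_C; apply/funext => x.
by rewrite -[RHS]/('D_(delta_mx 0 i) (f * g) x) deriveM.
Qed.

Lemma continuous_coord i : continuous (fun x : 'rV[R]_n => x 0 i).
Proof. exact: coord_continuous. Qed.

Lemma class_C_coord k (p : R) i : class_C k (fun x : 'rV[R]_n => p * x 0 i).
Proof.
have c : continuous (fun x : 'rV[R]_n => p * x 0 i).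
  by move=> x; exact: (continuousM (@cst_continuous _ _ p x) (@continuous_coord i x)).
case: k => [|k]; split=> // j.
have d x : is_derive x (delta_mx 0 j) (fun x : 'rV[R]_n => p * x 0 i)
    (p * (delta_mx 0 j : 'rV[R]_n) 0 i).
  apply: is_derive_line.
  rewrite (_ : (fun h : R => _) =
    fun h => (p * (delta_mx 0 j : 'rV[R]_n) 0 i) * h + p * x 0 i).
    exact: is_derive_affine.
  by apply/funext => h; rewrite !mxE; ring.
split=> [x|]; first by have [] := d x.
rewrite (_ : 'D_ _ _ = fun=> p * (delta_mx 0 j : 'rV[R]_n) 0 i); first exact: class_C_cst.
by apply/funext => x; have dx := d x; rewrite derive_val.
Qed.

Lemma continuous_sq : continuous (@sq R n).
Proof.
have h (r : seq 'I_n) : continuous (fun x : 'rV[R]_n => \sum_(i <- r) x 0 i ^+ 2).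
  elim: r => [|i r IH] x.
    by under eq_fun do rewrite big_nil; exact: cst_continuous.
  under eq_fun do rewrite big_cons expr2.
  have ci := @continuous_coord i x.
  exact: (continuousD (continuousM ci ci) (IH x)).
exact: h.
Qed.

Lemma sq_line (h : R) x i : sq (h *: delta_mx 0 i + x) = h ^+ 2 + 2 * x 0 i * h + sq x.
Proof.
have d y : dotr (delta_mx 0 i) y = y 0 i.
  rewrite /dotr (bigD1 i)//= big1 ?addr0; first by rewrite mxE !eqxx mul1r.
  by move=> j ji; rewrite mxE (negbTE ji) andbF mul0r.
have s1 : sq (delta_mx 0 i : 'rV[R]_n) = 1.
  rewrite (_ : sq _ = dotr (delta_mx 0 i) (delta_mx 0 i)).
    by rewrite d mxE !eqxx.
  by apply: eq_bigr => j _; rewrite expr2.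
rewrite sqD sqZ s1 -[x in dotr _ x]scale1r dotrZ d.
by ring.
Qed.

(** The i-th partial derivative is psi'(|x|^2) 2 x_i, again a radial function times a coordinate, so
    the induction closes; working with |x|^2 avoids a singularity at the origin. *)
Lemma class_C_radial k (psi : R -> R) : (forall j, Ck j setT psi) ->
  class_C k (fun x : 'rV[R]_n => psi (sq x)).
Proof.
elim: k psi => [|k IH] psi Cpsi.
all: have [dpsi _] := Cpsi 0%N.
all: have d (t : R) : is_derive t 1 psi (derive1 psi t) by apply: derivable_derive1; exact: dpsi.
all: have c : continuous (fun x : 'rV[R]_n => psi (sq x)) by
  move=> x; apply: (@continuous_comp _ _ _ (@sq R n) psi);
  [exact: continuous_sq|exact: is_derive_continuous (d _)].
all: split=> //.
move=> i.
have dx x : is_derive x (delta_mx 0 i) (fun x : 'rV[R]_n => psi (sq x))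
    (derive1 psi (sq x) * (2 * x 0 i)).
  apply: is_derive_line.
  rewrite (_ : (fun h : R => _) = fun h => psi (h * h + (2 * x 0 i * h + sq x))); last first.
    by apply/funext => h; rewrite sq_line expr2 addrA.
  have d1 : is_derive (0 : R) 1 (fun h : R => 1 * (h * h) + 1 * (2 * x 0 i * h + sq x)) (2 * x 0 i).
    have d0 := is_derive_prod (is_derive_id (0 : R) (1 : R)) (is_derive_id (0 : R) (1 : R)).
    apply: is_derive_eq (is_derive_lin 1 1 d0 (is_derive_affine (2 * x 0 i) (sq x) 0)) _.
    by rewrite mulr0 mul0r; ring.
  have d2 : is_derive (0 : R) 1 (fun h : R => h * h + (2 * x 0 i * h + sq x)) (2 * x 0 i).
    by move: d1; under eq_fun do rewrite !mul1r.
  have E : (0 : R) * 0 + (2 * x 0 i * 0 + sq x) = sq x by ring.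
  have := is_derive_comp1 (g := fun h : R => h * h + (2 * x 0 i * h + sq x)) (d _) d2.
  by rewrite E.
split=> [x|]; first by have [] := dx x.
rewrite (_ : 'D_ _ _ = fun x => derive1 psi (sq x) * (2 * x 0 i)); last first.
  by apply/funext => x; have d' := dx x; rewrite derive_val.
apply: class_C_mul; last exact: class_C_coord.
by apply: IH => j; have [] := Cpsi j.+1.
Qed.

End class_C_calculus.

(** * The solution *)

Section euclidean_ball.
Context {R : realType}.
Variable n : nat.
Implicit Types x y : 'rV[R]_n.

Lemma enorm_dist x y : `|enorm x - enorm y| <= enorm (x - y).
Proof.
have h (u v : 'rV[R]_n) : enorm u - enorm v <= enorm (u - v).
  by rewrite lerBlDr -{1}[u](subrK v); exact: enorm_triangle.
rewrite ler_norml h andbT lerNl opprB.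
by have := h y x; rewrite -(enormN (y - x)) opprB.
Qed.

Lemma continuous_enorm : continuous (@enorm R n).
Proof.
move=> x; apply: (@continuous_comp _ _ _ (@sq R n) Num.sqrt); first exact: continuous_sq.
exact: sqrt_continuous.
Qed.

Lemma sq_lt (rho : R) x : 0 < rho -> (sq x < rho ^+ 2) = (enorm x < rho).
Proof.
by move=> r0; rewrite -enorm_sqr ltr_pXn2r// nnegrE ?enorm_ge0// ltW.
Qed.

Lemma open_sq_gt (b : R) : open [set x : 'rV[R]_n | b < sq x].
Proof.
apply: (@open_comp _ _ (@sq R n) [set t | b < t]); last exact: open_gt.
by move=> x _; exact: continuous_sq.
Qed.

Lemma closed_sq_le (b : R) : closed [set x : 'rV[R]_n | sq x <= b].
Proof.
apply: (@closed_comp _ _ (@sq R n) [set t | t <= b]); last exact: closed_le.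
by move=> x _; exact: continuous_sq.
Qed.

Lemma open_eball (rho : R) : open (eball rho : set 'rV[R]_n).
Proof.
apply: (@open_comp _ _ (@enorm R n) [set t | t < rho]); last exact: open_lt.
by move=> x _; exact: continuous_enorm.
Qed.

Lemma sq_rot (Q : 'M[R]_n) x : Q *m Q^T = 1%:M -> sq (x *m Q) = sq x.
Proof.
have E y : sq y = (y *m y^T) 0 0.
  by rewrite mxE; apply: eq_bigr => i _; rewrite mxE expr2.
by move=> QQ; rewrite !E trmx_mul mulmxA -(mulmxA x) QQ mulmx1.
Qed.

Lemma sqr_le_norm x i : `|x 0 i| <= enorm x.
Proof.
rewrite -(@ler_pXn2r _ 2) ?nnegrE ?enorm_ge0// enorm_sqr (real_normK (num_real _)).
by rewrite /sq (bigD1 i)//= lerDl sumr_ge0// => j _; exact: sqr_ge0.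
Qed.

End euclidean_ball.

(** * Distance to the sphere *)

Section ball_boundary.
Context {R : realType}.
Variables (n : nat) (rho : R).
Hypothesis rho0 : 0 < rho.
Let B : set 'rV[R]_n.+1 := eball rho.
Let p : 'rV[R]_n.+1 := rho *: delta_mx 0 0.

Lemma sq_scale_delta (t : R) : sq (t *: delta_mx 0 0 : 'rV[R]_n.+1) = t ^+ 2.
Proof.
rewrite sqZ /sq (bigD1 ord0)//= big1 ?addr0; first by rewrite mxE !eqxx expr1n mulr1.
by move=> i i0; rewrite mxE (negbTE i0) andbF expr0n.
Qed.

Lemma boundary_ball_p : boundary B p.
Proof.
split; last first.
  move=> /interior_subset; rewrite /B /eball /= -sq_lt// sq_scale_delta.
  by rewrite ltxx.
move=> U Up.
have c : (fun t : R => t *: (delta_mx 0 0 : 'rV[R]_n.+1)) t @[t --> rho] --> p.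
  exact: scalel_continuous.
have /nbhs_ballP[e /= e0 he] : \forall t \near rho, U (t *: (delta_mx 0 0 : 'rV[R]_n.+1)) by exact: c.
pose t := rho - Num.min (e / 2) (rho / 2).
have m0 : 0 < Num.min (e / 2) (rho / 2) by rewrite lt_min !divr_gt0.
have tr : t < rho by rewrite ltrBlDr ltrDl.
have t0 : 0 < t.
  by rewrite subr_gt0 gt_min; apply/orP; right; have := rho0; lra.
exists (t *: delta_mx 0 0); split.
  rewrite /B /eball /= -sq_lt// sq_scale_delta ltr_pXn2r// nnegrE ltW//.
apply: he; rewrite /ball /= opprB addrC subrK gtr0_norm//.
by rewrite gt_min; apply/orP; left; have := e0; lra.
Qed.

(** A lower bound suffices because the distance stands in a denominator. The point [p] shows that
    the infimum is over a nonempty set. *)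
Lemma dist_boundary_ball x : rho - enorm x <= dist_to (boundary B) x.
Proof.
apply: lb_le_inf.
  by exists (enorm (x - p)), p => //; exact: boundary_ball_p.
move=> _ [y [_ yB] <-].
have ry : rho <= enorm y.
  rewrite leNgt; apply/negP => yr; apply: yB.
  by rewrite /interior; apply: open_nbhs_nbhs; split; [exact: open_eball|].
have := enorm_dist x y; rewrite distrC => h.
by have := le_trans (ler_norm _) h; move: ry; lra.
Qed.

End ball_boundary.

(** * Properties of V and u *)

Section assembly.
Context {R : realType}.
Local Notation mu := (@lebesgue_measure R).
Variables (n : nat) (s rho : R).
Hypothesis s01 : 0 < s < 1.
Hypothesis rho0 : 0 < rho.
Let P := rho ^+ 2.
Let P0 : 0 < P. Proof. exact: exprn_gt0. Qed.
Let s0 : 0 < s. Proof. by case/andP: s01. Qed.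
Variables (f : R -> R) (b0 b1 : R).
Hypothesis Bf : forall k, Bk k f.
Hypothesis fsupp : forall t, f t != 0 -> (P / 4 < t < P / 2) || (b0 < t < b1).
Hypothesis Pb0 : P / 2 < b0.
Hypothesis b01 : b0 < b1.
Hypothesis b1P : b1 < P.
Hypothesis HP : absum n s f P = 0.
Local Notation K := (cutder n s P f).
Local Notation g := (prof s K).
Hypothesis g_neg : forall r, P / 4 <= r <= P / 2 -> g r < 0.
Hypothesis g_pos : forall r, b0 <= r <= b1 -> 0 < g r.
Implicit Types x y : 'rV[R]_n.+1.

Lemma prof_ne0 r : f r != 0 -> g r != 0.
Proof.
move=> /fsupp/orP[/andP[r1 r2]|/andP[r1 r2]].
  by rewrite lt_eqF// g_neg// (ltW r1) ltW.
by rewrite gt_eqF// g_pos// (ltW r1) ltW.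
Qed.

(** Two open sets cover the line. On U1, inside (0, P), g = (P - r)^(s+1) W(r) with both factors
    smooth and nonzero. U2 is the complement of the closed shells; there f is 0, and so is the
    quotient, even where g vanishes. *)
Lemma Ck_quotient (lam : R) k : Ck k setT (fun r => lam * f r / g r).
Proof.
pose W := innerprof n s P f.
have BW := Bk_innerprof n P s01 Bf.
pose U1 : set R := [set r | W r != 0] `&` ([set r | 0 < r] `&` [set r | r < P]).
have oU1 : open U1.
  apply: openI; last by apply: openI; [exact: open_gt|exact: open_lt].
  apply: (@open_comp _ _ W [set t | t != 0]); last exact: open_neq.
  by move=> r _; exact: (Bk_continuous (BW 0)).
pose U2 : set R := [set r | r < P / 4] `|` ([set r | P / 2 < r] `&` [set r | r < b0] `|` [set r | b1 < r]).
have oU2 : open U2.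
  apply: openU; first exact: open_lt.
  by apply: openU; [apply: openI; [exact: open_gt|exact: open_lt]|exact: open_gt].
have gW r : 0 <= r < P -> g r = (P - r) `^ (s + 1) * W r.
  exact: (prof_innerprof n s01 Bf).
have U12 : U1 `|` U2 = setT.
  apply/seteqP; split=> // r _.
  have [r1|r1] := ltP r (P / 4); first by right; left.
  have rp : 0 < r by rewrite (lt_le_trans _ r1)// divr_gt0.
  have [r2|r2] := leP r (P / 2).
    have rP : r < P by rewrite (le_lt_trans r2)// ltr_pdivrMr// ltr_pMr// ltr1n.
    left; split=> //=; apply/negP => /eqP W0.
    have : g r < 0 by rewrite g_neg// r1.
    by rewrite gW ?(ltW rp)// W0 mulr0 ltxx.
  have [r3|r3] := ltP r b0; first by right; right; left.
  have [r4|r4] := leP r b1; last by right; right; right.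
  have rP : r < P by rewrite (le_lt_trans r4).
  left; split=> //=; apply/negP => /eqP W0.
  have : 0 < g r by rewrite g_pos// r3.
  by rewrite gW ?(ltW rp)// W0 mulr0 ltxx.
rewrite -U12; apply: Ck_setU; last first.
  apply: (Ck_eq oU2 _ (Ck_cst k U2 0)) => r rU.
  have -> : f r = 0.
    apply/eqP; apply: contraT => /fsupp fr; exfalso.
    case: rU => [|[[]|]] /=.
    + move=> r1; move: fr => /orP[/andP[r2 _]|/andP[r2 _]].
        by have := lt_trans r1 r2; rewrite ltxx.
      by move: r1 r2; have := Pb0; have := P0; lra.
    + move=> r1 r2; move: fr => /orP[/andP[_ r3]|/andP[r3 _]].
        by have := lt_trans r1 r3; rewrite ltxx.
      by have := lt_trans r2 r3; rewrite ltxx.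
    + move=> r1; move: fr => /orP[/andP[_ r3]|/andP[_ r3]].
        by move: r1 r3; have := Pb0; have := b01; lra.
      by have := lt_trans r1 r3; rewrite ltxx.
  by rewrite mulr0 mul0r.
have CP : Ck k U1 (fun r => (P - r) `^ (s + 1)).
  by apply: Ck_sub (Ck_powRB k P (s + 1)) => r [_ []].
have Pn0 r : U1 r -> (P - r) `^ (s + 1) != 0.
  by move=> [_ [_ /= rP]]; rewrite gt_eqF// powR_gt0// subr_gt0.
have Wn0 r : U1 r -> W r != 0 by case.
have CW := Ck_Bk oU1 (BW k).
have Cf := Ck_Bk oU1 (Bf k).
have := Ck_mul oU1 (Ck_mul oU1 (Ck_cst k U1 lam) Cf)
  (Ck_mul oU1 (Ck_inv oU1 Pn0 CP) (Ck_inv oU1 Wn0 CW)).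
apply: Ck_eq => // r [_ [/= r0 rP]].
by rewrite gW ?(ltW r0)// invfM.
Qed.

Lemma test_function_quotient (lam : R) :
  test_function (eball rho) (fun x => lam * f (sq x) / g (sq x)).
Proof.
have Vb : closure [set x : 'rV[R]_n.+1 | lam * f (sq x) / g (sq x) != 0] `<=`
    [set x | sq x <= b1].
  have h : [set x : 'rV[R]_n.+1 | lam * f (sq x) / g (sq x) != 0] `<=`
      [set x | sq x <= b1]; last first.
    move=> x /(closure_subset h).
    by rewrite -((closure_id _).1 (@closed_sq_le R n.+1 b1)).
  move=> x /=; apply: contraR; rewrite -ltNge => bx.
  have -> : f (sq x) = 0.
    apply/eqP; apply: contraT => /fsupp /orP[/andP[_ r3]|/andP[_ r3]].
      by move: bx r3; have := Pb0; have := b01; lra.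
    by have := lt_trans bx r3; rewrite ltxx.
  by rewrite mulr0 mul0r.
split.
- by move=> k; exact: (@class_C_radial R n.+1 k (fun r => lam * f r / g r) (Ck_quotient lam)).
- apply: bounded_closed_compact; last exact: closed_closure.
  exists rho; split; first exact: num_real.
  move=> t rt x /Vb /= xb; apply: ltW; apply: le_lt_trans rt.
  have xr : enorm x < rho by rewrite -sq_lt// (le_lt_trans xb).
  rewrite [leLHS]/Num.norm /= mx_normrE; apply: bigmax_le; first exact: ltW.
  by move=> i _; rewrite (ord1 i.1) (le_trans (sqr_le_norm _ _))// ltW.
- by move=> x /Vb /= xb; rewrite /eball /= -sq_lt// (le_lt_trans xb).
Qed.

Lemma prof_hoelder r r' : 0 <= r -> 0 <= r' ->
  `|g r - g r'| <= (\int[mu]_t `|K t * ppow 0 t|) * `|r - r'| `^ s.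
Proof.
move=> r0 r'0; have [M gK] := good_cutder n P s01 Bf.
have Lr := L1_prof gK (ltW s0) r0; have L2 := L1_prof gK (ltW s0) r'0.
have L0 : L1 mu (fun t => K t * ppow 0 t).
  by apply: eq_L1 (L1_prof gK (lexx 0) (lexx 0)) => t; rewrite subr0.
rewrite /prof -(RintB Lr L2) mulrC -(RintZ _ (L1_norm L0)).
apply: (@Rint_norm_le _ _ _ mu _ (fun t => `|r - r'| `^ s * `|K t * ppow 0 t|)).
- exact: (L1_measurable (L1B Lr L2)).
- by apply: L1Z; exact: L1_norm.
move=> t; have [t0|t0] := leP t 0.
  have z q : 0 <= q -> ppow s (t - q) = 0.
    by move=> q0; rewrite ppow0// subr_le0 (le_trans t0).
  by rewrite !z// !mulr0 subrr normr0 mulr_ge0 ?powR_ge0.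
rewrite [ppow 0 t]ppowE// powRr0 mulr1 -mulrBr normrM mulrC ler_wpM2r//.
apply: le_trans (pw_hoelder s01 _ _) _.
by rewrite (_ : t - r - (t - r') = - (r - r')) ?normrN//; ring.
Qed.

Lemma hoelder_prof : hoelder_space s (fun x => g (sq x)).
Proof.
have [M gK] := good_cutder n P s01 Bf.
split; first by exists (M * Gam s) => x; apply: (prof_bound gK (ltW s0)); exact: sq_ge0.
pose I := \int[mu]_t `|K t * ppow 0 t|.
have I0 : 0 <= I by exact: Rint_ge0.
exists (I * (2 * rho) `^ s) => x y.
(* |x|^2 is not globally Lipschitz. Clamping |x| at rho leaves u unchanged, since g vanishes from P
   on, and makes the square Lipschitz with constant 2 rho. *)
pose e x := Num.min (enorm x) rho.
have e0 z : 0 <= e z by rewrite le_min enorm_ge0 ltW.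
have er z : e z <= rho by rewrite ge_min lexx orbT.
have uE z : g (sq z) = g (e z ^+ 2).
  rewrite /e; have [zr|rz] := leP (enorm z) rho; first by rewrite enorm_sqr.
  rewrite !(prof_cutder_out n s f s)//.
  by rewrite -enorm_sqr /P ler_pXn2r ?nnegrE ?enorm_ge0 ?(ltW rho0) ?(ltW rz).
rewrite !uE; apply: le_trans (prof_hoelder (sqr_ge0 _) (sqr_ge0 _)) _.
rewrite -mulrA; apply: ler_wpM2l => //.
rewrite -powRM ?enorm_ge0 ?mulr_ge0 ?(ltW rho0)//.
apply: powR_le; rewrite ?(ltW s0)//.
rewrite subr_sqr normrM mulrC; apply: ler_pM => //.
  by rewrite ger0_norm ?addr_ge0// mulr2n mulrDl !mul1r lerD.
apply: le_trans (enorm_dist x y).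
rewrite /e; have [h1|h1] := leP (enorm x) rho; have [h2|h2] := leP (enorm y) rho => //.
- rewrite !ler0_norm ?subr_le0 ?(ltW (le_lt_trans h1 h2))// lerN2 lerD2l lerN2.
  exact: ltW.
- rewrite !ger0_norm ?subr_ge0 ?(ltW (le_lt_trans h2 h1))// lerD2r.
  exact: ltW.
- by rewrite subrr normr0.
Qed.

Lemma is_fractional_laplacian_prof (c : R) x : eball rho x ->
  is_fractional_laplacian c s (fun x => g (sq x)) x
    (c * (Gam s * Num.sqrt pi ^+ n.+1 / (Gam (n.+1%:R / 2 + s - 1) * Gam 0) *
      (s^-1 * Bet (s - 1) (- s) * f (sq x)))).
Proof.
move=> Bx; have xP : 0 <= sq x < P by rewrite sq_ge0 /P sq_lt.
have [M gK] := good_cutder n P s01 Bf.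
have P40 : 0 < P / 4 by rewrite divr_gt0.
have f0 t : t < P / 4 -> f t = 0.
  move=> t4; apply/eqP; apply: contraT => /fsupp /orP[/andP[r1 _]|/andP[r1 _]].
    by have := lt_trans t4 r1; rewrite ltxx.
  by move: t4 r1; have := Pb0; have := P0; lra.
have I := ident_general s01 x gK (continuous_cutder s01 Bf).
rewrite -(Efun_cutder s01 P40 Bf f0 HP xP) -I.
have [C C0 hC] := second_diff_bound s01 x.
apply: (is_fractional_laplacian_sym s01 (M := M * Gam s) (C := M * C)).
- by apply: measurable_prof; case: gK.
- by move=> r r0; exact: (prof_bound gK (ltW s0) r0).
- by move=> y; exact: hC.
Qed.

Lemma prof_decay : exists2 C, 0 <= C &
  forall r, 0 <= r < P -> `|g r| <= C * (P - r) `^ (s + 1).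
Proof.
have [C C0 hC] := Bk_bound (Bk_innerprof n P s01 Bf 0).
exists C => // r rP; rewrite (prof_innerprof n s01 Bf rP) normrM mulrC.
by rewrite (ger0_norm (powR_ge0 _ _)) ler_wpM2r ?powR_ge0.
Qed.

(** P - |x|^2 <= 2 rho (rho - |x|) and the distance is at least rho - |x|, so vanishing to order s +
    1 leaves a quotient bounded by a multiple of rho - |x|. *)
Lemma cvg_prof_dist :
  g (sq x) / dist_to (boundary (eball rho)) x `^ s
    @[x --> within (eball rho) (nbhs (rho *: delta_mx 0 0 : 'rV[R]_n.+1))] --> 0.
Proof.
set p : 'rV[R]_n.+1 := rho *: delta_mx 0 0.
have [C C0 hC] := prof_decay.
have pE : enorm p = rho by rewrite /enorm -/(sq p) sq_scale_delta sqrtr_sqr ger0_norm// ltW.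
pose A := C * (2 * rho) `^ (s + 1).
have A0 : 0 <= A by rewrite mulr_ge0 ?powR_ge0.
have key x : eball rho x ->
    `|g (sq x) / dist_to (boundary (eball rho)) x `^ s| <= A * (rho - enorm x).
  move=> Bx; have d0 : 0 < rho - enorm x by rewrite subr_gt0.
  have dd := dist_boundary_ball rho0 x.
  have D0 := lt_le_trans d0 dd.
  have xP : 0 <= sq x < P by rewrite sq_ge0 /P sq_lt.
  rewrite normrM normfV (ger0_norm (powR_ge0 _ _)) ler_pdivrMr ?powR_gt0//.
  apply: (le_trans (hC _ xP)).
  apply: (@le_trans _ _ (A * (rho - enorm x) * (rho - enorm x) `^ s)); last first.
    by apply: ler_wpM2l; [rewrite mulr_ge0// ltW|exact: (powR_le (ltW s0) (ltW d0) dd)].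
  have -> : A * (rho - enorm x) * (rho - enorm x) `^ s =
      C * ((2 * rho) * (rho - enorm x)) `^ (s + 1).
    rewrite powRM ?mulr_ge0 ?(ltW rho0) ?(ltW d0)// [X in _ = _ * (_ * X)](powR_add _ _ d0).
    by rewrite powRr1 ?(ltW d0)// /A; move: (_ `^ _) (_ `^ _) => *; ring.
  apply: ler_wpM2l => //; apply: powR_le.
  - by rewrite addr_ge0// ltW.
  - by case/andP: xP => _ xP; rewrite subr_ge0 ltW.
  - rewrite -enorm_sqr /P subr_sqr mulrC; apply: ler_wpM2r; first exact: ltW.
    by move: Bx; rewrite /eball /= => Bx; have := rho0; lra.
apply/cvgr0Pnorm_le => e e0.
have c : rho - enorm x @[x --> p] --> (0 : R).
  have -> : 0 = rho - enorm p by rewrite pE subrr.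
  exact: (continuousB (@cst_continuous _ _ rho p) (@continuous_enorm R n.+1 p)).
have eA : 0 < e / (A + 1) by rewrite divr_gt0// ltr_wpDl.
have h : \forall x \near p, rho - enorm x <= e / (A + 1).
  by apply: (cvgr_le _ c); exact: eA.
move: h; rewrite /within /=; apply: filterS => x xe Bx.
apply: (le_trans (key x Bx)); have d0 : 0 < rho - enorm x by rewrite subr_gt0.
apply: (@le_trans _ _ ((A + 1) * (rho - enorm x))).
  by apply: ler_wpM2r; [exact: ltW|rewrite lerDl].
by rewrite mulrC -ler_pdivlMr// ltr_wpDl.
Qed.

End assembly.

(* The dimension is n.+1 >= 1, and c > 0 is the normalization constant. *)
Theorem theorem1p14 (R : realType) (n : nat) (s rho c : R)
    (hs : 0 < s < 1) (hrho : 0 < rho) (hc : 0 < c) :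
  let B : set 'rV[R]_n.+1 := eball rho in
  let p : 'rV[R]_n.+1 := rho *: delta_mx 0 0 in
  exists V u : 'rV[R]_n.+1 -> R,
    test_function B V /\
    hoelder_space s u /\
    (forall x, B x -> is_fractional_laplacian c s u x (V x * u x)) /\
    (forall x, ~ B x -> u x = 0) /\
    (exists2 N : set 'rV[R]_n.+1, nbhs p N &
      (exists2 x, (N `&` B) x & u x != 0) /\
      ((forall x, (N `&` B) x -> 0 <= u x) \/
       (forall x, (N `&` B) x -> u x <= 0))) /\
    u x / dist_to (boundary B) x `^ s @[x --> within B (nbhs p)] --> 0 /\
    rotationally_symmetric u.
Proof.
move=> B p.
have P0 : 0 < rho ^+ 2 by exact: exprn_gt0.
have [f [b0 [b1 [Bf fsupp [Pb0 b01 b1P] HP [g_neg g_pos g_ge0]]]]] := sign_data n hs P0.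
have b00 : 0 < b0 by rewrite (lt_trans _ Pb0)// divr_gt0.
pose g := prof s (cutder n s (rho ^+ 2) f).
(* The product of the normalization c, the constant of [Ident] and the constant of the Abel
   inversion. *)
pose lam := c * (Gam s * Num.sqrt pi ^+ n.+1 / (Gam (n.+1%:R / 2 + s - 1) * Gam 0) *
  (s^-1 * Bet (s - 1) (- s))).
exists (fun x => lam * f (sq x) / g (sq x)), (fun x => g (sq x)).
have gP x : ~ B x -> g (sq x) = 0.
  move=> Bx; apply: prof_cutder_out; rewrite leNgt; apply/negP.
  by rewrite sq_lt// => xr; exact: Bx.
split; first exact: (test_function_quotient hs hrho Bf fsupp Pb0 b01 b1P g_neg g_pos).
split; first exact: (hoelder_prof n hs hrho Bf).
split.
  move=> x Bx.
  have -> : lam * f (sq x) / g (sq x) * g (sq x) = lam * f (sq x).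
    (* Where f vanishes both sides are 0, whatever g is; elsewhere g is nonzero by the sign
       estimates. *)
    have [f0|/(prof_ne0 fsupp g_neg g_pos) gn0] := eqVneq (f (sq x)) 0.
      by rewrite f0 !(mulr0, mul0r).
    by rewrite divfK.
  rewrite /lam -(mulrA c) -(mulrA (Gam s * _ / _)).
  exact: (is_fractional_laplacian_prof hs hrho Bf fsupp Pb0 HP Bx).
split=> //; split.
  (* Past b0, g is positive on the outer shell and nonnegative beyond it. *)
  exists [set x | b0 < sq x].
    apply: open_nbhs_nbhs; split; first exact: open_sq_gt.
    by rewrite /= /p sq_scale_delta (lt_trans b01).
  split; last first.
    left=> x [/= bx Bx]; have [xb|xb] := leP (sq x) b1; last by apply: g_ge0; exact: ltW.
    by apply: ltW; apply: g_pos; rewrite (ltW bx).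
  (* A radius inside the outer shell, where g is positive, shows that u is not identically 0 on this
     neighbourhood. *)
  pose m := (b0 + b1) / 2.
  have m0 : b0 < m by rewrite /m; move: b01; lra.
  have m1 : m < b1 by rewrite /m; move: b01; lra.
  pose x : 'rV[R]_n.+1 := Num.sqrt m *: delta_mx 0 0.
  have xE : sq x = m by rewrite sq_scale_delta sqr_sqrtr// ltW// (lt_trans b00).
  exists x; last by rewrite xE gt_eqF//; apply: g_pos; rewrite !ltW.
  by split; rewrite /= ?xE// /B /eball /= -sq_lt// xE (lt_trans m1).
split; first exact: (cvg_prof_dist n hs hrho Bf).
by move=> Q QQ x; rewrite sq_rot.
Qed.
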